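(* Let $a,b\ge 2$ be integers, let $\delta,\rho\in(0,1)$, $t_1,\dots,t_a,s_1,\dots,s_b\in\mathbb{R}$, and let $\bm{I}=\{\delta x+t_i\}_{i=1}^a$ and $\bm{J}=\{\rho x+s_j\}_{j=1}^b$ be the corresponding iterated function systems on $\mathbb{R}$ with canonical mappings $\Phi_{\bm{I}}$ and $\Phi_{\bm{J}}$ (no separation condition is assumed). Let $\mu^+$ and $\nu^+$ be two $\sigma$-invariant probability measures on $\Sigma_a^+$ and $\Sigma_b^+$ respectively. If $\log\delta/\log\rho$ is irrational, then $$\underline{\dim}_H\, \pi(\Phi_{\bm{I}}(\mu^+)\times \Phi_{\bm{J}}(\nu^+))=\min\{1,\underline{\dim}_H\, \Phi_{\bm{I}}(\mu^+)\times \Phi_{\bm{J}}(\nu^+)\}$$ for all $\pi\in\Pi\setminus\{\pi_1,\pi_2\}$.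
   Context: For an integer $a\ge2$, $\Sigma_a^+=\{1,\dots,a\}^{\mathbb{N}}$ is the one-sided symbolic space with product topology and Borel $\sigma$-algebra, and $\sigma:i_1i_2\cdots\mapsto i_2i_3\cdots$ is the left shift (the same letter is used on $\Sigma_b^+$). For $\bm{I}=\{f_i\}_{i=1}^a$ the canonical mapping $\Phi_{\bm{I}}:\Sigma_a^+\to\mathbb{R}$ is $\Phi_{\bm{I}}(i_1i_2\cdots)=\lim_{n\to\infty}f_{i_1}\circ\cdots\circ f_{i_n}(0)$; $\Phi_{\bm{J}}:\Sigma_b^+\to\mathbb{R}$ is defined in the same way. For a measurable map $f$ and a measure $\lambda$, $f(\lambda)=\lambda\circ f^{-1}$ denotes the push-forward. $\Pi$ is the family of orthogonal projections from $\mathbb{R}^2$ to its $1$-dimensional linear subspaces, and $\pi_1,\pi_2\in\Pi$ are the horizontal and vertical projections (onto the two coordinate axes). The lower Hausdorff dimension of a measure $\lambda$ is $\underline{\dim}_H\lambda=\inf\{\dim_H E:\lambda(E)>0\}$, where $\dim_H$ is Hausdorff dimension and $E$ ranges over Borel sets. *)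

(* Defs.v *)
From HB Require Import structures.
From mathcomp Require Import all_boot all_order all_algebra.
From mathcomp Require Import all_classical all_reals all_analysis.

Set Implicit Arguments.
Unset Strict Implicit.
Unset Printing Implicit Defensive.

Import Order.TTheory GRing.Theory Num.Theory.
Import numFieldNormedType.Exports.

Local Open Scope classical_set_scope.
Local Open Scope ring_scope.

(* The alphabet {1, ..., a} is encoded as 'I_a = {0, ..., a - 1}, with the
   discrete topology. The proof of 2 <= a is a parameter of the type because
   library measurable types must be pointed. *)
Definition alphabet (a : nat) (ha : (2 <= a)%N) : Type := 'I_a.

Section alphabet_instances.
Variables (a : nat) (ha : (2 <= a)%N).

HB.instance Definition _ := Choice.copy (alphabet ha) 'I_a.
HB.instance Definition _ :=
  isPointed.Build (alphabet ha) (Ordinal (ltnW ha)).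
HB.instance Definition _ := hasNbhs.Build (alphabet ha) principal_filter.
HB.instance Definition _ := Discrete_ofNbhs.Build (alphabet ha) erefl.

End alphabet_instances.

Definition sequence_space (a : nat) (ha : (2 <= a)%N) : Type :=
  prod_topology (fun _ : nat => alphabet ha).

HB.instance Definition _ (a : nat) (ha : (2 <= a)%N) :=
  Topological.copy (sequence_space ha)
    (prod_topology (fun _ : nat => alphabet ha)).
HB.instance Definition _ (a : nat) (ha : (2 <= a)%N) :=
  Pointed.copy (sequence_space ha)
    (prod_topology (fun _ : nat => alphabet ha)).

Notation symbolic_space ha :=
  (g_sigma_algebraType (@open (sequence_space ha))).

Definition shift (a : nat) (ha : (2 <= a)%N) (w : symbolic_space ha) :
  symbolic_space ha := fun n => w n.+1.

Definition shift_invariant (R : realType) (a : nat) (ha : (2 <= a)%N)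
    (mu : set (symbolic_space ha) -> \bar R) : Prop :=
  forall A : set (symbolic_space ha),
    measurable A -> mu (@shift a ha @^-1` A) = mu A.

(* The n-th term of the sequence is f_{w 0} (f_{w 1} (... (f_{w (n-1)} 0))). *)
Definition canonical_map (R : realType) (a : nat) (ha : (2 <= a)%N)
    (f : 'I_a -> R -> R) (w : symbolic_space ha) : R :=
  lim ((fun n : nat => foldr (fun k x => f (w k) x) 0 (iota 0 n)) @ \oo).

Definition affine_ifs (R : realType) (a : nat) (r : R) (t : 'I_a -> R) :
  'I_a -> R -> R := fun i x => r * x + t i.

Section plane.
Variable R : realType.
Local Notation plane := (R * R)%type.

Definition inner (x y : plane) : R := x.1 * y.1 + x.2 * y.2.

Definition edist (x y : plane) : R := Num.sqrt (inner (x - y) (x - y)).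

Definition is_line (L : set plane) : Prop :=
  exists2 u : plane, u <> 0 & L = [set (c * u.1, c * u.2) | c in [set: R]].

Definition is_orthogonal_projection (L : set plane) (p : plane -> plane) :
    Prop :=
  forall x, L (p x) /\ forall y, L y -> inner (x - p x) y = 0.

Definition projections : set (plane -> plane) :=
  [set p | exists2 L, is_line L & is_orthogonal_projection L p].

Definition pi_horizontal (x : plane) : plane := (x.1, 0).

Definition pi_vertical (x : plane) : plane := (0, x.2).

Local Open Scope ereal_scope.

(* Equals -oo on the empty set. *)
Definition diameter (U : set plane) : \bar R :=
  ereal_sup [set (edist x.1 x.2)%:E | x in U `*` U].

(* The empty set contributes 0 also for s = 0; a singleton contributes
   0 `^ 0 = 1, so that the 0-dimensional measure is the counting measure. *)
Definition diameter_power (s : R) (U : set plane) : \bar R :=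
  if `[< U = set0 >] then 0 else diameter U `^ s.

Definition hausdorff_premeasure (s e : R) (E : set plane) : \bar R :=
  ereal_inf [set \sum_(n <oo) diameter_power s (U n) |
    U in [set U : nat -> set plane |
      E `<=` \bigcup_n U n /\ forall n, diameter (U n) <= e%:E]].

Definition hausdorff_measure (s : R) (E : set plane) : \bar R :=
  ereal_sup [set hausdorff_premeasure s e E | e in [set e : R | (0 < e)%R]].

Definition hausdorff_dim (E : set plane) : \bar R :=
  ereal_inf [set s%:E |
    s in [set s : R | (0 <= s)%R /\ hausdorff_measure s E = 0]].

Definition lower_hausdorff_dim (m : set plane -> \bar R) : \bar R :=
  ereal_inf [set hausdorff_dim E |
    E in [set E : set plane | measurable E /\ 0 < m E]].

End plane.

(* Main.v *)
(* Write the projection as (x, y) |-> x + c y up to scaling, and put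
   theta = log delta / log rho. Cut the two codes into blocks of N letters and
   of about N theta letters. By self-similarity, a block seen after its past is
   projected with slope c u = c rho^(- {u N theta}) up to a constant factor; as
   theta is irrational, an arc of length l contains at most O(l J) of the first
   J slopes, and averaging Marstrand's projection argument over u < J shows that for most u the block measure,
   Frostman with exponent s1 at scale delta^N, projects to a measure whose
   delta^N-balls have mass at most delta^(N s1) up to small losses.
   Subadditivity of entropy makes most blocks almost independent of their past
   (the ratio of conditional and unconditional probabilities is at most
   exp (eps N)), uniformly in the past. Hence, after a start j from which few
   blocks are irregular, the mass of a ball of radius delta^(N n) is at most
   2^n times the product of the block bounds, that is, at most radius^s0 for
   s0 < s1. Starts may be replaced by boundedly many ones, by compactness of
   the set of slopes, which bounds the projected measure of any union of balls
   by a small eta plus a constant times the sum of the radii to the power s0.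
   The Frostman bound comes from discarding the heavy dyadic cells, whose upper
   limit is a null set when s1 is smaller than the lower dimension.

   For the upper bound, the projected measure lives on a segment, and the
   projection of a null set is contained in a measurable null set. *)

Require Import Defs.
From mathcomp Require Import all_boot all_order all_algebra.
From mathcomp Require Import all_classical all_reals all_analysis.
From mathcomp Require Import ring lra zify.
From mathcomp Require Import measurable_realfun.

Set Implicit Arguments.
Unset Strict Implicit.
Unset Printing Implicit Defensive.

Import Order.TTheory GRing.Theory Num.Theory.
Import numFieldNormedType.Exports.

Local Open Scope classical_set_scope.
Local Open Scope ring_scope.

(** * Stationary word probabilities and their entropy *)

(** Neither measure is assumed ergodic, so nothing is proved along almost every orbit: each step
    compares expectations over words of one finite length, and stationarity is the only dynamical
    property of the measures that enters. The obstacle is the dependence on the past. Making a block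
    independent of it costs a factor [K] per coordinate, an irregular block is bounded trivially by
    1, and [2 ^+ n] counts these two alternatives at every block. Such losses are exponential in the
    number of blocks; they are affordable because one block gains a positive power of [d ^+ N] and
    [N] is fixed after the tolerances, so that each loss is at most a small negative power of
    [d ^+ N]. A start must serve every radius at once, hence every initial run of blocks; a covering
    argument of maximal-inequality type reduces this to the mean frequency of irregular blocks. The
    start depends on the family of balls, the final constant must not: this is what the
    approximation of slopes is for. Three exponents [s0 < s1 < sg] separate the tasks: [sg], below
    the lower dimension, gives null sets mass zero, [sg - s1] pays for the heavy cells, and
    [s1 - s0] for all losses along the blocks. *)

Section WordSums.
Variables (R : realType) (T : finType).
Implicit Types (n m : nat) (f g : seq T -> R) (u v w : seq T).

(** Words are plain lists whose length is enforced by the recursion, so that splitting, reversing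
    and exchanging sums needs no casts between tuple types. *)
Fixpoint wsum n f : R :=
  if n is n'.+1 then \sum_(x : T) wsum n' (fun u => f (x :: u)) else f [::].

Lemma eq_wsum n f g : (forall u, size u = n -> f u = g u) -> wsum n f = wsum n g.
Proof.
elim: n f g => [|n IH] f g fg /=; first exact: fg.
by apply: eq_bigr => x _; apply: IH => u su; apply: fg; rewrite /= su.
Qed.

Lemma le_wsum n f g :
  (forall u, size u = n -> f u <= g u) -> wsum n f <= wsum n g.
Proof.
elim: n f g => [|n IH] f g fg /=; first exact: fg.
by apply: ler_sum => x _; apply: IH => u su; apply: fg; rewrite /= su.
Qed.

Lemma wsumD n f g : wsum n (fun u => f u + g u) = wsum n f + wsum n g.
Proof.
elim: n f g => [|n IH] f g //=; rewrite -big_split /=.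
by apply: eq_bigr => x _; rewrite IH.
Qed.

Lemma wsumZ n c f : wsum n (fun u => c * f u) = c * wsum n f.
Proof.
elim: n f => [|n IH] f //=; rewrite mulr_sumr.
by apply: eq_bigr => x _; rewrite IH.
Qed.

Lemma wsumZr n c f : wsum n (fun u => f u * c) = wsum n f * c.
Proof. by rewrite mulrC -wsumZ; apply: eq_wsum => u _; rewrite mulrC. Qed.

Lemma wsumN n f : wsum n (fun u => - f u) = - wsum n f.
Proof. by rewrite -mulN1r -wsumZ; apply: eq_wsum => u _; rewrite mulN1r. Qed.

Lemma wsumB n f g : wsum n (fun u => f u - g u) = wsum n f - wsum n g.
Proof. by rewrite wsumD wsumN. Qed.

Lemma wsum_sum n (I : Type) (r : seq I) (P : pred I) (F : I -> seq T -> R) :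
  wsum n (fun u => \sum_(i <- r | P i) F i u) = \sum_(i <- r | P i) wsum n (F i).
Proof.
elim: n F => [|n IH] F //=; rewrite exchange_big /=.
by apply: eq_bigr => x _; rewrite IH.
Qed.

Lemma wsum_cat n m f :
  wsum (n + m) f = wsum n (fun u => wsum m (fun v => f (u ++ v))).
Proof. by elim: n f => [|n IH] f //=; apply: eq_bigr => x _; rewrite IH. Qed.

Lemma wsumSr n f : wsum n.+1 f = wsum n (fun u => \sum_(x : T) f (rcons u x)).
Proof. by rewrite -addn1 wsum_cat; apply: eq_wsum => u _ /=; under eq_bigr do rewrite cats1. Qed.

Lemma wsum_ge0 n f : (forall u, size u = n -> 0 <= f u) -> 0 <= wsum n f.
Proof.
move=> f0; apply: (@le_trans _ _ (wsum n (fun=> 0 * 0))).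
  by rewrite wsumZ mul0r.
by apply: le_wsum => u su; rewrite mul0r f0.
Qed.

Lemma le_term_wsum n f u0 : size u0 = n ->
  (forall u, size u = n -> 0 <= f u) -> f u0 <= wsum n f.
Proof.
elim: n f u0 => [|n IH] f [|x u] //= [su] f0.
rewrite (bigD1 x) //= ler_wpDr //; last first.
  by apply: (IH (fun u => f (x :: u))) => // v sv; apply: f0; rewrite /= sv.
apply: sumr_ge0 => y _; apply: wsum_ge0 => v sv; apply: f0.
by rewrite /= sv.
Qed.

Lemma wsum_cst n c : wsum n (fun=> c) = (#|T| ^ n)%:R * c.
Proof.
elim: n => [|n IH] /=; first by rewrite mul1r.
by rewrite IH sumr_const expnS natrM -mulrA [RHS]mulr_natl.
Qed.

End WordSums.

Lemma exchange_wsum (R : realType) (T S : finType) n m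
    (F : seq T -> seq S -> R) :
  wsum n (fun u => wsum m (F u)) = wsum m (fun v => wsum n (F^~ v)).
Proof.
elim: m F => [|m IH] F //=; rewrite wsum_sum.
by apply: eq_bigr => x _; rewrite IH.
Qed.

(** [stat_rcons] is the consistency of cylinder masses and [stat_cons] is shift invariance. With
    both on word probabilities, entropy and block arguments are finite sums without measure
    theory. *)
Record stationary (R : realType) (T : finType) (p : seq T -> R) : Prop := {
  stat_ge0 : forall u, 0 <= p u;
  stat_nil : p [::] = 1;
  stat_cons : forall u, \sum_(x : T) p (x :: u) = p u;
  stat_rcons : forall u, \sum_(x : T) p (rcons u x) = p u }.

Section StationaryWords.
Variables (R : realType) (T : finType) (p : seq T -> R).
Hypothesis sp : stationary p.
Implicit Types (n m : nat) (f : seq T -> R) (u v w : seq T).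

Lemma wsum_catl n v : wsum n (fun u => p (u ++ v)) = p v.
Proof.
elim: n v => [|n IH] v //=; rewrite -[RHS](stat_cons sp).
rewrite -[LHS](wsum_sum n _ _ (fun x u => p (x :: u ++ v))).
under eq_wsum do rewrite (stat_cons sp).
by rewrite IH (stat_cons sp).
Qed.

Lemma wsum_catr n u : wsum n (fun v => p (u ++ v)) = p u.
Proof.
elim: n u => [|n IH] u /=; first by rewrite cats0.
rewrite -[RHS](stat_rcons sp); apply: eq_bigr => x _.
by rewrite -IH; apply: eq_wsum => v _; rewrite cat_rcons.
Qed.

Lemma wsum_stat n : wsum n p = 1.
Proof. by rewrite -(stat_nil sp) -(wsum_catr n). Qed.

Lemma stat_catl_le u v : p (u ++ v) <= p v.
Proof.
rewrite -(wsum_catl (size u) v).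
by apply: (@le_term_wsum _ _ _ (fun u => p (u ++ v))) => // w _; apply: stat_ge0.
Qed.

Lemma stat_catr_le u v : p (u ++ v) <= p u.
Proof.
rewrite -[leRHS](wsum_catr (size v) u).
by apply: (@le_term_wsum _ _ _ (fun v => p (u ++ v))) => // w _; apply: stat_ge0.
Qed.

(** Invariance sums out the [l] letters before the window, consistency the [m] letters after it. *)
Lemma wsum_window l n m f :
  wsum (l + (n + m)) (fun u => p u * f (take n (drop l u))) =
  wsum n (fun u => p u * f u).
Proof.
rewrite wsum_cat exchange_wsum wsum_cat.
apply: eq_wsum => u su.
transitivity (wsum m (fun v => p (u ++ v) * f u)).
  apply: eq_wsum => v sv; rewrite -(wsum_catl l) -wsumZr.
  by apply: eq_wsum => w sw; rewrite -sw drop_size_cat// -su take_size_cat.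
by rewrite wsumZr wsum_catr.
Qed.

End StationaryWords.
Lemma exists_nat_ge (R : realType) (x : R) : exists n : nat, x <= n%:R.
Proof.
exists (Num.Def.archi_bound `|x|).
exact: ltW (le_lt_trans (ler_norm x) (Num.Theory.archi_boundP (normr_ge0 x))).
Qed.

(** The inequality ln z <= z - 1 at z = y / x. Summed over words it is Gibbs' inequality, and the
    last hypothesis is absolute continuity. *)
Lemma ln_gibbs (R : realType) (x y : R) :
  0 <= x -> 0 <= y -> (y = 0 -> x = 0) -> x - y <= x * (ln x - ln y).
Proof.
move=> x0 y0 yx; have [x00|x_neq0] := eqVneq x 0.
  by rewrite x00 sub0r mul0r oppr_le0.
have xp : 0 < x by rewrite lt_neqAle eq_sym x_neq0.
have yp : 0 < y.
  rewrite lt_neqAle y0 andbT; apply/eqP => y00.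
  by move: x_neq0; rewrite yx ?eqxx.
have : ln (1 + (y / x - 1)) <= y / x - 1.
  by apply: le_ln1Dx; have := divr_gt0 yp xp; lra.
rewrite (_ : 1 + (y / x - 1) = y / x) ?ln_div ?posrE//; last by ring.
rewrite -(ler_pM2l xp) mulrBr mulrBr mulrCA divff// !mulr1; lra.
Qed.

(** * Block entropy and mutual information with the past *)

Section BlockEntropy.
Variables (R : realType) (T : finType) (p : seq T -> R).
Hypothesis sp : stationary p.
Implicit Types (n m : nat) (u v w : seq T).

Let p0 u : 0 <= p u := stat_ge0 sp u.

Definition block_entropy n := wsum n (fun u => - (p u * ln (p u))).
Local Notation H := block_entropy.

Lemma block_entropy0 : H 0 = 0.
Proof. by rewrite /H /= (stat_nil sp) ln1 mulr0 oppr0. Qed.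

Lemma block_entropy_le n : H n <= H n.+1.
Proof.
rewrite /H wsumSr; apply: le_wsum => u _.
rewrite -{1}(stat_rcons sp u) mulr_suml -sumrN; apply: ler_sum => x _.
rewrite lerN2; have [->|pn0] := eqVneq (p (rcons u x)) 0; first by rewrite !mul0r.
have pp : 0 < p (rcons u x) by rewrite lt_neqAle eq_sym pn0 p0.
have le : p (rcons u x) <= p u by rewrite -cats1 stat_catr_le.
by rewrite ler_wpM2l// ler_ln ?posrE// (lt_le_trans pp).
Qed.

(** The conditional mutual information of the first and last letters given the middle word is
    nonnegative: Gibbs' inequality against [q], which makes these two letters conditionally
    independent. *)
Lemma block_entropy_concave n : H n.+2 + H n <= H n.+1 + H n.+1.
Proof.
pose S (f : T -> seq T -> T -> R) :=
  \sum_x wsum n (fun u => \sum_y f x u y).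
pose q x u y := p (x :: u) * p (rcons u y) / p u.
have Sle f g : (forall x u y, f x u y <= g x u y) -> S f <= S g.
  move=> fg; apply: ler_sum => x _; apply: le_wsum => u _.
  by apply: ler_sum.
have SB f g : S (fun x u y => f x u y - g x u y) = S f - S g.
  rewrite /S -sumrB; apply: eq_bigr => x _; rewrite -wsumB.
  by apply: eq_wsum => u _; rewrite -sumrB.
have H2 : H n.+2 = - S (fun x u y => p (x :: rcons u y) * ln (p (x :: rcons u y))).
  rewrite /H -[wsum n.+2 _]/(\sum_x wsum n.+1 _) /S -sumrN.
  apply: eq_bigr => x _; rewrite wsumSr -wsumN; apply: eq_wsum => u _.
  by rewrite sumrN.
have H1l : H n.+1 = - S (fun x u y => p (x :: rcons u y) * ln (p (x :: u))).
  rewrite /H /= /S -sumrN; apply: eq_bigr => x _; rewrite -wsumN.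
  apply: eq_wsum => u _; rewrite -mulr_suml; congr (- (_ * _)).
  by rewrite -(stat_rcons sp); apply: eq_bigr.
have H1r : H n.+1 = - S (fun x u y => p (x :: rcons u y) * ln (p (rcons u y))).
  rewrite /H wsumSr /S -wsum_sum -wsumN; apply: eq_wsum => u _.
  rewrite exchange_big -sumrN; apply: eq_bigr => y _.
  by rewrite -mulr_suml (stat_cons sp).
have H0 : H n = - S (fun x u y => p (x :: rcons u y) * ln (p u)).
  rewrite /H /S -wsum_sum -wsumN; apply: eq_wsum => u _.
  rewrite exchange_big -(stat_rcons sp u) mulr_suml; congr (- _).
  apply: eq_bigr => y _; rewrite -mulr_suml (stat_cons sp).
  by rewrite (stat_rcons sp).
have Sp : S (fun x u y => p (x :: rcons u y)) = 1.
  rewrite -(wsum_stat sp n.+2) -[RHS]/(\sum_x wsum n.+1 _).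
  by apply: eq_bigr => x _; rewrite wsumSr.
have Sq : S q <= 1.
  rewrite -(wsum_stat sp n) /S -wsum_sum; apply: le_wsum => u _.
  under eq_bigr => x _ do rewrite -mulr_suml -mulr_sumr (stat_rcons sp).
  rewrite -mulr_suml -mulr_suml (stat_cons sp).
  have [->|pn0] := eqVneq (p u) 0; first by rewrite invr0 mulr0.
  by rewrite mulfK.
have : S (fun x u y => p (x :: rcons u y)) - S q <=
   S (fun x u y => p (x :: rcons u y) * ln (p (x :: rcons u y))) -
   S (fun x u y => p (x :: rcons u y) * ln (p (x :: u))) -
   (S (fun x u y => p (x :: rcons u y) * ln (p (rcons u y))) -
   S (fun x u y => p (x :: rcons u y) * ln (p u))).
  rewrite -!SB; apply: Sle => x u y.
  have [->|pn0] := eqVneq (p (x :: rcons u y)) 0.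
    by rewrite !mul0r !subr0 sub0r oppr_le0 /q divr_ge0 ?mulr_ge0.
  have pp : 0 < p (x :: rcons u y) by rewrite lt_neqAle eq_sym pn0 p0.
  have p1 : 0 < p (x :: u).
    by apply: (lt_le_trans pp); rewrite -cats1 -cat_cons stat_catr_le.
  have p2 : 0 < p (rcons u y).
    by apply: (lt_le_trans pp); rewrite -cat1s stat_catl_le.
  have p3 : 0 < p u by apply: (lt_le_trans p2); rewrite -cats1 stat_catr_le.
  have q0 : 0 < q x u y by rewrite /q divr_gt0 ?mulr_gt0.
  apply: (le_trans (ln_gibbs (ltW pp) (ltW q0) _)).
    by move=> q00; move: q0; rewrite q00 ltxx.
  rewrite le_eqVlt; apply/orP; left; apply/eqP.
  rewrite /q ln_div ?posrE ?mulr_gt0// lnM ?posrE//; ring.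
rewrite Sp; lra.
Qed.

Lemma block_entropy_increment n m : (n <= m)%N ->
  H m.+1 - H m <= H n.+1 - H n.
Proof.
move=> /subnK <-; elim: (m - n)%N => [|k IH]//.
apply: le_trans IH; have := block_entropy_concave (k + n).
by rewrite addSn; lra.
Qed.

(* The increments of the block entropy decrease to the entropy rate, so the
   mutual information between a block and its past is sublinear in the length
   of the block, uniformly in the length of the past. *)
Lemma block_mutual_information (e : R) : 0 < e ->
  exists N0, forall N L, (N0 <= N)%N -> H N + H L - H (L + N) <= e * N%:R.
Proof.
move=> e0; pose D n := H n.+1 - H n.
have D0 n : 0 <= D n by rewrite subr_ge0 block_entropy_le.
pose E := range D; pose h := inf E.
have hE : has_inf E.
  split; first by exists (D 0%N), 0%N.
  by exists 0 => _ [n _ <-].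
have hD n : h <= D n by apply: (ge_inf hE.2); exists n.
have h0 : 0 <= h by apply: (lb_le_inf hE.1) => _ [n _ <-].
have e2 : 0 < e / 2 by lra.
have [_ [n1 _ <-] Dn1] := inf_adherent e2 hE.
(* At most [n1] increments can exceed [h + e / 2], and each of them is at most [D 0]; the excess
   over the linear term is therefore bounded in [N]. *)
have Hub N : H N <= (minn N n1)%:R * D 0%N + N%:R * (h + e / 2).
  elim: N => [|N IH]; first by rewrite block_entropy0 min0n !mul0r addr0.
  have -> : H N.+1 = H N + D N by rewrite /D; ring.
  have [Nn|nN] := ltnP N n1.
    have -> : minn N.+1 n1 = (minn N n1).+1 by lia.
    have : D N <= D 0%N by apply: block_entropy_increment.
    by rewrite -(natr1 (minn N n1)) -(natr1 N) !(mulrDl _ 1) !mul1r; lra.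
  have -> : minn N.+1 n1 = minn N n1 by lia.
  have : D N <= D n1 by apply: block_entropy_increment.
  rewrite -/h in Dn1; rewrite -(natr1 N) (mulrDl _ 1) mul1r; lra.
have Hlb L N : H L + N%:R * h <= H (L + N).
  elim: N => [|N IH]; first by rewrite mul0r addr0 addn0.
  have := hD (L + N)%N; rewrite /D addnS -(natr1 N) mulrDl mul1r; lra.
pose c := n1%:R * D 0%N / (e / 2).
have [N0 cN0] : exists N0 : nat, c <= N0%:R.
  exact: exists_nat_ge.
exists N0 => N L N0N.
have cN : n1%:R * D 0%N <= e / 2 * N%:R.
  by rewrite [leRHS]mulrC -ler_pdivrMr// (le_trans cN0)// ler_nat.
have mn : (minn N n1)%:R * D 0%N <= n1%:R * D 0%N.
  by rewrite ler_wpM2r// ler_nat geq_minr.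
have := Hub N; move: mn; move: (_ * D 0%N) => c2.
have := Hlb L N; move: cN; move: (n1%:R * D 0%N) => c1.
lra.
Qed.

End BlockEntropy.
Lemma wsum_rev (R : realType) (T : finType) n (f : seq T -> R) :
  wsum n (fun u => f (rev u)) = wsum n f.
Proof.
elim: n f => [|n IH] f //=.
rewrite -/(wsum n.+1 f) wsumSr wsum_sum; apply: eq_bigr => x _.
rewrite -[RHS](IH (fun u => f (rcons u x))).
by apply: eq_wsum => u _; rewrite rev_cons.
Qed.

(** * Blocks that are predictable from their past *)

Section Predictable.
Variables (R : realType) (T : finType) (p : seq T -> R).
Implicit Types (K : R) (n m : nat) (u v w x : seq T).

Definition predictable_from K x v := K * (p x * p v) < p (x ++ v).

(* Some suffix of the past x already makes the block v more than K times as
   likely as it is unconditionally. *)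
Definition predictable K x v :=
  has (fun l => predictable_from K (drop l x) v) (iota 0 (size x).+1).

Lemma predictableP K x v :
  reflect (exists2 l, (l <= size x)%N & predictable_from K (drop l x) v)
          (predictable K x v).
Proof.
apply: (iffP hasP) => [[l]|[l lx pl]].
  by rewrite mem_iota /= add0n ltnS; exists l.
by exists l => //; rewrite mem_iota /= add0n ltnS.
Qed.

(** This monotonicity is why [predictable] looks at all suffixes: a block that is unpredictable from
    a long past remains so when the past is cut at a later start. *)
Lemma predictable_drop K l x v : predictable K (drop l x) v -> predictable K x v.
Proof.
move=> /predictableP[k]; rewrite drop_drop size_drop => kx kb.
have [lx|xl] := leqP l (size x).
  by apply/predictableP; exists (k + l)%N => //; lia.
apply/predictableP; exists (size x) => //.
by move: kb; rewrite !drop_oversize//; lia.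
Qed.

Lemma unpredictable_le K x v : ~~ predictable K x v ->
  p (x ++ v) <= K * (p x * p v).
Proof.
move=> xv; rewrite leNgt; apply: contra xv => xv.
by apply/predictableP; exists 0%N => //; rewrite drop0.
Qed.

Hypothesis sp : stationary p.
Let p0 u : 0 <= p u := stat_ge0 sp u.

(* The past is read outwards from the block, so u lists the letters preceding
   u0 in reverse order; the likelihood ratio is frozen at the first time it
   exceeds K. *)
Fixpoint stopped_ratio K v u0 u : R :=
  if predictable_from K u0 v then p (u0 ++ v) / (p u0 * p v)
  else if u is x :: u' then stopped_ratio K v (x :: u0) u' else 1.

Lemma wsum_catrev n w : wsum n (fun u => p (catrev u w)) = p w.
Proof.
rewrite -(wsum_catl sp n w) -(wsum_rev n (fun u => p (u ++ w))).
by apply: eq_wsum => u _; rewrite catrevE.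
Qed.

Lemma predictable_from_gt0 K u v : 0 <= K -> predictable_from K u v ->
  [/\ 0 < p u, 0 < p v & K < p (u ++ v) / (p u * p v)].
Proof.
move=> K0 uv.
have puv : 0 < p (u ++ v) by apply: le_lt_trans uv; rewrite !mulr_ge0.
have pu : 0 < p u by apply: (lt_le_trans puv); apply: stat_catr_le.
have pv : 0 < p v by apply: (lt_le_trans puv); apply: stat_catl_le.
by split => //; rewrite ltr_pdivlMr ?mulr_gt0.
Qed.

(** For fixed [v] the likelihood ratio is a martingale under [p] as the past grows, so the stopped
    pasts carry at most [p (u0 ++ v)]; the pasts that never stop have ratio 1 and carry at most
    [p u0 * p v]. *)
Lemma wsum_stopped_ratio K v n u0 : 0 <= K ->
  wsum n (fun u => p (catrev u u0) * p v * stopped_ratio K v u0 u) <=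
  p (u0 ++ v) + p u0 * p v.
Proof.
move=> K0; elim: n u0 => [|n IH] u0.
  rewrite /=; case: ifP => uv; last by rewrite mulr1 lerDr.
  have [pu pv _] := predictable_from_gt0 K0 uv.
  rewrite mulrCA divff ?mulr1 ?lerDl ?mulr_ge0//.
  by rewrite mulf_neq0 ?gt_eqF.
have [uv|uv] := boolP (predictable_from K u0 v).
  rewrite (@eq_wsum _ _ _ _ (fun u => p (catrev u u0) *
    (p v * (p (u0 ++ v) / (p u0 * p v))))); last first.
    by move=> [|x u] //= _; rewrite uv -!mulrA.
  have [pu pv _] := predictable_from_gt0 K0 uv.
  rewrite wsumZr wsum_catrev mulrA mulrCA divff ?mulr1 ?lerDl ?mulr_ge0//.
  by rewrite mulf_neq0 ?gt_eqF.
rewrite /= (negPf uv) -(stat_cons sp (u0 ++ v)) -(stat_cons sp u0) mulr_suml -big_split.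
by apply: ler_sum => x _; apply: IH.
Qed.

Lemma stopped_ratio_ge1 K v u0 u : 1 <= K -> 1 <= stopped_ratio K v u0 u.
Proof.
move=> K1; have K0 : 0 <= K by lra.
elim: u u0 => [|x u IH] u0 /=; case: ifP => // uv;
  have [_ _] := predictable_from_gt0 K0 uv; lra.
Qed.

Lemma stopped_ratio_ge K v u0 u l : 1 <= K -> (l <= size u)%N ->
  predictable_from K (catrev (take l u) u0) v -> K <= stopped_ratio K v u0 u.
Proof.
move=> K1; have K0 : 0 <= K by lra.
elim: u u0 l => [|x u IH] u0 l /=.
  move=> _; case: ifP => uv; first by have [_ _] := predictable_from_gt0 K0 uv; lra.
  by [].
move=> lu; case: ifP => uv; first by have [_ _] := predictable_from_gt0 K0 uv; lra.
case: l lu => [|l] lu /=; first by rewrite uv.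
exact: IH.
Qed.

(** Gibbs' inequality for the joint law against the product law tilted by [stopped_ratio], of mass
    at most 2: mutual information bounds the mean of ln [rt] up to 1, and ln [rt] is nonnegative
    everywhere and at least ln [K] on predictable pairs. Stopping treats all suffixes of the past at
    once. *)
Lemma predictable_prob K L N : 1 <= K ->
  wsum L (fun x => wsum N (fun v => p (x ++ v) * (predictable K x v)%:R)) * ln K
  <= block_entropy p N + block_entropy p L - block_entropy p (L + N) + 1.
Proof.
move=> K1; have K0 : 0 <= K by lra.
have Kp : 0 < K by lra.
(* [u] lists the past outwards from the block, in the order in which [stopped_ratio] reads it; the
   past itself is [rev u]. *)
pose S (f : seq T -> seq T -> seq T -> R) : R :=
  wsum L (fun u => wsum N (fun v => f (rev u) u v)).
have SB (f g : seq T -> seq T -> seq T -> R) :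
    S (fun x u v => f x u v - g x u v) = S f - S g.
  by rewrite /S -wsumB; apply: eq_wsum => u _; rewrite -wsumB.
have SrevE (f : seq T -> seq T -> R) :
    wsum L (fun x => wsum N (fun v => f x v)) = S (fun x _ v => f x v).
  by rewrite -(wsum_rev L).
pose pr := fun x u v : seq T => p (x ++ v).
pose rt := fun x u v : seq T => stopped_ratio K v [::] u.
pose q := fun x u v => p x * p v * rt x u v.
have Hc : block_entropy p (L + N) = - S (fun x u v => pr x u v * ln (pr x u v)).
  rewrite /block_entropy wsum_cat.
  rewrite -(SrevE (fun x v => p (x ++ v) * ln (p (x ++ v)))) -wsumN.
  by apply: eq_wsum => x _; rewrite -wsumN.
have HL : block_entropy p L = - S (fun x u v => pr x u v * ln (p x)).
  rewrite /block_entropy -(SrevE (fun x v => p (x ++ v) * ln (p x))) -wsumN.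
  by apply: eq_wsum => x _; rewrite wsumZr (wsum_catr sp).
have HN : block_entropy p N = - S (fun x u v => pr x u v * ln (p v)).
  rewrite /block_entropy -(SrevE (fun x v => p (x ++ v) * ln (p v))).
  rewrite exchange_wsum wsumN; congr (- _); apply: eq_wsum => v _.
  by rewrite wsumZr (wsum_catl sp).
have Sp : S pr = 1.
  rewrite -(SrevE (fun x v => p (x ++ v))) -(wsum_stat sp L).
  by apply: eq_wsum => x _; rewrite wsum_catr.
have Sq : S q <= 2.
  rewrite /S exchange_wsum.
  apply: (@le_trans _ _ (wsum N (fun v => p v + p v))); last first.
    by rewrite wsumD (wsum_stat sp).
  apply: le_wsum => v _.
  have := @wsum_stopped_ratio K v L [::] K0; rewrite /= (stat_nil sp) mul1r.
  by apply: le_trans; rewrite le_eqVlt; apply/orP; left; apply/eqP/eq_wsum.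
have rt1 x u v : 1 <= rt x u v by apply: stopped_ratio_ge1.
have gibbs : S pr - S q <= S (fun x u v => pr x u v * ln (pr x u v)) -
   S (fun x u v => pr x u v * ln (p x)) -
   S (fun x u v => pr x u v * ln (p v)) -
   S (fun x u v => pr x u v * ln (rt x u v)).
  rewrite -!SB; apply: le_wsum => u _; apply: le_wsum => v _.
  have [pn0|pn0] := eqVneq (pr (rev u) u v) 0.
    rewrite pn0 !mul0r !subr0 sub0r oppr_le0 /q !mulr_ge0//.
    by apply: le_trans (rt1 _ _ _).
  have pp : 0 < pr (rev u) u v by rewrite lt_neqAle eq_sym pn0 p0.
  have px : 0 < p (rev u) by apply: (lt_le_trans pp); apply: stat_catr_le.
  have pv : 0 < p v by apply: (lt_le_trans pp); apply: stat_catl_le.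
  have rp : 0 < rt (rev u) u v by apply: lt_le_trans (rt1 _ _ _).
  have q0 : 0 < q (rev u) u v by rewrite /q !mulr_gt0.
  apply: (le_trans (ln_gibbs (ltW pp) (ltW q0) _)).
    by move=> q00; move: q0; rewrite q00 ltxx.
  rewrite le_eqVlt; apply/orP; left; apply/eqP.
  rewrite /q !lnM ?posrE ?mulr_gt0//; ring.
have bad : wsum L (fun x => wsum N (fun v =>
    p (x ++ v) * (predictable K x v)%:R)) * ln K <=
    S (fun x u v => pr x u v * ln (rt x u v)).
  rewrite SrevE /S -wsumZr; apply: le_wsum => u _.
  rewrite -wsumZr; apply: le_wsum => v _.
  rewrite -mulrA ler_wpM2l//; case: predictableP => [[l]|] /=; last first.
    by rewrite mul0r ln_ge0.
  rewrite size_rev drop_rev mul1r => lu ul.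
  rewrite ler_ln ?posrE//; last by apply: lt_le_trans (rt1 _ _ _).
  by apply: stopped_ratio_ge ul => //; rewrite leq_subr.
by move: gibbs; rewrite Sp Hc HL HN; lra.
Qed.

(** The mutual information and the additive 1 each take half of [e * eta * N], and ln of the
    threshold is [e * N]. *)
Lemma rarely_predictable (e eta : R) : 0 < e -> 0 < eta ->
  exists N0, forall N L, (N0 <= N)%N ->
    wsum L (fun x => wsum N (fun v =>
      p (x ++ v) * (predictable (expR (e * N%:R)) x v)%:R)) <= eta.
Proof.
move=> e0 eta0; have e1 : 0 < e * eta / 2 by rewrite divr_gt0 ?mulr_gt0.
have [N0 N0P] := block_mutual_information sp e1.
have [N1 N1P] := exists_nat_ge (2 / (e * eta)).
exists (maxn (maxn N0 N1) 1) => N L; rewrite !geq_max => /andP[/andP[N0N N1N] Np].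
have eN : 0 < e * N%:R by rewrite mulr_gt0 ?ltr0n.
have := @predictable_prob (expR (e * N%:R)) L N.
rewrite -{1}expR0 ler_expR expRK => /(_ (ltW eN)).
have := N0P N L N0N.
have : 1 <= e * eta / 2 * N%:R.
  have : 2 / (e * eta) <= N%:R by rewrite (le_trans N1P)// ler_nat.
  rewrite ler_pdivrMr ?mulr_gt0//; lra.
move: (wsum _ _) => P; move=> h1 h2 h3.
rewrite -(ler_pM2r eN); apply: (le_trans h3); nra.
Qed.

End Predictable.
(** * Projections along an orbit of an irrational rotation *)

Section RotationOrbit.
Variables (R : realType) (x : R).
Hypotheses (x_irr : irrational x) (x_ge0 : 0 <= x).

Definition whole (u : nat) : nat := Num.truncn (u%:R * x).
Definition phase (u : nat) : R := u%:R * x - (whole u)%:R.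

Lemma phase_itv u : 0 <= phase u < 1.
Proof.
have := truncn_itv (mulr_ge0 (ler0n R u) x_ge0); rewrite -natr1 /phase /whole.
by move=> /andP[h1 h2]; apply/andP; split; lra.
Qed.

Lemma irrational_mul_neq_int (q : nat) (k : int) : (0 < q)%N ->
  q%:R * x - k%:~R != 0.
Proof.
move=> q0; apply/eqP => qxk; apply: x_irr; exists (k%:~R / q%:R) => //.
rewrite rmorphM fmorphV /= ratr_int ratr_nat.
have q_neq0 : q%:R != 0 :> R by rewrite pnatr_eq0 -lt0n.
by apply: (mulIf q_neq0); rewrite divfK//; lra.
Qed.

Lemma dirichlet_approx (e : R) : 0 < e ->
  exists (q : nat) (k : int), (0 < q)%N /\ 0 < `|q%:R * x - k%:~R| < e.
Proof.
move=> e0; have [n ne] := exists_nat_ge (e^-1).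
have n0 : (0 < n)%N.
  by rewrite -(ltr_nat R) (lt_le_trans _ ne)// invr_gt0.
have nR : 0 < n%:R :> R by rewrite ltr0n.
have fP (i : 'I_n.+1) : (Num.truncn (n%:R * phase i) < n)%N.
  have /andP[t0 t1] := phase_itv i.
  by rewrite truncn_lt_nat ?mulr_ge0// gtr_pMr.
pose f i : 'I_n := Ordinal (fP i).
have /injectivePn[i [j ij fij]] : ~~ injectiveb f.
  by apply/injectiveP => /leq_card; rewrite !card_ord ltnn.
have {fij} tij : Num.truncn (n%:R * phase i) = Num.truncn (n%:R * phase j).
  by have := congr1 val fij.
have close : `|phase i - phase j| < e.
  have h k := truncn_itv (mulr_ge0 (ler0n R n) (proj1 (andP (phase_itv k)))).
  have := h i; have := h j; rewrite tij -natr1 => /andP[a1 a2] /andP[a3 a4].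
  have : `|n%:R * (phase i - phase j)| < 1.
    by rewrite ltr_norml; apply/andP; split; rewrite mulrBr; lra.
  rewrite normrM (gtr0_norm nR) => h1.
  have : e^-1 * `|phase i - phase j| < 1.
    by apply: le_lt_trans h1; rewrite ler_wpM2r.
  by rewrite mulrC ltr_pdivrMr// mul1r.
wlog lij : i j ij tij close / (i < j)%N.
  move=> W; case: (ltngtP i j) => [/W|/W|/val_inj ij'].
  - by apply.
  - by apply => //; [rewrite eq_sym|rewrite distrC].
  - by rewrite ij' eqxx in ij.
exists (j - i)%N, ((whole j)%:Z - (whole i)%:Z); rewrite subn_gt0; split => //.
rewrite normr_gt0 irrational_mul_neq_int ?subn_gt0//=.
rewrite natrB ?(ltnW lij)// intrB -!pmulrn.
suff -> : (j%:R - i%:R) * x - ((whole j)%:R - (whole i)%:R) = phase j - phase i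
  by rewrite distrC.
by rewrite /phase; ring.
Qed.

(* Translates of A along the orbit by multiples of a time q with
   l < |q x mod 1| <= 2 l are disjoint, so A has density O(l). *)
Lemma rotation_orbit_count (r : R) : 0 < r ->
  exists J0, forall J (A : pred nat) (l : R), (J0 <= J)%N -> r <= l ->
    (forall u v, A u -> A v -> `|phase u - phase v| <= l) ->
    (#|[set u : 'I_J | A u]%SET|)%:R <= 8 * l * J%:R.
Proof.
move=> r0; have [q0 [k0 [q0p /andP[d0 dr]]]] := dirichlet_approx r0.
set d : R := `|_| in d0 dr.
(* [Q] will bound the time [q] uniformly in [l], since [h <= l / d + 1] and [l < 1] in the
   nontrivial case; hence [J0] depends on [r] alone. *)
have [Q QP] := exists_nat_ge (q0%:R * (d^-1 + 1)).
have [J0 J0P] := exists_nat_ge (Q%:R / (4 * r)).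
exists J0 => J A l J0J rl Al.
have l0 : 0 < l by lra.
have [l8|l8] := lerP 1 (8 * l).
  apply: (@le_trans _ _ J%:R); last by rewrite ler_peMl.
  by rewrite ler_nat -[leqRHS]card_ord max_card.
pose h := (Num.truncn (l / d)).+1.
have /andP[h1 h2] := truncn_itv (ltW (divr_gt0 l0 d0)).
have hR : l / d < h%:R <= l / d + 1.
  by apply/andP; split; [exact: h2|rewrite /h -natr1; lra].
clear h1 h2; have : l < h%:R * d <= 2 * l.
  case/andP: hR; rewrite ltr_pdivrMr// => -> /= h2.
  have := ler_wpM2r (ltW d0) h2; rewrite mulrDl divfK ?gt_eqF//; lra.
move=> /andP[hd1 hd2].
pose q := (h * q0)%N; pose D := q%:R * x - (h%:Z * k0)%:~R.
have DE : `|D| = h%:R * d.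
  rewrite /d -[h%:R in RHS]normr_nat -normrM /D; congr `|_|.
  by rewrite natrM intrM -pmulrn; ring.
have qQ : (q <= Q)%N.
  rewrite -(ler_nat R) (le_trans _ QP)// natrM mulrC ler_wpM2l//.
  case/andP: hR => _ /le_trans; apply; rewrite lerD2r.
  by rewrite ler_pdivrMr// mulVf ?gt_eqF//; lra.
(* One step of time [q] moves a phase by at most [2 * l], so [T] successive translates do not wrap
   around the circle. *)
pose T := Num.truncn ((2 * l)^-1).
have l20 : 0 < 2 * l by lra.
have /andP[T1 T2] := truncn_itv (ltW (etrans (invr_gt0 _) l20)).
rewrite -/T -(natr1 T) in T1 T2.
have {}T1 : T%:R * (2 * l) <= 1 by rewrite -ler_pdivlMr// div1r.
have {}T2 : 1 < (T%:R + 1) * (2 * l) by rewrite -ltr_pdivrMr// div1r.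
have T4 : 1 <= T%:R * (4 * l) by lra.
clearbody T.
pose S := [set u : 'I_J | A u]%SET.
have F_lt (ui : 'I_J * 'I_T) : (ui.1 + ui.2 * q < J + T * q)%N.
  case: ui => [u i] /=; have := ltn_ord u; have := ltn_ord i.
  by move=> iT uJ; rewrite -addSn leq_add// leq_mul2r ltnW ?orbT//.
pose F ui : 'I_(J + T * q) := Ordinal (F_lt ui).
(* A coincidence would make the phases of [u] and [v] differ by [(j - i) * D] plus an integer. If
   the integer is 0 this exceeds [l]; otherwise it is at least [1 - (T - 1) * (2 * l) >= 2 * l]. *)
have A_lt u v i j : A u -> A v -> (i < j)%N -> (j < T)%N ->
    (u + i * q = v + j * q)%N -> False.
  move=> Au Av ij jT uv; have := Al _ _ Au Av.
  pose z := (j - i)%N%:Z * (h%:Z * k0) - ((whole u)%:Z - (whole v)%:Z).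
  have uE : u%:R = v%:R + (j - i)%N%:R * q%:R :> R.
    rewrite -natrM -natrD; congr _%:R.
    have : (i * q <= j * q)%N by rewrite leq_mul2r ltnW ?orbT.
    by rewrite mulnBl; move: (i * q)%N (j * q)%N uv => a1 a2; clear; lia.
  have -> : phase u - phase v = (j - i)%N%:R * D + z%:~R.
    by rewrite /phase uE /D /z intrB intrB !intrM -!pmulrn; ring.
  have s1 : 1 <= (j - i)%N%:R :> R by rewrite ler1n subn_gt0.
  have sT : (j - i)%N%:R <= T%:R - 1 :> R.
    by rewrite lerBrDr natr1 ler_nat; clear -ij jT; lia.
  have sD : `|(j - i)%N%:R * D| = (j - i)%N%:R * `|D| by rewrite normrM normr_nat.
  have [->|z0] := eqVneq z 0.
    rewrite addr0 sD DE => h1.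
    by have := ler_wpM2r (ltW (lt_trans l0 hd1)) s1; lra.
  have z1 : 1 <= `|z%:~R| :> R.
    rewrite -intr_norm -[1]/(1%:~R) ler_int.
    by move: z z0 => z z0; clear -z0; lia.
  move=> h1; have := lerB_normD (z%:~R) ((j - i)%N%:R * D).
  rewrite [_%:~R + _]addrC sD DE.
  have := ler_wpM2r (ltW (lt_trans l0 hd1)) sT.
  have : (T%:R - 1) * (h%:R * d) <= (T%:R - 1) * (2 * l).
    by rewrite ler_wpM2l// subr_ge0; lra.
  lra.
have Finj : {in finset.setX S [set: 'I_T]%SET &, injective F}.
  move=> [u i] [v j]; rewrite !inE !andbT /= => Au Av /(congr1 val) /= uv.
  case: (ltngtP i j) => [ij|ji|/val_inj ij].
  - by case: (A_lt u v i j Au Av ij (ltn_ord j) uv).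
  - by case: (A_lt v u j i Av Au ji (ltn_ord i) (esym uv)).
  - by move: uv; rewrite ij => /addIn/val_inj ->.
(* Disjointness of the translates, all within [J + T * Q] times. After division by [T], each of the
   two terms is at most [4 * l * J]. *)
have : (#|S| * T <= J + T * Q)%N.
  apply: (@leq_trans (J + T * q)); last by rewrite leq_add2l leq_mul2l qQ orbT.
  rewrite -[leqRHS]card_ord -[T in leqLHS]card_ord -cardsT -cardsX.
  by rewrite -(card_in_imset Finj) max_card.
rewrite -(ler_nat R) natrD !natrM => cS.
have QJ : Q%:R <= 4 * l * J%:R.
  have : Q%:R / (4 * r) <= J%:R by rewrite (le_trans J0P)// ler_nat.
  rewrite ler_pdivrMr; last by lra.
  move=> /le_trans; apply; rewrite mulrC.
  by rewrite ler_wpM2r ?ler_wpM2l.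
have T0 : 0 < T%:R :> R.
  rewrite lt_neqAle ler0n andbT eq_sym; apply/eqP => T0.
  by move: T4; rewrite T0 mul0r; lra.
rewrite -(ler_pM2r T0); apply: (le_trans cS).
have : J%:R <= T%:R * (4 * l) * J%:R by rewrite ler_peMl.
have := ler_wpM2l (ltW T0) QJ.
lra.
Qed.

End RotationOrbit.
Section PairSums.
Variables (R : realType) (A B : finType).
Implicit Types (F G : seq A -> seq B -> R).

Definition wsum2 n m F : R := wsum n (fun x => wsum m (F x)).

Lemma eq_wsum2 n m F G :
  (forall x y, size x = n -> size y = m -> F x y = G x y) ->
  wsum2 n m F = wsum2 n m G.
Proof.
by move=> FG; apply: eq_wsum => x sx; apply: eq_wsum => y sy; apply: FG.
Qed.

Lemma le_wsum2 n m F G :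
  (forall x y, size x = n -> size y = m -> F x y <= G x y) ->
  wsum2 n m F <= wsum2 n m G.
Proof.
by move=> FG; apply: le_wsum => x sx; apply: le_wsum => y sy; apply: FG.
Qed.

Lemma wsum2_ge0 n m F :
  (forall x y, size x = n -> size y = m -> 0 <= F x y) -> 0 <= wsum2 n m F.
Proof.
by move=> FG; apply: wsum_ge0 => x sx; apply: wsum_ge0 => y sy; apply: FG.
Qed.

Lemma wsum2D n m F G :
  wsum2 n m (fun x y => F x y + G x y) = wsum2 n m F + wsum2 n m G.
Proof. by rewrite -wsumD; apply: eq_wsum => x _; rewrite -wsumD. Qed.

Lemma wsum2B n m F G :
  wsum2 n m (fun x y => F x y - G x y) = wsum2 n m F - wsum2 n m G.
Proof. by rewrite -wsumB; apply: eq_wsum => x _; rewrite -wsumB. Qed.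

Lemma wsum2Z n m c F :
  wsum2 n m (fun x y => c * F x y) = c * wsum2 n m F.
Proof. by rewrite -wsumZ; apply: eq_wsum => x _; rewrite -wsumZ. Qed.

Lemma wsum2Zr n m c F :
  wsum2 n m (fun x y => F x y * c) = wsum2 n m F * c.
Proof. by rewrite -wsumZr; apply: eq_wsum => x _; rewrite -wsumZr. Qed.

Lemma wsum2_sum n m (I : Type) (r : seq I) (P : pred I)
    (F : I -> seq A -> seq B -> R) :
  wsum2 n m (fun x y => \sum_(i <- r | P i) F i x y) =
  \sum_(i <- r | P i) wsum2 n m (F i).
Proof. by rewrite -wsum_sum; apply: eq_wsum => x _; rewrite -wsum_sum. Qed.

Lemma wsum2_cst n m c :
  wsum2 n m (fun _ _ => c) = (#|A| ^ n * #|B| ^ m)%:R * c.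
Proof. by rewrite /wsum2 !wsum_cst natrM mulrA. Qed.

End PairSums.

(** The derivative of exp is at least 1 on the nonnegative half-line. This turns closeness of slopes
    into closeness of phases. *)
Lemma expR_distE (R : realType) (x y : R) : 0 <= x -> 0 <= y ->
  `|x - y| <= `|expR x - expR y|.
Proof.
wlog xy : x y / y <= x => [W x0 y0|x0 y0].
  have [yx|xy] := leP y x; first exact: W.
  by rewrite distrC [leRHS]distrC; apply: W => //; apply: ltW.
rewrite !ger0_norm ?subr_ge0 ?ler_expR//.
have -> : expR x = expR y * expR (x - y) by rewrite -expRD addrCA subrr addr0.
have : 1 <= expR y by rewrite -expR0 ler_expR.
have := expR_ge1Dx (x - y); have : 0 <= x - y by rewrite subr_ge0.
move: (expR y) (expR (x - y)) => a b; nra.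
Qed.

Section ProjectionsAlongOrbit.
Variables (R : realType) (x : R).
Hypotheses (x_irr : irrational x) (x_ge0 : 0 <= x).
Variables (c0 lam : R).
Hypotheses (c0_neq0 : c0 != 0) (lam_gt0 : 0 < lam).

Definition orbit_slope (u : nat) : R := c0 * expR (lam * phase x u).
Local Notation c := orbit_slope.

Lemma orbit_slope_bounds u : `|c0| <= `|c u| <= `|c0| * expR lam.
Proof.
have /andP[t0 t1] := phase_itv x_ge0 u.
rewrite /c normrM (gtr0_norm (expR_gt0 _)) ler_peMr//=; last first.
  by rewrite -expR0 ler_expR mulr_ge0// ltW.
by rewrite ler_wpM2l// ler_expR ler_piMr// ltW.
Qed.

Lemma orbit_slope_dist u v : `|c0| * lam * `|phase x u - phase x v| <= `|c u - c v|.
Proof.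
have /andP[t0 _] := phase_itv x_ge0 u; have /andP[t1 _] := phase_itv x_ge0 v.
rewrite /c -mulrBr normrM -mulrA ler_wpM2l//.
rewrite -[X in X * _](gtr0_norm lam_gt0) -normrM mulrBr.
by rewrite expR_distE// mulr_ge0// ltW.
Qed.

Definition orbit_const : R :=
  1 + 32 * (`|c0| * expR lam + 1) / (`|c0| * lam).

Lemma orbit_const_ge1 : 1 <= orbit_const.
Proof.
rewrite /orbit_const lerDl divr_ge0 ?mulr_ge0 ?addr_ge0 ?mulr_ge0 ?expR_ge0//.
exact: ltW.
Qed.

Lemma dyadic_bracket (k rad : R) I : 0 < k -> 2 * k < rad ->
  rad <= 2 ^+ I.+1 * k ->
  exists2 i, (i <= I)%N & 2 ^+ i * k < rad <= 2 ^+ i.+1 * k.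
Proof.
move=> k0 kr; elim: I => [|I IH] radI; first by move: radI; rewrite expr1; lra.
have [/IH[i iI ri]|rI] := leP rad (2 ^+ I.+1 * k); first by exists i; rewrite ?leqW.
by exists I.+1 => //; rewrite rI.
Qed.

Lemma small_combination_count (k D : R) I : 0 < k -> D <= 2 ^+ I.+1 * k ->
  exists J0, forall J (X Y : R), (J0 <= J)%N -> `|X| <= D -> `|Y| <= D ->
    (#|[set u : 'I_J | `|X + c u * Y| <= k]%SET|)%:R <=
    orbit_const * J%:R * \sum_(i < I.+1)
      2 ^- i * ((`|X| <= 2 ^+ i.+1 * k) && (`|Y| <= 2 ^+ i.+1 * k))%:R.
Proof.
move=> k0 DI; set C1 : R := `|c0| * expR lam.
have C10 : 0 <= C1 by rewrite mulr_ge0 ?expR_ge0.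
have cl0 : 0 < `|c0| * lam by rewrite mulr_gt0 ?normr_gt0.
pose K : R := 4 * (C1 + 1) / (`|c0| * lam).
have K0 : 0 < K by rewrite divr_gt0// mulr_gt0//; lra.
have KE : orbit_const = 1 + 8 * K
  by rewrite /orbit_const -/C1 /K; field; rewrite ?gt_eqF//;
    move: cl0; rewrite pmulr_lgt0 ?normr_gt0.
have P0 i : 0 < 2 ^+ i :> R by rewrite exprn_gt0.
have D1 : 0 < 2 ^+ I.+1 * k by rewrite mulr_gt0.
have r0 : 0 < K * k / (2 ^+ I.+1 * k) by apply: divr_gt0 => //; apply: mulr_gt0.
have [J0 J0P] := rotation_orbit_count x_irr x_ge0 r0.
exists J0 => J X Y J0J XD YD; set S := [set _ | _]%SET.
have SJ : #|S|%:R <= J%:R :> R by rewrite ler_nat -[leqRHS]card_ord max_card.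
have J_ge0 : 0 <= J%:R :> R by [].
pose rad : R := Num.max `|X| `|Y|.
have Xr : `|X| <= rad by rewrite le_max lexx.
have Yr : `|Y| <= rad by rewrite le_max lexx orbT.
have sumE i0 : (i0 <= I)%N -> rad <= 2 ^+ i0.+1 * k ->
    2 ^- i0 <= \sum_(i < I.+1)
      2 ^- i * ((`|X| <= 2 ^+ i.+1 * k) && (`|Y| <= 2 ^+ i.+1 * k))%:R :> R.
  rewrite -ltnS => i0I radi.
  rewrite (bigD1 (Ordinal i0I))//= (le_trans Xr)// (le_trans Yr)// mulr1 lerDl.
  by apply: sumr_ge0 => i _; apply: mulr_ge0 => //; rewrite invr_ge0 ltW.
have [small|big] := leP rad (2 * k).
  apply: (le_trans SJ); apply: (@le_trans _ _ (orbit_const * J%:R * 1)).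
    by rewrite mulr1 ler_peMl// orbit_const_ge1.
  rewrite ler_wpM2l ?mulr_ge0 ?(le_trans _ orbit_const_ge1)//.
  by have := sumE 0%N; rewrite expr0 invr1 expr1; apply.
have radD : rad <= 2 ^+ I.+1 * k by rewrite ge_max !(le_trans _ DI).
have [i iI /andP[ri1 ri2]] := dyadic_bracket k0 big radD.
have rad0 : 0 < rad by lra.
have close u v : `|X + c u * Y| <= k -> `|X + c v * Y| <= k ->
    `|phase x u - phase x v| <= K * k / rad.
  move=> uk vk.
  have cuv : `|c u - c v| * `|Y| <= 2 * k.
    rewrite -normrM (_ : (c u - c v) * Y = (X + c u * Y) - (X + c v * Y)); last by ring.
    by apply: (le_trans (ler_normB _ _)); lra.
  have Xk : `|X| <= k + C1 * `|Y|.
    rewrite -[X](addrK (c u * Y)); apply: (le_trans (ler_normB _ _)).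
    apply: lerD => //; rewrite normrM ler_wpM2r//.
    by have /andP[] := orbit_slope_bounds u.
  have Yrad : rad <= 2 * (C1 + 1) * `|Y|.
    have : rad <= k + (C1 + 1) * `|Y|.
      rewrite ge_max; apply/andP; split.
        by apply: (le_trans Xk); rewrite lerD2l ler_wpM2r//; lra.
      by have := mulr_ge0 C10 (normr_ge0 Y); rewrite mulrDl mul1r; lra.
    lra.
  have := ler_wpM2r (normr_ge0 Y) (orbit_slope_dist u v).
  move=> /le_trans/(_ cuv).
  move: (`|phase x u - phase x v|) (normr_ge0 (phase x u - phase x v)) => t t0 h.
  rewrite ler_pdivlMr// /K mulrAC ler_pdivlMr//.
  have := ler_wpM2l t0 Yrad; have : 0 <= C1 + 1 by lra.
  move=> C11 /(ler_wpM2l (ltW cl0)) h2.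
  have := ler_wpM2l C11 h; nra.
have radl : K * k / (2 ^+ I.+1 * k) <= K * k / rad.
  apply: ler_wpM2l; first by apply: mulr_ge0; apply: ltW.
  by rewrite lef_pV2 ?posrE.
have := J0P J (fun u => `|X + c u * Y| <= k) _ J0J radl close.
rewrite -/S => /le_trans; apply.
apply: (@le_trans _ _ (orbit_const * J%:R * 2 ^- i)); last first.
  by rewrite ler_wpM2l ?mulr_ge0 ?(le_trans _ orbit_const_ge1)//; apply: sumE.
rewrite [leRHS]mulrAC ler_wpM2r// KE.
have kr : k / rad <= 2 ^- i.
  by rewrite ler_pdivrMr// mulrC -ler_pdivrMr ?invr_gt0// invrK mulrC ltW.
have : 0 <= 2 ^- i :> R by rewrite invr_ge0 ltW.
rewrite -[K * k / rad]mulrA; have := ler_wpM2l (ltW K0) kr.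
rewrite [(1 + _) / _]mulrDl mul1r -mulrA; move: (2 ^- i) (k / rad) => a b; lra.
Qed.

End ProjectionsAlongOrbit.

(** * Marstrand's argument for weighted pairs of words *)

Section WordProjections.
Variables (R : realType) (om : R).
Hypotheses (om_irr : irrational om) (om_ge0 : 0 <= om).
Variables (c0 lam : R).
Hypotheses (c0_neq0 : c0 != 0) (lam_gt0 : 0 < lam).
Local Notation c := (orbit_slope om c0 lam).

Variables (A B : finType) (n m : nat) (X : seq A -> R) (Y : seq B -> R).
Variables (P g : seq A -> seq B -> R) (k : R).
Hypotheses (g_ge0 : forall x y, 0 <= g x y) (gP : forall x y, g x y <= P x y).
Hypotheses (P1 : wsum2 n m P = 1) (k_gt0 : 0 < k).

Definition concentration u x y := wsum2 n m (fun x' y' =>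
  g x' y' * (`|(X x - X x') + c u * (Y y - Y y')| <= k)%R%:R).

(** The first condition replaces the full weight [P] by the Frostman weight [g] at the cost of a
    factor 2. *)
Definition spread (beta : R) u x y :=
  (P x y <= 2 * g x y) && (concentration u x y <= beta).

Lemma concentration_ge0 u x y : 0 <= concentration u x y.
Proof. by apply: wsum2_ge0 => *; apply: mulr_ge0. Qed.

(** A ball of radius [k / 2] containing the projection of one spread pair lies in the ball of radius
    [k] about that projection, which [concentration] controls. The maximum with 0 serves balls
    without spread pairs. *)
Lemma wsum2_spread_le (beta : R) u z :
  wsum2 n m (fun x y => P x y *
    (spread beta u x y && (`|X x + c u * Y y - z| <= k / 2))%:R) <=
  2 * Num.max 0 beta.
Proof.
pose near x y := spread beta u x y && (`|X x + c u * Y y - z| <= k / 2).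
have [[x1 [y1 [sx1 sy1 /andP[/andP[_ cb] n1]]]]|far] := pselect (exists x y,
    [/\ size x = n, size y = m & near x y]); last first.
  apply: (@le_trans _ _ (wsum2 n m (fun _ _ => 0))).
    apply: le_wsum2 => x' y' sx sy; case: (boolP (_ && _)) => h.
      by case: far; exists x', y'; split.
    by rewrite mulr0.
  by rewrite wsum2_cst mulr0 mulr_ge0// le_max lexx.
apply: (@le_trans _ _ (2 * concentration u x1 y1)); last first.
  by rewrite ler_wpM2l// le_max cb orbT.
rewrite -wsum2Z; apply: le_wsum2 => x2 y2 sx sy.
case: (boolP (_ && _)) => [/andP[/andP[Pg _] n2]|_].
  rewrite mulr1 mulrA (_ : (_ <= k)) ?mulr1//.
  have -> : X x1 - X x2 + c u * (Y y1 - Y y2) =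
    (X x1 + c u * Y y1 - z) - (X x2 + c u * Y y2 - z) by ring.
  by apply: (le_trans (ler_normB _ _)); lra.
by rewrite mulr0 mulr_ge0// mulr_ge0.
Qed.

Variables (s CF D : R) (I : nat).
Hypothesis s_le1 : s <= 1.
Hypothesis frostman : forall z1 z2 rad, k <= rad ->
  wsum2 n m (fun x y => g x y *
    ((`|X x - z1| <= rad) && (`|Y y - z2| <= rad))%:R) <= CF * rad `^ s.
Hypotheses (XD : forall x x', `|X x - X x'| <= D)
  (YD : forall y y', `|Y y - Y y'| <= D) (DI : D <= 2 ^+ I.+1 * k).

(** Scale [2 ^+ i * k] is met with frequency O(2^-i) and has Frostman mass at most [CF] times its
    [s]-th power; as [s <= 1], every scale contributes O(k^s), and the number of scales is the
    logarithmic loss. *)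
Lemma sum_concentration_le : exists J0, forall J, (J0 <= J)%N ->
  \sum_(u < J) wsum2 n m (fun x y => g x y * concentration u x y) <=
  orbit_const c0 lam * (2 * CF * I.+1%:R * k `^ s) * J%:R.
Proof.
have [J0 J0P] := small_combination_count om_irr om_ge0 c0_neq0 lam_gt0 k_gt0 DI.
exists J0 => J J0J; have oc0 : 0 <= orbit_const c0 lam.
  by apply: le_trans (orbit_const_ge1 _ lam_gt0).
have CF0 : 0 <= CF.
  rewrite -(@pmulr_lge0 _ (k `^ s)) ?powR_gt0//.
  apply: le_trans (frostman 0 0 (lexx k)).
  by apply: wsum2_ge0 => x1 y1 _ _; apply: mulr_ge0.
set K := _ * J%:R; have K0 : 0 <= K.
  by rewrite /K !mulr_ge0 ?powR_ge0.
rewrite -wsum2_sum; apply: (@le_trans _ _ (wsum2 n m (fun x y => g x y * K))).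
  apply: le_wsum2 => x1 y1 sx sy; rewrite -mulr_sumr ler_wpM2l// -wsum2_sum.
  apply: (@le_trans _ _ (wsum2 n m (fun x' y' => \sum_(i < I.+1)
      (orbit_const c0 lam * J%:R * 2 ^- i) * (g x' y' *
      ((`|X x' - X x1| <= 2 ^+ i.+1 * k) &&
       (`|Y y' - Y y1| <= 2 ^+ i.+1 * k))%:R)))).
    apply: le_wsum2 => x' y' _ _; rewrite -mulr_sumr.
    rewrite (_ : \sum_(i < J) _ = (#|[set u : 'I_J |
        `|(X x1 - X x') + c u * (Y y1 - Y y')| <= k]%SET|)%:R); last first.
      rewrite -sum1_card natr_sum [RHS]big_mkcond /=; apply: eq_bigr => i _.
      by rewrite inE; case: (_ <= k).
    have := J0P J _ _ J0J (XD x1 x') (YD y1 y').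
    move/(ler_wpM2l (g_ge0 x' y')) => /le_trans; apply.
    rewrite mulrA mulr_sumr; apply: ler_sum => i _.
    by rewrite distrC [`|Y y' - _|]distrC; rewrite le_eqVlt; apply/orP; left; apply/eqP; ring.
  rewrite wsum2_sum.
  apply: (@le_trans _ _ (\sum_(i < I.+1)
      orbit_const c0 lam * J%:R * (2 * CF * k `^ s))); last first.
    rewrite sumr_const card_ord -[leLHS]mulr_natl /K.
    by rewrite le_eqVlt; apply/orP; left; apply/eqP; ring.
  apply: ler_sum => i _; rewrite wsum2Z -mulrA ler_wpM2l ?mulr_ge0//.
  have P2 j : 0 < 2 ^+ j :> R by rewrite exprn_gt0.
  have k2 : k <= 2 ^+ i.+1 * k.
    by rewrite ler_peMl ?(ltW k_gt0)// exprn_ege1// ler1n.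
  have := frostman (X x1) (Y y1) k2; have i2 : 0 <= 2 ^- i :> R by rewrite invr_ge0 ltW.
  move/(ler_wpM2l i2).
  move=> /le_trans; apply.
  rewrite powRM ?(ltW (P2 _)) ?(ltW k_gt0)//.
  have h : (2 ^+ i.+1) `^ s <= 2 ^+ i.+1 :> R.
    by apply: ler1_powR => //; rewrite exprn_ege1// ler1n.
  have := ler_wpM2r (mulr_ge0 CF0 (powR_ge0 k s)) h.
  rewrite exprS => h2; rewrite mulrC -ler_pdivlMr ?invr_gt0// invrK.
  move: h2; move: (_ `^ s) => a; lra.
rewrite wsum2Zr ler_piMl//; rewrite -P1; apply: le_wsum2 => *; exact: gP.
Qed.

(** Where [P > 2 * g], the weight [P] is at most twice the discarded weight [P - g]; elsewhere
    Markov's inequality applies to [concentration]. *)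
Lemma sum_not_spread_le (beta : R) : 0 < beta ->
  exists J0, forall J, (J0 <= J)%N ->
  \sum_(u < J) wsum2 n m (fun x y => P x y * (~~ spread beta u x y)%:R) <=
  (2 * (1 - wsum2 n m g) +
   2 * (orbit_const c0 lam * (2 * CF * I.+1%:R * k `^ s)) / beta) * J%:R.
Proof.
move=> b0; have [J0 J0P] := sum_concentration_le.
exists J0 => J /J0P; set K := orbit_const _ _ * _ => h.
apply: (@le_trans _ _ (\sum_(u < J) (2 * (1 - wsum2 n m g) +
   2 / beta * wsum2 n m (fun x y => g x y * concentration u x y)))).
  apply: ler_sum => u _.
  have -> : 1 - wsum2 n m g = wsum2 n m (fun x y => P x y - g x y).
    by rewrite wsum2B P1.
  rewrite -wsum2Z -wsum2Z -wsum2D; apply: le_wsum2 => x1 y1 _ _.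
  have := concentration_ge0 u x1 y1; have := g_ge0 x1 y1; have := gP x1 y1.
  rewrite /spread; move: (P _ _) (g _ _) (concentration _ _ _) => p q t.
  move=> qp q0 t0; have bt : 0 <= 2 / beta * (q * t).
    by rewrite !mulr_ge0 ?invr_ge0 ?(ltW b0).
  have [pq|pq] /= := leP p (2 * q); last by rewrite mulr1; lra.
  have [tb|tb] /= := leP t beta; first by rewrite mulr0; lra.
  rewrite mulr1; suff : 2 * q <= 2 / beta * (q * t) by lra.
  rewrite -mulrA ler_wpM2l// mulrCA ler_peMr//.
  by rewrite mulrC ler_pdivlMr// mul1r ltW.
rewrite big_split sumr_const card_ord -mulr_sumr -[_ *+ J]mulr_natr /=.
rewrite [leRHS]mulrDl lerD2l.
have b2 : 0 <= 2 / beta by rewrite mulr_ge0 ?invr_ge0 ?(ltW b0).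
by apply: (le_trans (ler_wpM2l b2 h)); rewrite le_eqVlt; apply/orP; left; apply/eqP; ring.
Qed.

End WordProjections.
(** * Products of two stationary processes cut into blocks *)

Section Covering.
Variables (R : realType) (g S : nat -> bool) (K : nat) (t : R).
Hypothesis t_le1 : 0 <= t <= 1.
Hypothesis S_dense : forall j, S j ->
  exists n, [/\ (0 < n)%N, (n <= K)%N & t * n%:R <= \sum_(k < n) (g (j + k)%N)%:R].

(** Greedy covering from the left: at a point of [S] jump over its dense window, otherwise advance
    by one. The windows used are disjoint, so there is no multiplicity constant, and the last one
    overruns [J] by less than [K]. Jumps of variable length call for induction over all offsets and
    smaller [J]. *)
Lemma dense_starts_le J :
  t * \sum_(j < J) (S j)%:R <= \sum_(u < J + K) (g u)%:R.
Proof.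
case/andP: t_le1 => t0 t1.
have sum_le1 (h : nat -> bool) n j :
    0 <= (\sum_(k < n) (h (j + k)%N)%:R : R) <= n%:R.
  rewrite sumr_ge0//= -[leRHS]mul1r -[n in leRHS]card_ord mulr_natr -sumr_const.
  by apply: ler_sum => i _; rewrite lern1 leq_b1.
have split_sum (h : nat -> bool) a b j : (a <= b)%N ->
    \sum_(k < b) (h (j + k)%N)%:R =
    \sum_(k < a) (h (j + k)%N)%:R + \sum_(k < b - a) (h (j + a + k)%N)%:R :> R.
  move=> ab; transitivity (\sum_(k < a + (b - a)) (h (j + k)%N)%:R : R).
    by rewrite subnKC.
  rewrite big_split_ord /=; congr (_ + _); apply: eq_bigr => i _.
  by rewrite addnA.
suff H m : forall J j, (J <= m)%N -> t * \sum_(k < J) (S (j + k)%N)%:R <=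
    \sum_(k < J + K) (g (j + k)%N)%:R by exact: (H J J 0%N).
elim: m => [|m IH] {}J j; first by
  rewrite leqn0 => /eqP ->; rewrite big_ord0 mulr0; case/andP: (sum_le1 g (0 + K)%N j).
case: J => [|J Jm]; first by move=> _; apply: IH.
have [Sj|nSj] := boolP (S j).
  have [n [n0 nK tn]] := S_dense Sj.
  have gsplit : \sum_(k < J.+1 + K) (g (j + k)%N)%:R =
      \sum_(k < n) (g (j + k)%N)%:R +
      \sum_(k < J.+1 + K - n) (g (j + n + k)%N)%:R :> R.
    by apply: split_sum; lia.
  have [nJ|Jn] := leqP n J.+1.
    have -> : \sum_(k < J.+1) (S (j + k)%N)%:R = \sum_(k < n) (S (j + k)%N)%:R +
        \sum_(k < J.+1 - n) (S (j + n + k)%N)%:R :> R.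
      exact: split_sum.
    have := IH (J.+1 - n)%N (j + n)%N; rewrite gsplit mulrDr => H.
    apply: lerD.
      by apply: le_trans tn; rewrite ler_wpM2l//; case/andP: (sum_le1 S n j).
    have -> : (J.+1 + K - n = J.+1 - n + K)%N by lia.
    by apply: H; lia.
  rewrite gsplit; apply: (@le_trans _ _ (t * n%:R)).
    rewrite ler_wpM2l//; case/andP: (sum_le1 S J.+1 j) => _ /le_trans; apply.
    by rewrite ler_nat ltnW.
  by rewrite ler_wpDr//; case/andP: (sum_le1 g (J.+1 + K - n)%N (j + n)%N).
have := IH J j.+1 (ltnSE Jm).
rewrite addSn !big_ord_recl /= addn0 (negPf nSj) add0r => H.
rewrite ler_wpDl//; under eq_bigr => i _ do rewrite /bump add1n addnS -addSn.
by under [leRHS]eq_bigr => i _ do rewrite /bump add1n addnS -addSn.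
Qed.

End Covering.

Section Blocks.
Variables (R : realType) (A B : finType) (p : seq A -> R) (q : seq B -> R).
Hypotheses (sp : stationary p) (sq : stationary q).

Let p0 x : 0 <= p x := stat_ge0 sp x.
Let q0 y : 0 <= q y := stat_ge0 sq y.

Definition expect n m (F : seq A -> seq B -> R) : R :=
  wsum2 n m (fun x y => p x * q y * F x y).

Lemma le_expect n m F G :
  (forall x y, size x = n -> size y = m -> F x y <= G x y) ->
  expect n m F <= expect n m G.
Proof.
by move=> FG; apply: le_wsum2 => x y sx sy; rewrite ler_wpM2l ?mulr_ge0// FG.
Qed.

Lemma eq_expect n m F G :
  (forall x y, size x = n -> size y = m -> F x y = G x y) ->
  expect n m F = expect n m G.
Proof. by move=> FG; apply: eq_wsum2 => x y sx sy; rewrite FG. Qed.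

Lemma expectD n m F G :
  expect n m (fun x y => F x y + G x y) = expect n m F + expect n m G.
Proof. by rewrite -wsum2D; apply: eq_wsum2 => x y _ _; rewrite mulrDr. Qed.

Lemma expectZ n m c F :
  expect n m (fun x y => c * F x y) = c * expect n m F.
Proof. by rewrite -wsum2Z; apply: eq_wsum2 => x y _ _; rewrite mulrCA. Qed.

Lemma expect_sum n m (I : Type) (r : seq I) (P : pred I)
    (F : I -> seq A -> seq B -> R) :
  expect n m (fun x y => \sum_(i <- r | P i) F i x y) =
  \sum_(i <- r | P i) expect n m (F i).
Proof. by rewrite -wsum2_sum; apply: eq_wsum2 => x y _ _; rewrite mulr_sumr. Qed.

Lemma expectM n m (f : seq A -> R) (h : seq B -> R) :
  expect n m (fun x y => f x * h y) =
  wsum n (fun x => p x * f x) * wsum m (fun y => q y * h y).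
Proof.
rewrite -wsumZr; apply: eq_wsum => x _; rewrite -wsumZ.
by apply: eq_wsum => y _; rewrite mulrACA.
Qed.

Lemma expect1 n m : expect n m (fun _ _ => 1) = 1.
Proof.
rewrite -[LHS](@eq_expect _ _ (fun _ _ => 1 * 1)); last by move=> *; rewrite mulr1.
by rewrite expectM !wsumZr (wsum_stat sp) (wsum_stat sq) !mulr1.
Qed.

Lemma expect_window l n m l' n' m' F :
  expect (l + (n + m)) (l' + (n' + m'))
    (fun x y => F (take n (drop l x)) (take n' (drop l' y))) = expect n n' F.
Proof.
rewrite /expect /wsum2.
transitivity (wsum (l + (n + m)) (fun x => p x *
    (fun x => wsum n' (fun y => q y * F x y)) (take n (drop l x)))).
  apply: eq_wsum => x _ /=.
  rewrite -(wsum_window sq l' n' m' (fun y => F (take n (drop l x)) y)) -wsumZ.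
  by apply: eq_wsum => y _; rewrite mulrA.
rewrite (wsum_window sp l n m (fun x => wsum n' (fun y => q y * F x y))).
by apply: eq_wsum => x _; rewrite -wsumZ; apply: eq_wsum => y _; rewrite mulrA.
Qed.

Lemma expect_take n m n' m' F : (n <= n')%N -> (m <= m')%N ->
  expect n' m' (fun x y => F (take n x) (take m y)) = expect n m F.
Proof.
move=> nn mm; rewrite -(expect_window 0 n (n' - n) 0 m (m' - m)) !add0n !subnKC//.
by apply: eq_expect => x y _ _; rewrite !drop0.
Qed.

Lemma expect_cat n m n' m' F :
  expect (n + n') (m + m') F =
  wsum2 n m (fun x y => wsum2 n' m' (fun u v =>
    p (x ++ u) * q (y ++ v) * F (x ++ u) (y ++ v))).
Proof.
rewrite /expect /wsum2 wsum_cat; apply: eq_wsum => x _.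
rewrite [RHS]exchange_wsum; apply: eq_wsum => u _.
by rewrite wsum_cat.
Qed.

End Blocks.
Lemma take_drop_take (T : Type) (s : seq T) k l n : (l + k <= n)%N ->
  take l (drop k (take n s)) = take l (drop k s).
Proof. by move=> kln; rewrite take_drop take_takel// -take_drop. Qed.

(** * Block schedules and exponential moments *)

Section BlockSchedule.
Variables (R : realType) (A B : finType) (p : seq A -> R) (q : seq B -> R).
Hypotheses (sp : stationary p) (sq : stationary q).
Variables (N M : nat) (w : nat -> nat).
Hypothesis w_step : forall u, (w u + M <= w u.+1)%N.
Variables (K : R) (W : nat -> seq A -> seq B -> bool).

Let p0 x : 0 <= p x := stat_ge0 sp x.
Let q0 y : 0 <= q y := stat_ge0 sq y.

(* The j-th block consists of N letters of x and of w (j+1) - w j letters of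
   y, about N (ln d / ln e) of them, so that both coordinates contract by
   comparable factors. *)
Definition ylen j k := (w (j + k) - w j)%N.

Lemma w_homo a b : (a <= b)%N -> (w a <= w b)%N.
Proof.
move=> /subnK <-; elim: (b - a)%N => [|k IH]//.
by rewrite addSn (leq_trans IH)// (leq_trans _ (w_step _))// leq_addr.
Qed.

Lemma ylen_homo j a b : (a <= b)%N -> (ylen j a <= ylen j b)%N.
Proof. by move=> ab; rewrite leq_sub2r// w_homo// leq_add2l. Qed.

Lemma ylenS j k : (ylen j k + M <= ylen j k.+1)%N.
Proof.
rewrite /ylen addnS; have := w_step (j + k).
have : (w j <= w (j + k))%N by rewrite w_homo// leq_addr.
lia.
Qed.

Definition xblock k (x : seq A) := take N (drop (k * N) x).
Definition yblock j k (y : seq B) :=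
  take (ylen j k.+1 - ylen j k) (drop (ylen j k) y).
(** Blocks of [y] vary in length, whereas the spread condition concerns words of one fixed length;
    [M] letters are available in every block. *)
Definition yblock_head j k (y : seq B) := take M (drop (ylen j k) y).

Definition regular j k x y := [&& ~~ predictable p K (take (k * N) x) (xblock k x),
  ~~ predictable q K (take (ylen j k) y) (yblock j k y)
  & W (j + k) (xblock k x) (yblock_head j k y)].

Lemma regular_take j n k x y : (k < n)%N ->
  regular j k (take (n * N) x) (take (ylen j n) y) = regular j k x y.
Proof.
move=> kn; have kN : (k * N + N <= n * N)%N by rewrite -mulSnr leq_mul2r kn orbT.
have yk : (ylen j k.+1 <= ylen j n)%N by apply: ylen_homo.
have := ylenS j k => ySk.
by rewrite /regular /xblock /yblock /yblock_head !take_drop_take ?take_takel//; lia.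
Qed.

Lemma regular_drop j k x y :
  regular 0 (j + k) x y -> regular j k (drop (j * N) x) (drop (w j - w 0) y).
Proof.
have ylj : (ylen 0 (j + k) = ylen j k + (w j - w 0))%N.
  rewrite /ylen add0n; have : (w 0 <= w j)%N by rewrite w_homo.
  have : (w j <= w (j + k))%N by rewrite w_homo// leq_addr.
  lia.
have yljS : (ylen 0 (j + k).+1 = ylen j k.+1 + (w j - w 0))%N.
  rewrite /ylen add0n addnS; have : (w 0 <= w j)%N by rewrite w_homo.
  have : (w j <= w (j + k).+1)%N by rewrite w_homo// leqW// leq_addr.
  lia.
rewrite /regular /xblock /yblock /yblock_head add0n ylj yljS subnDr.
rewrite !drop_drop mulnDl [(j * N + _)%N]addnC !take_drop => /and3P[h1 h2 h3].
apply/and3P; split => //.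
  by apply: contra h1 => /predictable_drop.
by apply: contra h2 => /predictable_drop.
Qed.

Variables (j : nat) (near : nat -> seq A -> seq B -> seq A -> seq B -> bool).
Definition nearby k x y := near k (take (k * N) x) (take (ylen j k) y)
  (xblock k x) (yblock_head j k y).

Lemma nearby_take n k x y : (k < n)%N ->
  nearby k (take (n * N) x) (take (ylen j n) y) = nearby k x y.
Proof.
move=> kn; have kN : (k * N + N <= n * N)%N by rewrite -mulSnr leq_mul2r kn orbT.
have yk : (ylen j k.+1 <= ylen j n)%N by apply: ylen_homo.
have := ylenS j k => ySk.
by rewrite /nearby /xblock /yblock_head !take_drop_take ?take_takel//; lia.
Qed.

Variables (beta b0 : R).
Hypotheses (K_ge0 : 0 <= K) (beta_gt0 : 0 < beta) (b0_beta : K * K * b0 <= beta).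
Hypothesis near_small : forall k x y, expect p q N M (fun u v =>
  (W (j + k) u v && near k x y u v)%:R) <= b0.

Definition block_weight k x y : R :=
  (nearby k x y)%:R * (if regular j k x y then beta^-1 else 1).

(** Given the earlier blocks, the last factor has mean at most 2: the irregular case contributes at
    most 1, and in the regular case unpredictability in both coordinates replaces the conditional
    law by the unconditional one at cost [K * K], after which [b0] is absorbed by [beta]. *)
Lemma expect_block_weights n :
  expect p q (n * N) (ylen j n) (fun x y => \prod_(k < n) block_weight k x y)
  <= 2 ^+ n.
Proof.
elim: n => [|n IH].
  rewrite mul0n /ylen addn0 subnn /expect /wsum2 /= big_ord0.
  by rewrite (stat_nil sp) (stat_nil sq) !mulr1.
have yn := ylenS j n.
have -> : (ylen j n.+1 = ylen j n + (ylen j n.+1 - ylen j n))%N by lia.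
set m := (ylen j n.+1 - ylen j n)%N; have Mm : (M <= m)%N by lia.
rewrite mulSnr expect_cat exprS mulrC.
apply: le_trans (ler_wpM2r (ler0n R 2) IH).
rewrite /expect -wsum2Zr; apply: le_wsum2 => x y sx sy.
set Pr := \prod_(k < n) _.
have Pr0 : 0 <= Pr.
  apply: prodr_ge0 => k _; apply: mulr_ge0 => //; case: ifP => _ //.
  by rewrite invr_ge0 ltW.
have prefix u v k : (k < n)%N ->
    block_weight k (x ++ u) (y ++ v) = block_weight k x y.
  move=> kn; rewrite /block_weight -(@nearby_take n)// -(@regular_take j n)//.
  by rewrite take_size_cat// take_size_cat// -(@nearby_take n k x)//
    -(@regular_take j n k x)// !take_oversize// ?sx ?sy.
apply: (@le_trans _ _ (wsum2 N m (fun u v => Pr * (p (x ++ u) * q (y ++ v) +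
    p x * q y * K * K * beta^-1 * (p u * q v *
     (W (j + n) u (take M v) && near n x y u (take M v))%:R))))).
  apply: le_wsum2 => u v su sv.
  rewrite big_ord_recr /= [X in _ * (X * _) <= _](_ : _ = Pr); last first.
    by apply: eq_bigr => k _; apply: prefix.
  rewrite mulrCA ler_wpM2l// /block_weight /nearby /regular.
  rewrite /xblock /yblock /yblock_head !take_size_cat// !drop_size_cat//.
  have -> : take N u = u by rewrite take_oversize ?su.
  have -> : take (ylen j n.+1 - ylen j n) v = v by rewrite take_oversize ?sv.
  have pq0 : 0 <= p (x ++ u) * q (y ++ v) by rewrite mulr_ge0.
  have r0 : 0 <= p x * q y * K * K * beta^-1 * (p u * q v *
     (W (j + n) u (take M v) && near n x y u (take M v))%:R).
    by rewrite !mulr_ge0 ?invr_ge0 ?(ltW beta_gt0).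
  case: (boolP (near _ _ _ _ _)) r0 => [nr|nr] r0; last first.
    by rewrite mul0r mulr0 addr_ge0.
  rewrite mul1r; case: ifP => [/and3P[hp hq Wuv]|_]; last by rewrite mulr1 lerDl.
  rewrite ler_wpDl//= Wuv mulr1.
  have := unpredictable_le hp; have := unpredictable_le hq => hq' hp'.
  have := ler_pM (p0 _) (q0 _) hp' hq'.
  have bi : 0 <= beta^-1 by rewrite invr_ge0 ltW.
  move/(ler_wpM2r bi) => /le_trans; apply.
  by rewrite le_eqVlt; apply/orP; left; apply/eqP; ring.
rewrite wsum2Z wsum2D wsum2Z [leRHS]mulrAC [leRHS]mulrC ler_wpM2l//.
rewrite -/(expect _ _ _ _ _) [X in _ + _ * X](_ : _ = expect p q N M (fun u v =>
  (W (j + n) u v && near n x y u v)%:R)); last first.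
  rewrite -(expect_take sp sq _ (leqnn N) Mm).
  by apply: eq_expect => u v su sv; have -> : take N u = u by rewrite take_oversize ?su.
have -> : wsum2 N m (fun u v => p (x ++ u) * q (y ++ v)) = p x * q y.
  rewrite -[in RHS](wsum_catr sp N) -[in RHS](wsum_catr sq m) -wsumZr.
  by apply: eq_wsum => u _; rewrite -wsumZ.
rewrite [2]/(1 + 1) mulrDr mulr1 lerD2l.
have := near_small n x y; move: (expect _ _ _ _ _) => e e_b0.
apply: (@le_trans _ _ (p x * q y * beta^-1 * (K * K * b0))).
  rewrite (_ : p x * q y * K * K / beta * e = p x * q y * beta^-1 * (K * K * e)); last by ring.
  rewrite ler_wpM2l ?mulr_ge0 ?invr_ge0 ?(ltW beta_gt0)//.
  by rewrite ler_wpM2l ?mulr_ge0.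
rewrite -mulrA ler_piMr ?mulr_ge0//.
by rewrite mulrC ler_pdivrMr// mul1r.
Qed.

End BlockSchedule.

(** * Starts from which few blocks are irregular *)

Section RegularStarts.
Variables (R : realType) (A B : finType) (p : seq A -> R) (q : seq B -> R).
Hypotheses (sp : stationary p) (sq : stationary q).
Variables (N M : nat) (w : nat -> nat).
Hypothesis w_step : forall u, (w u + M <= w u.+1)%N.
Variables (K : R) (W : nat -> seq A -> seq B -> bool) (t : R).
Hypothesis t01 : 0 < t <= 1.

Local Notation regular := (regular p q N M w K W).
Local Notation ylen := (ylen w).

(** All [n] up to [H] are tested because the number of blocks that will be used depends on the
    radius of the ball, which is not known when the start is chosen. *)
Definition erratic H j x y :=
  has (fun n => t * n%:R <= \sum_(k < n) (~~ regular j k x y)%:R) (iota 1 H).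

Lemma erraticP H j x y : reflect
  (exists n, [/\ (0 < n)%N, (n <= H)%N &
     t * n%:R <= \sum_(k < n) (~~ regular j k x y)%:R]) (erratic H j x y).
Proof.
apply: (iffP hasP) => [[n]|[n [n0 nH tn]]].
  by rewrite mem_iota add1n ltnS => /andP[n0 nH] tn; exists n.
by exists n => //; rewrite mem_iota add1n ltnS n0.
Qed.

Lemma erratic_take H j x y :
  erratic H j (take (H * N) x) (take (ylen j H) y) = erratic H j x y.
Proof.
apply: eq_in_has => n; rewrite mem_iota add1n ltnS => /andP[n0 nH].
congr (_ <= _); apply: eq_bigr => k _.
by rewrite (regular_take p q N w_step)// (leq_trans (ltn_ord k)).
Qed.

Lemma prod_if_cst n (r : pred nat) (b : R) :
  \prod_(k < n) (if r k then b else 1) = b ^+ (\sum_(k < n) r k).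
Proof.
elim: n => [|n IH]; first by rewrite !big_ord0.
rewrite !big_ord_recr /= IH exprD; congr (_ * _).
by case: (r n); rewrite ?expr1 ?expr0.
Qed.

(** On this event more than [(1 - t) * n] of the first [n] blocks are regular, so the product of the
    weights is large and Markov's inequality applies. *)
Lemma expect_nearby_le (beta b0 : R) j near n H : 0 <= K -> 0 < beta <= 1 ->
  K * K * b0 <= beta -> (n <= H)%N ->
  (forall k x y, expect p q N M (fun u v =>
     (W (j + k) u v && near k x y u v)%:R) <= b0) ->
  expect p q (H * N) (ylen j H) (fun x y => (~~ erratic H j x y &&
     [forall k : 'I_n, nearby N M w j near k x y])%:R)
  <= 2 ^+ n * beta `^ ((1 - t) * n%:R).
Proof.
move=> K0 /andP[be0 be1] Kb nH near_small.
case: n nH => [_|n nH].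
  rewrite expr0 mulr0 powRr0 mulr1 -[leRHS](expect1 sp sq (H * N) (ylen j H)).
  by apply: le_expect => // x y _ _; rewrite lern1 leq_b1.
rewrite mulrC; apply: le_trans (ler_wpM2l (powR_ge0 _ _)
  (expect_block_weights sp sq w_step K0 be0 Kb near_small n.+1)).
rewrite -(expect_take sp sq _ (_ : n.+1 * N <= H * N)%N (ylen_homo w_step j nH));
  last by rewrite leq_mul2r nH orbT.
rewrite -expectZ; apply: le_expect => // x y _ _.
have bw0 (k : 'I_n.+1) : 0 <= block_weight p q N M w K W j near beta k
    (take (n.+1 * N) x) (take (ylen j n.+1) y).
  by rewrite /block_weight mulr_ge0//; case: ifP => _; rewrite ?invr_ge0// ltW.
have [/andP[ner nb]|_] := boolP (_ && _); last first.
  by rewrite mulr_ge0 ?powR_ge0// prodr_ge0.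
set Pr := \prod_(_ < _) _.
have -> : Pr = (beta^-1) ^+ (\sum_(k < n.+1) regular j k x y).
  rewrite -(prod_if_cst _ (fun k => regular j k x y)); apply: eq_bigr => k _.
  rewrite /block_weight (nearby_take N w_step)// (regular_take p q N w_step)//.
  by rewrite (forallP nb) mul1r.
have lt_irr : \sum_(k < n.+1) (~~ regular j k x y)%:R < t * n.+1%:R.
  by rewrite ltNge; apply: contra ner => h; apply/erraticP; exists n.+1; split.
have regE : (\sum_(k < n.+1) regular j k x y)%:R = n.+1%:R -
    \sum_(k < n.+1) (~~ regular j k x y)%:R :> R.
  rewrite natr_sum; apply: (canRL (addrK _)); rewrite -big_split /=.
  transitivity (\sum_(k < n.+1) 1 : R); last by rewrite sumr_const card_ord.
  by apply: eq_bigr => k _; case: (regular _ _ _ _); rewrite /= ?addr0 ?add0r.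
rewrite -powR_mulrn ?invr_ge0 ?(ltW be0)// regE.
rewrite -(powR_inv1 (ltW be0)) -powRrM mulN1r -powRD; last first.
  by rewrite (gt_eqF be0) implybT.
rewrite -[leLHS](powRr0 beta); apply: ger_powR; first by rewrite be0 be1.
lra.
Qed.

(** By stationarity all starts live in one long pair of words, where an erratic start opens a window
    dense in blocks that are irregular for the start 0 too, by [regular_drop]; [dense_starts_le]
    counts such starts. *)
Lemma sum_erratic_le J H :
  t * \sum_(j < J) expect p q (H * N) (ylen j H)
        (fun x y => (erratic H j x y)%:R) <=
  \sum_(u < J + H) expect p q ((J + H) * N) (ylen 0 (J + H))
        (fun x y => (~~ regular 0 u x y)%:R).
Proof.
have t1 : 0 <= t <= 1 by case/andP: t01 => /ltW -> ->.
set Lx := ((J + H) * N)%N; set Ly := ylen 0 (J + H).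
rewrite -expect_sum.
rewrite (eq_bigr (fun j : 'I_J => expect p q Lx Ly (fun x y =>
    (erratic H j (drop (j * N) x) (drop (w j - w 0)%N y))%:R))); last first.
  move=> j _; have jJ := ltn_ord j.
  have -> : Lx = (j * N + (H * N + (J - j) * N))%N.
    by rewrite /Lx -!mulnDl; congr (_ * N)%N; lia.
  have Ej : Ly = (w j - w 0 + (ylen j H + (w (J + H) - w (j + H))))%N.
    rewrite /Ly /ylen add0n.
    have : (w 0 <= w j)%N by apply: (w_homo w_step).
    have : (w j <= w (j + H))%N by apply: (w_homo w_step); rewrite leq_addr.
    have : (w (j + H) <= w (J + H))%N.
      by apply: (w_homo w_step); rewrite leq_add2r ltnW.
    lia.
  rewrite Ej -(expect_window sp sq (j * N) _ ((J - j) * N) (w j - w 0) _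
    (w (J + H) - w (j + H))).
  by apply: eq_expect => x y _ _; rewrite erratic_take.
rewrite -expect_sum -expectZ; apply: le_expect => // x y _ _.
pose g u := ~~ regular 0 u x y.
pose S j := erratic H j (drop (j * N) x) (drop (w j - w 0)%N y).
have := @dense_starts_le R g S H t t1 _ J; apply.
move=> j /erraticP[n [n0 nH tn]]; exists n; split => //.
apply: (le_trans tn); apply: ler_sum => k _; rewrite ler_nat /g.
by case: (boolP (regular 0 _ _ _)) => [/(regular_drop w_step) ->|]//=; rewrite leq_b1.
Qed.

Variable eta : R.
Hypothesis xpredictable_le : forall u, wsum (u * N) (fun x => wsum N (fun v =>
  p (x ++ v) * (predictable p K x v)%:R)) <= eta.
Hypothesis ypredictable_le : forall u, wsum (ylen 0 u) (fun x =>
  wsum (ylen 0 u.+1 - ylen 0 u)%N (fun v =>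
  q (x ++ v) * (predictable q K x v)%:R)) <= eta.

Lemma expect_irregular_le u L : (u < L)%N ->
  expect p q (L * N) (ylen 0 L) (fun x y => (~~ regular 0 u x y)%:R) <=
  eta + eta + expect p q N M (fun x y => (~~ W u x y)%:R).
Proof.
move=> uL; have yu := ylenS w_step 0 u.
have yuL : (ylen 0 u.+1 <= ylen 0 L)%N by apply: (ylen_homo w_step).
pose Fx (x : seq A) (y : seq B) : R :=
  (predictable p K (take (u * N) x) (drop (u * N) x))%:R.
pose Fy (x : seq A) (y : seq B) : R :=
  (predictable q K (take (ylen 0 u) y) (drop (ylen 0 u) y))%:R.
have EW : expect p q N M (fun x y => (~~ W u x y)%:R) =
    expect p q (L * N) (ylen 0 L)
      (fun x y => (~~ W u (xblock N u x) (yblock_head M w 0 u y))%:R).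
  have -> : (L * N = u * N + (N + (L - u.+1) * N))%N.
    by rewrite -mulSn -mulnDl; congr (_ * N)%N; lia.
  have -> : (ylen 0 L = ylen 0 u + (M + (ylen 0 L - (ylen 0 u + M))))%N by lia.
  by rewrite -[LHS](expect_window sp sq (u * N) N ((L - u.+1) * N)
    (ylen 0 u) M (ylen 0 L - (ylen 0 u + M))).
have Ex : expect p q (L * N) (ylen 0 L)
    (fun x y => Fx (take (u * N + N) x) (take 0 y)) <= eta.
  rewrite (expect_take sp sq Fx) ?leq0n//; last first.
    by rewrite -mulSnr leq_mul2r uL orbT.
  apply: le_trans (xpredictable_le u); rewrite /expect /wsum2 wsum_cat.
  apply: le_wsum => x sx; apply: le_wsum => v sv /=.
  by rewrite (stat_nil sq) mulr1 /Fx take_size_cat// drop_size_cat.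
have Ey : expect p q (L * N) (ylen 0 L)
    (fun x y => Fy (take 0 x) (take (ylen 0 u.+1) y)) <= eta.
  rewrite (expect_take sp sq Fy) ?leq0n//.
  apply: le_trans (ypredictable_le u); rewrite /expect /wsum2 /=.
  have -> : ylen 0 u.+1 = (ylen 0 u + (ylen 0 u.+1 - ylen 0 u))%N by lia.
  rewrite wsum_cat addKn; apply: le_wsum => y sy; apply: le_wsum => v sv /=.
  by rewrite (stat_nil sp) mul1r /Fy take_size_cat// drop_size_cat.
apply: le_trans (lerD (lerD Ex Ey) (lexx _)); rewrite EW -!expectD.
apply: le_expect => // x y _ _.
rewrite /Fx /Fy !take_takel ?leq_addr//; last by lia.
rewrite /regular add0n /xblock /yblock.
rewrite [(u * N + N)%N]addnC -take_drop.
have -> : drop (ylen 0 u) (take (ylen 0 u.+1) y) =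
    take (ylen 0 u.+1 - ylen 0 u) (drop (ylen 0 u) y).
  by rewrite take_drop subnK//; lia.
by case: (predictable p _ _ _); case: (predictable q _ _ _); case: (W _ _ _);
  rewrite /= -!natrD ler_nat.
Qed.

(** Each of [J + J] blocks is irregular with mean probability at most [3 * eta]: two predictability
    terms and the average of [W]. Dividing by [t * J] gives [6 * eta / t] for the average start. *)
Lemma exists_regular_start J : (0 < J)%N ->
  \sum_(u < J + J) expect p q N M (fun x y => (~~ W u x y)%:R) <=
    eta * (J + J)%:R ->
  exists2 j, (j < J)%N & expect p q (J * N) (ylen j J)
        (fun x y => (erratic J j x y)%:R) <= 6 * eta / t.
Proof.
move=> J0 WJ; case/andP: (t01) => t0 _.
apply: contrapT => nex.
have big (j : 'I_J) : 6 * eta / t < expect p q (J * N) (ylen j J)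
    (fun x y => (erratic J j x y)%:R).
  by rewrite ltNge; apply/negP => h; apply: nex; exists j.
have : \sum_(j < J) (6 * eta / t) < \sum_(j < J) expect p q (J * N) (ylen j J)
    (fun x y => (erratic J j x y)%:R).
  by apply: ltr_sum => //; apply/hasP; exists (Ordinal J0).
rewrite sumr_const card_ord -mulr_natr.
rewrite -(ltr_pM2l t0) => /lt_le_trans/(_ (sum_erratic_le J J)).
have : \sum_(u < J + J) expect p q ((J + J) * N) (ylen 0 (J + J))
    (fun x y => (~~ regular 0 u x y)%:R) <=
  \sum_(u < J + J) (eta + eta + expect p q N M (fun x y => (~~ W u x y)%:R)).
  by apply: ler_sum => u _; apply: expect_irregular_le.
rewrite big_split sumr_const card_ord /= -mulr_natr => h1 h2.
have := lt_le_trans h2 (le_trans h1 (lerD (lexx _) WJ)).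
rewrite (_ : t * _ = 6 * eta * J%:R); last by field; rewrite gt_eqF.
by rewrite natrD; lra.
Qed.

End RegularStarts.
(** * Self-similar word values *)

Section AffineWords.
Variables (R : realType) (T : finType) (d : R) (t : T -> R).
Hypothesis d01 : 0 < d < 1.

Definition word_value (u : seq T) : R := foldr (fun i z => d * z + t i) 0 u.

Lemma word_value_cat u v :
  word_value (u ++ v) = word_value u + d ^+ size u * word_value v.
Proof.
elim: u => [|x u IH] /=; first by rewrite add0r expr0 mul1r.
by rewrite IH exprS; ring.
Qed.

Definition word_bound : R := (\sum_i `|t i|) / (1 - d).

Lemma word_bound_ge0 : 0 <= word_bound.
Proof. by rewrite divr_ge0 ?sumr_ge0//; case/andP: d01; lra. Qed.

Lemma word_value_bound u : `|word_value u| <= word_bound.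
Proof.
case/andP: d01 => d0 d1; elim: u => [|x u IH] /=.
  by rewrite normr0 word_bound_ge0.
have tx : `|t x| <= \sum_i `|t i| by rewrite (bigD1 x)//= lerDl sumr_ge0.
apply: (le_trans (ler_normD _ _)); rewrite normrM (gtr0_norm d0).
have := ler_wpM2l (ltW d0) IH.
have : word_bound * (1 - d) = \sum_i `|t i|.
  by rewrite /word_bound divfK// subr_eq0 gt_eqF.
lra.
Qed.

Lemma word_value_dist u v : `|word_value u - word_value v| <= 2 * word_bound.
Proof.
apply: (le_trans (ler_normB _ _)).
by have := word_value_bound u; have := word_value_bound v; lra.
Qed.

End AffineWords.

Section BlockLengths.
Variables (R : realType) (d e : R).
Hypotheses (d01 : 0 < d < 1) (e01 : 0 < e < 1).
Variable N : nat.

Let theta : R := ln d / ln e.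
Local Notation om := (N%:R * theta).

Lemma log_ratio_gt0 : 0 < theta.
Proof. by rewrite /theta -mulrNN -invrN divr_gt0// oppr_gt0 ln_lt0. Qed.

Lemma block_angle_ge0 : 0 <= om.
Proof. by rewrite mulr_ge0// ltW// log_ratio_gt0. Qed.

Lemma block_angle_irrational : irrational theta -> (0 < N)%N -> irrational om.
Proof.
move=> irr N0 [x _ xE]; apply: irr; exists (x / N%:R) => //.
have Nn0 : N%:R != 0 :> R by rewrite pnatr_eq0 -lt0n.
by rewrite rmorphM fmorphV /= ratr_nat xE mulrAC divff ?mul1r.
Qed.

Lemma whole0 : whole om 0 = 0%N.
Proof. by rewrite /whole mul0r truncn0. Qed.

Lemma whole_step u : (whole om u + Num.truncn om <= whole om u.+1)%N.
Proof.
rewrite /whole truncn_ge_nat; last exact: mulr_ge0 (ler0n _ _) block_angle_ge0.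
have /andP[h1 _] := truncn_itv (mulr_ge0 (ler0n R u) block_angle_ge0).
have /andP[h2 _] := truncn_itv block_angle_ge0.
by rewrite natrD -(natr1 u) mulrDl mul1r lerD.
Qed.

Lemma whole_step_le u : (whole om u.+1 - whole om u <= (Num.truncn om).+1)%N.
Proof.
suff : (whole om u.+1 < (whole om u + (Num.truncn om).+2))%N by lia.
rewrite {1}/whole truncn_lt_nat; last exact: mulr_ge0 (ler0n _ _) block_angle_ge0.
have /andP[_ h1] := truncn_itv (mulr_ge0 (ler0n R u) block_angle_ge0).
have /andP[_ h2] := truncn_itv block_angle_ge0.
move: h1 h2; rewrite -/(whole om u) natrD -(natr1 u) -(natr1 (Num.truncn _).+1).
by rewrite -(natr1 (whole om u)) -(natr1 (Num.truncn om)) mulrDl mul1r; lra.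
Qed.

(** The real power of [e] with exponent [om] is exactly [d ^+ N]; truncating the exponent costs at
    most one factor [e]. *)
Lemma expn_truncn_le : e ^+ Num.truncn om <= d ^+ N / e.
Proof.
case/andP: (d01) => d0 d1; case/andP: (e01) => e0 e1.
rewrite ler_pdivlMr// -exprSr -[e in leLHS]lnK ?posrE// -expRM_natr.
rewrite -[d]lnK ?posrE// -expRM_natr ler_expR.
have le0 : ln e < 0 by apply: ln_lt0.
have -> : ln d * N%:R = ln e * om.
  by rewrite /theta mulrCA [ln e * _]mulrC divfK ?lt_eqF// mulrC.
rewrite ler_nM2l//; have /andP[_] := truncn_itv block_angle_ge0.
exact: ltW.
Qed.

(** After [u] blocks the coordinates have contracted by [(d ^+ N) ^+ u] and [e ^+ whole om u]. The
    renormalized slope is the quotient, and it stays bounded because only the fractional part of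
    [u * om] survives in it. *)
Lemma orbit_slopeE (c0 : R) u :
  orbit_slope om c0 (- ln e) u * (d ^+ N) ^+ u = c0 * e ^+ whole om u.
Proof.
case/andP: (d01) => d0 d1; case/andP: (e01) => e0 e1.
rewrite /orbit_slope -mulrA; congr (_ * _).
rewrite -[e in RHS]lnK ?posrE// -[d in LHS]lnK ?posrE// -!expRM_natr -expRD.
congr expR; rewrite /phase /theta; have ln0 : ln e != 0 by rewrite lt_eqF ?ln_lt0.
by field.
Qed.

End BlockLengths.

Lemma expR_lipschitz (R : realType) (l x y : R) : x <= l -> y <= l ->
  `|expR x - expR y| <= expR l * `|x - y|.
Proof.
wlog xy : x y / y <= x => [W xl yl|xl yl].
  have [yx|xy] := leP y x; first exact: W.
  by rewrite distrC [`|x - y|]distrC; apply: W => //; apply: ltW.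
rewrite !ger0_norm ?subr_ge0 ?ler_expR//.
apply: (@le_trans _ _ (expR x * (x - y))); last first.
  by rewrite ler_wpM2r ?subr_ge0// ler_expR.
have -> : expR y = expR x * expR (y - x) by rewrite -expRD addrCA subrr addr0.
have := expR_ge1Dx (y - x); have := expR_ge0 x.
move: (expR x) (expR (y - x)) => a b; nra.
Qed.

Lemma finite_net (R : realType) (f : nat -> R) (e : R) :
  (forall j, 0 <= f j < 1) -> 0 < e ->
  exists m, forall j, exists2 i, (i <= m)%N & `|f i - f j| <= e.
Proof.
move=> f01 e0; have [n ne] := exists_nat_ge (e^-1).
have n0 : (0 < n)%N by rewrite -(ltr_nat R) (lt_le_trans _ ne)// invr_gt0.
have nR : 0 < n%:R :> R by rewrite ltr0n.
pose cell j := Num.truncn (n%:R * f j).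
have cellP j : (cell j < n)%N.
  have /andP[f0 f1] := f01 j.
  by rewrite truncn_lt_nat ?mulr_ge0// gtr_pMr.
have [first firstP] : exists h : 'I_n -> nat, forall j,
    cell (h (Ordinal (cellP j))) = cell j.
  have /choice[h hP] : forall a : 'I_n, exists i, forall j,
      cell j = a -> cell i = a.
    move=> a; have [[i ia]|no] := pselect (exists i, cell i = a).
      by exists i => j _.
    by exists 0%N => j ja; case: no; exists j.
  by exists h => j; apply: (hP (Ordinal (cellP j)) j).
exists (\max_a first a) => j; exists (first (Ordinal (cellP j))).
  exact: leq_bigmax.
set i := first _; have ij : cell i = cell j by apply: firstP.
have h k := truncn_itv (mulr_ge0 (ler0n R n) (proj1 (andP (f01 k)))).
have := h i; have := h j; rewrite -/(cell i) -/(cell j) ij -(natr1 (cell j)).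
move=> /andP[a1 a2] /andP[a3 a4].
have : `|n%:R * (f i - f j)| <= 1.
  by rewrite ler_norml; apply/andP; split; rewrite mulrBr; lra.
rewrite normrM (gtr0_norm nR) => h1.
have : e^-1 * `|f i - f j| <= 1 by apply: le_trans h1; rewrite ler_wpM2r.
by rewrite mulrC ler_pdivrMr// mul1r.
Qed.

(** With [z] the square root of [y], one factor [z ^+ N] absorbs the linear term by Bernoulli's
    inequality and the other one tends to 0. *)
Lemma linear_geometric_small (R : realType) (a y e : R) :
  0 <= a -> 0 < y < 1 -> 0 < e ->
  exists N0, forall N, (N0 <= N)%N -> (a * N%:R + 1) * y ^+ N <= e.
Proof.
move=> a0 /andP[y0 y1] e0; pose z := Num.sqrt y.
have z0 : 0 < z by rewrite sqrtr_gt0.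
have zy : z ^+ 2 = y by rewrite sqr_sqrtr// ltW.
have z1 : z < 1 by rewrite -(@ltr_pXn2r _ 2) ?nnegrE ?ltW// zy expr1n.
pose h := z^-1 - 1; have h0 : 0 < h by rewrite subr_gt0 invf_gt1.
have bern N : 1 + h * N%:R <= z^-1 ^+ N.
  elim: N => [|N IH]; first by rewrite mulr0 addr0 expr0.
  have z1h : z^-1 = 1 + h by rewrite /h; ring.
  have h1 : 0 <= 1 + h by lra.
  rewrite exprSr z1h in IH *; have := ler_wpM2r h1 IH => H.
  apply: le_trans H; rewrite -(natr1 N).
  have : 0 <= h * (h * N%:R) by rewrite !mulr_ge0// ltW.
  lra.
pose c := a / h + 1.
have c0 : 0 < c by rewrite ltr_wpDl// divr_ge0// ltW.
have [N0 N0P] := exists_nat_ge (c / e / h).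
exists N0 => N N0N.
have hN : 0 < 1 + h * N%:R by rewrite ltr_pwDl// mulr_ge0// ltW.
have zN : (1 + h * N%:R) * z ^+ N <= 1.
  rewrite -ler_pdivlMr ?exprn_gt0// div1r -exprVn; exact: bern.
rewrite -zy -exprM mulnC exprM expr2 mulrA.
have zN0 : 0 <= z ^+ N by rewrite exprn_ge0// ltW.
have aN : (a * N%:R + 1) * z ^+ N <= c.
  apply: (@le_trans _ _ (c * ((1 + h * N%:R) * z ^+ N))); last by rewrite ler_piMr// ltW.
  rewrite mulrA ler_wpM2r// /c mulrDl mul1r.
  have -> : a / h * (1 + h * N%:R) = a / h + a * N%:R by field; rewrite gt_eqF.
  have : 0 <= a / h by rewrite divr_ge0// ltW.
  have : 0 <= h * N%:R by rewrite mulr_ge0// ltW.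
  lra.
apply: (le_trans (ler_wpM2r zN0 aN)).
rewrite mulrC -ler_pdivlMr//.
have cN : c / e <= h * N%:R.
  by rewrite [leRHS]mulrC -ler_pdivrMr// (le_trans N0P)// ler_nat.
have ce0 : 0 < c / e by rewrite divr_gt0.
rewrite -[e / c]invf_div -[leRHS]mul1r ler_pdivlMr//.
apply: le_trans zN; rewrite mulrC ler_wpM2r//; lra.
Qed.
(** Dividing by [rk] normalizes the block and turns its slope into [ck * (cs / cj)]. The three
    errors are the rescaled radius, the contribution of the letters after the block, and the
    replacement of this slope by [ck]. *)
Lemma close_block (R : realType)
    (Xp Yp Xu Yv x2 y2 ck cj cs r rk rn EM Ek z BX BY C1 c0 q : R) :
  0 < r -> 0 < rk -> rn <= rk * r -> 0 <= EM <= q -> 0 <= C1 -> 0 <= BY ->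
  0 < c0 -> c0 <= `|cj| -> `|ck| <= C1 -> `|x2| <= BX -> `|y2| <= BY ->
  `|Yv| <= BY -> `|cs - cj| <= c0 -> C1 * BY * `|cs - cj| <= c0 * r ->
  ck * rk = cj * Ek ->
  `|Xp + rk * (Xu + r * x2) + cs * (Yp + Ek * (Yv + EM * y2)) - z| <= rn ->
  `|Xu + ck * Yv - (z - Xp - cs * Yp) / rk| <= r + (r * BX + 2 * C1 * q * BY) + r.
Proof.
move=> r0 rk0 rnr /andP[EM0 EMq] C10 BY0 c00 cj0 ckC x2B y2B YvB csc csr ckE close.
have cjp : 0 < `|cj| by apply: lt_le_trans cj0.
have cjn0 : cj != 0 by rewrite -normr_gt0.
pose c' := ck * (cs / cj).
have c'E : cs * Ek = c' * rk by rewrite /c' mulrAC ckE; field.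
have c'2 : `|c'| <= 2 * C1.
  have : `|cs / cj| <= 2.
    rewrite normf_div ler_pdivrMr//.
    rewrite -[cs](subrK cj); apply: (le_trans (ler_normD _ _)); lra.
  by move=> h; rewrite /c' normrM [leLHS]mulrC; apply: ler_pM.
have c'c : `|c' - ck| * BY <= r.
  have -> : c' - ck = ck * ((cs - cj) / cj) by rewrite /c'; field.
  rewrite normrM normf_div -(ler_pM2l c00); apply: le_trans csr.
  have h1 : c0 / `|cj| <= 1 by rewrite ler_pdivrMr// mul1r.
  apply: (@le_trans _ _ (`|ck| * BY * `|cs - cj|)); last first.
    by rewrite ler_wpM2r// ler_wpM2r.
  rewrite (_ : c0 * _ = `|ck| * BY * `|cs - cj| * (c0 / `|cj|)); last by ring.
  by rewrite ler_piMr// !mulr_ge0.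
set zeta := (z - Xp - cs * Yp) / rk.
have main : `|Xu + c' * Yv - zeta + (r * x2 + c' * EM * y2)| <= r.
  rewrite -(ler_pM2l rk0); apply: le_trans rnr; apply: le_trans close.
  rewrite -[X in X * `|_|](gtr0_norm rk0) -normrM le_eqVlt; apply/orP; left.
  apply/eqP; congr `|_|; rewrite [cs * (_ + _)]mulrDr mulrA c'E /zeta.
  by field; rewrite gt_eqF.
have tail : `|r * x2 + c' * EM * y2| <= r * BX + 2 * C1 * q * BY.
  apply: (le_trans (ler_normD _ _)); apply: lerD.
    by rewrite normrM (gtr0_norm r0) ler_wpM2l// ltW.
  rewrite normrM normrM (ger0_norm EM0).
  by apply: ler_pM; rewrite ?mulr_ge0//; apply: ler_pM.
have cv : `|(ck - c') * Yv| <= r.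
  by rewrite normrM distrC; apply: le_trans c'c; rewrite ler_wpM2l.
have -> : Xu + ck * Yv - zeta = (Xu + c' * Yv - zeta + (r * x2 + c' * EM * y2)) -
  (r * x2 + c' * EM * y2) + (ck - c') * Yv by ring.
apply: (le_trans (ler_normD _ _)).
apply: (le_trans (lerD (ler_normB _ _) (lexx _))).
by apply: lerD => //; apply: lerD.
Qed.

Lemma near_error_le (R : realType) (a1 a2 a3 a4 a5 : R) : 0 <= (a5 + a2) * a3 ->
  a3 + (a3 * a4 + 2 * a1 * (a3 * a2) * a5) + a3 <=
  (2 + a4 + a5 + a2 + 2 * a1 * a5 * a2) * a3.
Proof. lra. Qed.

(** * Renormalized projections of words *)

Section ProjectedWords.
Variables (R : realType) (A B : finType) (d e : R).
Hypotheses (d01 : 0 < d < 1) (e01 : 0 < e < 1).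
Variables (t : A -> R) (s : B -> R) (N : nat) (c0 : R).
Hypothesis c0_neq0 : c0 != 0.

Local Notation om := (N%:R * (ln d / ln e)).
Local Notation M := (Num.truncn om).
Local Notation w := (whole om).
Local Notation c := (orbit_slope om c0 (- ln e)).
Local Notation r := (d ^+ N).
Local Notation X := (word_value d t).
Local Notation Y := (word_value e s).
Local Notation BX := (word_bound d t).
Local Notation BY := (word_bound e s).

Definition max_slope : R := `|c0| * expR (- ln e).

(** 2, [BX] and the last term are the errors of [close_block] in units of [r]; [BY] and [e^-1] make
    the constant dominate the word bound of [s] and the rounding factor of [expn_truncn_le] when the
    scale [k] is chosen. *)
Definition near_const : R := 2 + BX + BY + e^-1 + 2 * max_slope * BY / e.

(* If X x + cs * Y y is close to z then, by self-similarity, block k of (x, y)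
   projects close to a point determined by the previous blocks px and py. *)
Definition near j cs z k (px : seq A) (py : seq B) (u : seq A) (v : seq B) :=
  `|X u + c (j + k) * Y v - (z - X px - cs * Y py) / r ^+ k| <= near_const * r.

Lemma block_slope_bounds u : `|c0| <= `|c u| <= max_slope.
Proof.
case/andP: (e01) => e0 e1.
apply: orbit_slope_bounds; last by rewrite oppr_gt0 ln_lt0.
exact: block_angle_ge0.
Qed.

Lemma block_slope_shift j k :
  c (j + k) * r ^+ k = c j * e ^+ (w (j + k) - w j).
Proof.
case/andP: (d01) => d0 d1; case/andP: (e01) => e0 e1.
have rn0 : r ^+ j != 0 by rewrite !expf_neq0// gt_eqF.
apply: (mulIf rn0); rewrite -mulrA -exprD [(k + j)%N]addnC.
rewrite [RHS]mulrAC !orbit_slopeE//.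
have wj : (w j <= w (j + k))%N.
  by apply: (w_homo (whole_step d01 e01 N)); rewrite leq_addr.
by rewrite -mulrA -exprD subnKC.
Qed.

Variables (j : nat) (cs : R).
Hypothesis cs_close : `|cs - c j| <= `|c0|.
Hypothesis cs_close' : max_slope * BY * `|cs - c j| <= `|c0| * r.

Lemma nearby_of_close z n H x y : size x = (H * N)%N -> size y = ylen w j H ->
  (n <= H)%N -> `|X x + cs * Y y - z| <= r ^+ n ->
  forall k, (k < n)%N -> nearby N M w j (near j cs z) k x y.
Proof.
case/andP: (d01) => d0 d1; case/andP: (e01) => e0 e1.
have r0 : 0 < r by rewrite exprn_gt0.
have r1 : r <= 1 by rewrite exprn_ile1// ltW.
have ms0 : 0 <= max_slope by rewrite mulr_ge0 ?expR_ge0.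
have BX0 := word_bound_ge0 t d01; have BY0 := word_bound_ge0 s e01.
have cp : 0 < `|c0| by rewrite normr_gt0.
move=> sx sy nH close k kn; rewrite /nearby /near /xblock /yblock_head.
have step := whole_step d01 e01 N.
have yS := ylenS step j k.
have yH : (ylen w j k.+1 <= ylen w j H)%N.
  by apply: (ylen_homo step); apply: leq_trans nH.
set px := take (k * N) x; set u := take N (drop (k * N) x).
set py := take (ylen w j k) y; set v := take M (drop (ylen w j k) y).
pose x2 := drop N (drop (k * N) x); pose y2 := drop M (drop (ylen w j k) y).
have spx : size px = (k * N)%N.
  by rewrite size_takel// sx leq_mul2r (leq_trans (ltnW kn) nH) orbT.
have su : size u = N.
  rewrite size_takel// size_drop sx -mulnBl leq_pmull// subn_gt0.
  exact: leq_trans nH.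
have ykH : (ylen w j k <= ylen w j H)%N.
  exact: leq_trans (leq_trans (leq_addr _ _) yS) yH.
have spy : size py = ylen w j k by rewrite size_takel// sy.
have sv : size v = M.
  by rewrite size_takel// size_drop sy leq_subRL// (leq_trans yS).
have Xx : X x = X px + r ^+ k * (X u + r * X x2).
  rewrite -{1}(cat_take_drop (k * N) x) -/px word_value_cat spx.
  rewrite -{1}(cat_take_drop N (drop (k * N) x)) -/u -/x2 word_value_cat su.
  by rewrite mulnC exprM.
have Yy : Y y = Y py + e ^+ ylen w j k * (Y v + e ^+ M * Y y2).
  rewrite -{1}(cat_take_drop (ylen w j k) y) -/py word_value_cat spy.
  by rewrite -{1}(cat_take_drop M (drop (ylen w j k) y)) -/v -/y2 word_value_cat sv.
have /andP[cj1 _] := block_slope_bounds j.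
have /andP[_ cjk2] := block_slope_bounds (j + k).
have rk0 : 0 < r ^+ k by rewrite exprn_gt0.
have rkr : r ^+ n <= r ^+ k * r by rewrite -exprSr; apply: ler_wiXn2l => //; apply: ltW.
have eM : 0 <= e ^+ M <= r / e by rewrite exprn_ge0 ?(ltW e0)// expn_truncn_le.
apply: (@le_trans _ _ (r + (r * BX + 2 * max_slope * (r / e) * BY) + r)); last first.
  have : 0 <= (BY + e^-1) * r by rewrite mulr_ge0 ?addr_ge0 ?invr_ge0// ltW.
  exact: near_error_le.
apply: (close_block r0 rk0 rkr eM ms0 BY0 cp cj1 cjk2 (word_value_bound t d01 x2)
  (word_value_bound s e01 y2) (word_value_bound s e01 v) cs_close cs_close').
  exact: block_slope_shift.
by rewrite -Xx -Yy.
Qed.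

Variables (p : seq A -> R) (q : seq B -> R).
Hypotheses (sp : stationary p) (sq : stationary q).
Variables (K : R) (W : nat -> seq A -> seq B -> bool) (tau beta b0 s0 : R).
Hypotheses (K_ge0 : 0 <= K) (beta01 : 0 < beta <= 1).
Hypotheses (Kb0 : K * K * b0 <= beta) (s0_ge0 : 0 <= s0).
Hypothesis beta_s0 : 2 * beta `^ (1 - tau) <= r `^ s0.
Hypothesis W_spread : forall u z, expect p q N M (fun x y =>
  (W u x y && (`|X x + c u * Y y - z| <= near_const * r)%R)%:R) <= b0.

(** The number [n] of blocks is the one with [r ^+ n.+1 <= rad <= r ^+ n], and rounding the radius
    to a power of [r] costs the division by [r]. For [rad >= r] the bound is trivial. *)
Lemma expect_close_le J z rad : r ^+ J <= rad ->
  expect p q (J * N) (ylen w j J) (fun x y =>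
    (~~ erratic p q N M w K W tau J j x y &&
     (`|X x + cs * Y y - z| <= rad)%R)%:R) <= (rad / r) `^ s0.
Proof.
case/andP: (d01) => d0 d1 rJ.
have r0 : 0 < r by rewrite exprn_gt0.
have r1 : r <= 1 by rewrite exprn_ile1// ltW.
have rad0 : 0 < rad by apply: lt_le_trans rJ; rewrite exprn_gt0.
have [big|small] := leP 1 (rad / r).
  apply: (@le_trans _ _ 1); last first.
    have := ge0_ler_powR s0_ge0 _ _ big; rewrite powR1; apply; rewrite nnegrE//.
    by apply: divr_ge0; exact: ltW.
  rewrite -[leRHS](expect1 sp sq (J * N) (ylen w j J)).
  by apply: le_expect => // x y _ _; rewrite lern1 leq_b1.
have [n [nJ nr rn]] : exists n, [/\ (n <= J)%N, rad <= r ^+ n & r ^+ n.+1 <= rad].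
  have rad1 : rad <= 1.
    by move: small; rewrite ltr_pdivrMr// mul1r => /ltW/le_trans; apply.
  clear small; elim: J rJ => [|J IH] rJ.
    exists 0%N; rewrite expr0 expr1; split => //.
    by move: rJ; rewrite expr0; apply: le_trans.
  have [/IH[n [nJ nr rn]]|radJ] := leP (r ^+ J) rad.
    by exists n; split => //; apply: leqW.
  by exists J; split => //; apply: ltW.
have near_small k px py : expect p q N M (fun u v =>
    (W (j + k) u v && near j cs z k px py u v)%:R) <= b0 by apply: W_spread.
have cn := expect_nearby_le sp sq (whole_step d01 e01 N) tau K_ge0 beta01
  Kb0 nJ near_small.
apply: le_trans (le_trans cn _).
  apply: le_expect => // x y sx sy; rewrite ler_nat.
  have [er|ner] //= := boolP (erratic _ _ _ _ _ _ _ _ _ _ _ _).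
  have [cl|] //= := boolP (_ <= rad).
  rewrite lt0b; apply/forallP => k; apply: (@nearby_of_close z n J) => //.
  exact: le_trans nr.
case/andP: beta01 => be0 be1.
rewrite powRrM powR_mulrn ?powR_ge0// -exprMn.
apply: (@le_trans _ _ ((r `^ s0) ^+ n)).
  by apply: lerXn2r => //; rewrite nnegrE ?mulr_ge0 ?powR_ge0.
rewrite -powR_mulrn ?powR_ge0// -powRrM mulrC powRrM powR_mulrn ?(ltW r0)//.
apply: (ge0_ler_powR s0_ge0); rewrite ?nnegrE ?exprn_ge0 ?divr_ge0
  ?(ltW r0) ?(ltW rad0) ?(ltW d0)//.
by rewrite ler_pdivlMr// -exprSr.
Qed.

End ProjectedWords.
Lemma exists_ge4 (a b c d : nat) :
  exists n, [/\ (a <= n)%N, (b <= n)%N, (c <= n)%N, (d <= n)%N & (0 < n)%N].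
Proof. by exists (maxn (maxn (maxn a b) (maxn c d)) 1); split; lia. Qed.

Lemma predictable_le (R : realType) (T : finType) (p : seq T -> R) (K K' : R) x v :
  (forall u, 0 <= p u) -> K <= K' -> predictable p K' x v -> predictable p K x v.
Proof.
move=> p0 KK /predictableP[l lx h]; apply/predictableP; exists l => //.
by apply: le_lt_trans h; rewrite ler_wpM2r// mulr_ge0.
Qed.

(* The weights g are the cylinder masses restricted to a set of probability at
   least 1 - eta; the point is that CF does not depend on the scale k. *)
Definition frostman_words (R : realType) (A B : finType) (d e : R)
    (t : A -> R) (s : B -> R) (p : seq A -> R) (q : seq B -> R) (s1 : R) :=
  forall eta : R, 0 < eta -> exists CF : R, forall n m (k : R),
    0 < k -> d ^+ n <= k -> e ^+ m <= k ->
  exists g : seq A -> seq B -> R,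
    [/\ forall x y, 0 <= g x y <= p x * q y, 1 - eta <= wsum2 n m g &
        forall z1 z2 rad : R, k <= rad -> wsum2 n m (fun x y => g x y *
          ((`|word_value d t x - z1| <= rad) &&
           (`|word_value e s y - z2| <= rad))%:R) <= CF * rad `^ s1].

Lemma double_complement_le (R : realType) (x y : R) :
  1 - y / 4 <= x -> 2 * (1 - x) <= y / 2.
Proof. lra. Qed.

(** * Choice of the constants *)

Section ChoiceOfConstants.
Variables (R : realType) (A B : finType) (d e : R).
Hypotheses (d01 : 0 < d < 1) (e01 : 0 < e < 1).
Hypothesis irr : irrational (ln d / ln e).
Variables (t : A -> R) (s : B -> R) (c0 : R).
Hypothesis c0_neq0 : c0 != 0.
Variables (p : seq A -> R) (q : seq B -> R).
Hypotheses (sp : stationary p) (sq : stationary q).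
Variables (s0 s1 : R).
Hypotheses (s0_gt0 : 0 < s0) (s01 : s0 < s1) (s1_le1 : s1 <= 1).
Hypothesis frostman : frostman_words d e t s p q s1.

Local Notation om N := (N%:R * (ln d / ln e)).
Local Notation c N := (orbit_slope (om N) c0 (- ln e)).
Local Notation nc := (near_const d e t s c0).

(** With [r = d ^+ N] and [kap] an eighth of [s1 - s0], every loss is a power of [r]: [K] is
    r^(-kap), the allowed concentration is r^(s1 - kap), and [K * K] with the factor 2 in [b0] takes
    three more [kap], whence [beta] is r^(s1 - 4 kap). The room left down to [s0] pays for the
    factor 2 per block and for the exponent 1 - kap. *)
Lemma exists_parameters (eta : R) : 0 < eta ->
  exists (N : nat) (K tau beta b0 eta1 : R) (W : nat -> seq A -> seq B -> bool),
  [/\ (0 < N)%N, (0 < Num.truncn (om N))%N, 0 < tau <= 1, 0 <= K & 0 < beta <= 1] /\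
  [/\ K * K * b0 <= beta, 2 * beta `^ (1 - tau) <= (d ^+ N) `^ s0,
    6 * eta1 / tau <= eta &
    forall u z, expect p q N (Num.truncn (om N)) (fun x y =>
     (W u x y && (`|word_value d t x + c N u * word_value e s y - z|
        <= nc * d ^+ N)%R)%:R) <= b0] /\
  [/\ forall L, wsum L (fun x => wsum N (fun v =>
       p (x ++ v) * (predictable p K x v)%:R)) <= eta1,
    forall L u, wsum L (fun x =>
       wsum (whole (om N) u.+1 - whole (om N) u)%N (fun v =>
       q (x ++ v) * (predictable q K x v)%:R)) <= eta1 &
    exists J0, forall J, (J0 <= J)%N ->
      \sum_(u < J) expect p q N (Num.truncn (om N))
        (fun x y => (~~ W u x y)%:R) <= eta1 * J%:R].
Proof.
move=> eta0; have s0p := s0_gt0; have s01' := s01; have s11 := s1_le1.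
case/andP: (d01) => d0 d1; case/andP: (e01) => e0 e1.
have p0 := stat_ge0 sp; have q0 := stat_ge0 sq.
have th0 : 0 < ln d / ln e := log_ratio_gt0 d01 e01.
pose kap : R := (s1 - s0) / 8; have kap0 : 0 < kap by rewrite /kap; lra.
have kap1 : kap <= 1 by rewrite /kap; lra.
pose eta1 : R := eta * kap / 6.
have eta10 : 0 < eta1 by apply: divr_gt0 => //; apply: mulr_gt0.
have kapE : s1 = s0 + 8 * kap by rewrite /kap; field.
have eta1E : 6 * eta1 / kap <= eta.
  by rewrite /eta1 le_eqVlt; apply/orP; left; apply/eqP; field; rewrite gt_eqF.
clearbody eta1; clearbody kap.
have kapA : 0 <= s1 - 4 * kap by lra.
have kapB : s0 <= - kap + (s1 - 4 * kap) * (1 - kap).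
  have : 0 <= kap * (1 - (s0 + 4 * kap)) by rewrite mulr_ge0 ?(ltW kap0)//; lra.
  by rewrite kapE; lra.
have s1_ge0 : 0 <= s1 by lra.
have lnd : 0 < - ln d by rewrite oppr_gt0 ln_lt0.
pose eps : R := kap * - ln d; have eps0 : 0 < eps by apply: mulr_gt0.
have epsE : eps = kap * - ln d by [].
clearbody eps.
have powE N (x : R) : (d ^+ N) `^ x = expR (x * (N%:R * ln d)).
  by rewrite /powR gt_eqF ?exprn_gt0// lnXn// -[_ *+ N]mulr_natl.
have [Np NpP] := rarely_predictable sp eps0 eta10.
(* A block of [y] has at most [N * (ln d / ln e + 1)] letters, so exp of [eps'] times its length
   stays below [K]. *)
pose eps' : R := eps / (ln d / ln e + 1).
have eps'0 : 0 < eps' by apply: divr_gt0 => //; apply: addr_gt0.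
have [Nq NqP] := rarely_predictable sq eps'0 eta10.
have eF : 0 < eta1 / 4 by lra.
have [CF CFP] := frostman eF.
(* [a * N] doublings lead from scale [k] to the diameter. The number of scales is thus linear in [N]
   and is beaten by [y ^+ N], which is r^kap. *)
have [a aP] : exists a : nat, d^-1 <= 2 ^+ a.
  have [a aP] := exists_nat_ge d^-1; exists a; apply: (le_trans aP).
  by rewrite -natrX ler_nat ltnW// ltn_expl.
have ncs : [/\ 2 <= nc, word_bound d t <= nc, word_bound e s <= nc & e^-1 <= nc].
  have h1 := word_bound_ge0 t d01; have h2 := word_bound_ge0 s e01.
  have h3 : 0 <= e^-1 by rewrite invr_ge0 ltW.
  have ms0 : 0 <= max_slope e c0 by apply: mulr_ge0 => //; apply: expR_ge0.
  have h4 : 0 <= 2 * max_slope e c0 * word_bound e s / e.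
    by apply: mulr_ge0 => //; apply: mulr_ge0 => //; apply: mulr_ge0.
  by rewrite /near_const; split; lra.
case: ncs => nc2 ncX ncY nce.
have nc_gt0 : 0 < nc by apply: lt_le_trans nc2.
have nc1 : 1 <= 2 * nc by move: nc nc2 => x; lra.
have lam0 : 0 < - ln e by rewrite oppr_gt0 ln_lt0.
have [oc ocE] : exists oc : R, oc = orbit_const c0 (- ln e) by eexists.
have oc0 : 0 <= oc by rewrite ocE (le_trans ler01)// orbit_const_ge1.
pose Cc : R := 2 * (oc * (2 * `|CF| * (2 * nc) `^ s1)).
have Cc0 : 0 <= Cc.
  apply: mulr_ge0 => //; apply: mulr_ge0 => //.
  by apply: mulr_ge0; [apply: mulr_ge0|apply: powR_ge0].
pose y : R := d `^ kap.
have y01 : 0 < y < 1.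
  rewrite powR_gt0//= /y /powR gt_eqF// expR_lt1 pmulr_rlt0//; lra.
have CcE : Cc = 2 * (oc * (2 * `|CF| * (2 * nc) `^ s1)) by [].
clearbody Cc.
have e4 : 0 < eta1 / 2 / (Cc + 1) by apply: divr_gt0; lra.
have [Ng NgP] := linear_geometric_small (ler0n R a) y01 e4.
have [Nth NthP] := exists_nat_ge ((maxn Nq 1)%:R / (ln d / ln e)).
have [Ne NeP] := exists_nat_ge (eps^-1).
have [N [NNp NNg NNth NNe N1]] := exists_ge4 Np Ng Nth Ne.
pose M := Num.truncn (om N).
have om0 : 0 <= om N := block_angle_ge0 d01 e01 N.
have MNq : (maxn Nq 1 <= M)%N.
  rewrite /M truncn_ge_nat// -ler_pdivrMr//.
  by apply: (le_trans NthP); rewrite ler_nat.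
have NqM : (Nq <= M)%N by apply: leq_trans MNq; rewrite leq_maxl.
have M0 : (0 < M)%N by apply: leq_trans MNq; rewrite leq_maxr.
pose r : R := d ^+ N; have r0 : 0 < r by rewrite exprn_gt0.
have r1 : r <= 1 by rewrite exprn_ile1// ltW.
have rn0 x : (x == 0) ==> (r != 0) by rewrite (gt_eqF r0) implybT.
pose K : R := r `^ (- kap).
have KE : K = expR (eps * N%:R) by rewrite /K powE epsE; congr expR; ring.
have K2 : 2 <= K.
  rewrite KE; apply: le_trans (expR_ge1Dx _).
  rewrite -[2]/(1 + 1) lerD2l.
  by rewrite mulrC -ler_pdivrMr// div1r (le_trans NeP)// ler_nat.
(* Twice the radius used in [near], because [wsum2_spread_le] controls balls of radius [k / 2]. *)
pose k : R := 2 * nc * r; have k0 : 0 < k by rewrite /k mulr_gt0// mulr_gt0.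
have rk : r <= k by rewrite /k ler_peMl ?(ltW r0).
have eMk : e ^+ M <= k.
  apply: (le_trans (expn_truncn_le d01 e01 N)).
  rewrite /k mulrC ler_wpM2r ?(ltW r0)// (le_trans nce)// ler_peMl ?(ltW nc_gt0)//.
  by rewrite ler1n.
have [g [g01 g1 gF]] := CFP N M k k0 rk eMk.
have g0 x y' : 0 <= g x y' by case/andP: (g01 x y').
have gP x y' : g x y' <= p x * q y' by case/andP: (g01 x y').
have P1 : wsum2 N M (fun x y => p x * q y) = 1.
  rewrite -(expect1 sp sq N M); apply: eq_wsum2 => x y' _ _.
  by rewrite mulr1.
pose s2 : R := s1 - kap.
pose W := spread (om N) c0 (- ln e) N M (word_value d t) (word_value e s)
  (fun x y => p x * q y) g k (r `^ s2).
exists N, K, kap, (r `^ (s1 - 4 * kap)), (2 * r `^ s2), eta1, W.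
have beta0 : 0 < r `^ (s1 - 4 * kap) by rewrite powR_gt0.
have r01 : 0 < r <= 1 by rewrite r0 r1.
split; [split|split] => //.
- by rewrite kap0 kap1.
- by rewrite powR_ge0.
- rewrite beta0/= -[leRHS](powRr0 r); apply: (ger_powR r01).
  exact: kapA.
- split.
  + apply: (@le_trans _ _ (K * K * (K * r `^ s2))).
      by rewrite ler_wpM2l ?mulr_ge0 ?powR_ge0// ler_wpM2r ?powR_ge0.
    rewrite (_ : s1 - 4 * kap = (- kap + - kap) + (- kap + s2)); last first.
      by rewrite /s2; ring.
    by rewrite /K !powRD ?rn0 ?mulrA.
  + apply: (@le_trans _ _ (K * (r `^ (s1 - 4 * kap)) `^ (1 - kap))).
      by rewrite ler_wpM2r ?powR_ge0.
    rewrite -powRrM /K -powRD ?rn0//; apply: (ger_powR r01).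
    exact: kapB.
  + exact: eta1E.
  + move=> u z; have := @wsum2_spread_le R (om N) c0 (- ln e) A B N M
      (word_value d t) (word_value e s) (fun x y => p x * q y) g k g0 (r `^ s2) u z.
    rewrite (_ : k / 2 = nc * d ^+ N); last by rewrite /k -/r; field.
    by rewrite (max_idPr _) ?powR_ge0.
- split.
  + by move=> L; rewrite KE; apply: NpP.
  + move=> L u; set m := (whole _ _ - _)%N.
    have stepM := whole_step d01 e01 N u.
    have mM : (M <= m)%N by rewrite /m leq_subRL// (leq_trans _ stepM)// leq_addr.
    have mM1 : (m <= M.+1)%N := whole_step_le d01 e01 N u.
    apply: le_trans (NqP m L (leq_trans NqM mM)).
    apply: le_wsum => x _; apply: le_wsum => v _; rewrite ler_wpM2l// ler_nat.
    case: (boolP (predictable q K x v)) => // h; rewrite lt0b.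
    apply: predictable_le h => //; rewrite KE ler_expR.
    rewrite /eps' mulrAC ler_pdivrMr ?addr_gt0// -mulrA ler_wpM2l ?(ltW eps0)//.
    have /andP[tM _] := truncn_itv om0.
    have : m%:R <= M%:R + 1 :> R by rewrite natr1 ler_nat.
    have : 1 <= N%:R :> R by rewrite ler1n.
    move=> N1R mM'; rewrite mulrDr mulr1; apply: (le_trans mM').
    exact: lerD.
  + have DX x x' : `|word_value d t x - word_value d t x'| <= 2 * nc.
      by apply: (le_trans (word_value_dist t d01 x x')); rewrite ler_wpM2l.
    have DY x x' : `|word_value e s x - word_value e s x'| <= 2 * nc.
      by apply: (le_trans (word_value_dist s e01 x x')); rewrite ler_wpM2l.
    have DI : 2 * nc <= 2 ^+ (a * N).+1 * k.
      have ad : 1 <= 2 ^+ (a * N) * r.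
        rewrite exprM /r -exprMn exprn_ege1//.
        by rewrite -ler_pdivrMr// div1r.
      have -> : 2 ^+ (a * N).+1 * k = 2 * nc * (2 * (2 ^+ (a * N) * r)).
        by rewrite /k exprS; ring.
      rewrite ler_peMr ?mulr_ge0 ?(ltW nc_gt0)//.
      by apply: (le_trans ad); rewrite ler_peMl ?(le_trans _ ad)// ler1n.
    have omirr := block_angle_irrational irr N1.
    have s10 := s1_ge0.
    have rs2 : 0 < r `^ s2 by rewrite powR_gt0.
    have [J0 J0P] := sum_not_spread_le omirr om0 c0_neq0 lam0 g0 gP P1 k0
      s1_le1 gF DX DY DI rs2.
    exists J0 => J J0J; apply: (le_trans (J0P J J0J)); rewrite -ocE ler_wpM2r//.
    rewrite [leRHS]splitr; apply: lerD; first exact: double_complement_le.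
    have -> : k `^ s1 = (2 * nc) `^ s1 * (r `^ s2 * y ^+ N).
      rewrite /k powRM ?(ltW r0)//; last by rewrite mulr_ge0 ?(ltW nc_gt0).
      congr (_ * _); rewrite -[in LHS](subrK kap s1) -/s2 powRD ?rn0//; congr (_ * _).
      by rewrite powE /y /powR gt_eqF// -expRM_natr; congr expR; ring.
    apply: (@le_trans _ _ (Cc * ((a%:R * N%:R + 1) * y ^+ N))); last first.
      apply: (@le_trans _ _ ((Cc + 1) * (eta1 / 2 / (Cc + 1)))); last first.
        by rewrite mulrC divfK// gt_eqF// ltr_wpDl.
      have yN : 0 <= (a%:R * N%:R + 1) * y ^+ N.
        by rewrite mulr_ge0 ?addr_ge0 ?mulr_ge0// exprn_ge0//; case/andP: y01 => /ltW.
      by apply: ler_pM => //; [rewrite lerDl|apply: NgP].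
    rewrite ler_pdivrMr// -(natr1 (a * N)) natrM CcE.
    have yN : 0 <= y ^+ N by rewrite exprn_ge0//; case/andP: y01 => /ltW.
    rewrite (_ : 2 * _ = CF * (2 * oc * 2 * (2 * nc) `^ s1 *
      (a%:R * N%:R + 1) * y ^+ N * r `^ s2)); last by ring.
    rewrite [leRHS](_ : _ = `|CF| * (2 * oc * 2 * (2 * nc) `^ s1 *
      (a%:R * N%:R + 1) * y ^+ N * r `^ s2)); last by ring.
    rewrite ler_wpM2r ?ler_norm//.
    by rewrite !mulr_ge0 ?powR_ge0// addr_ge0// mulr_ge0.
Qed.

End ChoiceOfConstants.
Lemma exists_pow_le_all (R : realType) (r : R) (L : seq (R * R)) : 0 < r < 1 ->
  (forall zr, zr \in L -> 0 < zr.2) ->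
  exists J0, forall J, (J0 <= J)%N -> forall zr, zr \in L -> r ^+ J <= zr.2.
Proof.
move=> r01; elim: L => [|a L IH] L0; first by exists 0%N.
have [J1 J1P] := IH (fun zr zrL => L0 zr (mem_behead (s := a :: L) zrL)).
have [J2 J2P] := linear_geometric_small (lexx 0) r01 (L0 a (mem_head _ _)).
exists (maxn J1 J2) => J; rewrite geq_max => /andP[J1J J2J] zr.
rewrite inE => /orP[/eqP ->|]; last exact: J1P.
by have := J2P J J2J; rewrite mul0r add0r mul1r.
Qed.

Lemma ylen_ge (M : nat) (w : nat -> nat) (w_step : forall u, (w u + M <= w u.+1)%N)
  j k : (k * M <= ylen w j k)%N.
Proof.
elim: k => [|k IH]//; apply: leq_trans (ylenS w_step j k).
by rewrite mulSnr leq_add2r.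
Qed.

Lemma expect_drop (R : realType) (A B : finType) (p : seq A -> R) (q : seq B -> R)
    l n l' m F : stationary p -> stationary q ->
  expect p q (l + n) (l' + m) (fun x y => F (drop l x) (drop l' y)) =
  expect p q n m F.
Proof.
move=> sp sq; rewrite -(expect_window sp sq l n 0 l' m 0) !addn0.
apply: eq_expect => x y sx sy.
by rewrite !take_oversize// size_drop ?sx ?sy addKn.
Qed.

(** * Mass of unions of balls, on the level of words *)

Section WordMeasure.
Variables (R : realType) (A B : finType) (d e : R).
Hypotheses (d01 : 0 < d < 1) (e01 : 0 < e < 1).
Hypothesis irr : irrational (ln d / ln e).
Variables (t : A -> R) (s : B -> R) (c0 : R).
Hypothesis c0_neq0 : c0 != 0.
Variables (p : seq A -> R) (q : seq B -> R).
Hypotheses (sp : stationary p) (sq : stationary q).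
Variables (s0 s1 : R).
Hypotheses (s0_gt0 : 0 < s0) (s01 : s0 < s1) (s1_le1 : s1 <= 1).
Hypothesis frostman : frostman_words d e t s p q s1.

Local Notation X := (word_value d t).
Local Notation Y := (word_value e s).

Lemma orbit_slope_net (N : nat) (D : R) : 0 < D -> exists m, forall j,
  exists2 i, (i <= m)%N &
    `|orbit_slope (N%:R * (ln d / ln e)) c0 (- ln e) i -
      orbit_slope (N%:R * (ln d / ln e)) c0 (- ln e) j| <= D.
Proof.
move=> D0; case/andP: (e01) => e0 e1.
have lam0 : 0 < - ln e by rewrite oppr_gt0 ln_lt0.
have C0 : 0 < `|c0| * (expR (- ln e) * - ln e).
  by rewrite !mulr_gt0 ?normr_gt0 ?expR_gt0.
have ph := phase_itv (block_angle_ge0 d01 e01 N).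
have [m mP] := finite_net ph (divr_gt0 D0 C0).
exists m => j; have [i im ij] := mP j; exists i => //.
move: ij; rewrite ler_pdivlMr// mulrC => ij.
rewrite /orbit_slope -mulrBr normrM; apply: le_trans ij.
rewrite -mulrA ler_wpM2l//.
have le1 u : - ln e * phase (N%:R * (ln d / ln e)) u <= - ln e.
  by rewrite ler_piMr ?(ltW lam0)//; case/andP: (ph u) => _ /ltW.
apply: (le_trans (expR_lipschitz (le1 i) (le1 j))).
have -> x y : - ln e * x - - ln e * y = - ln e * (x - y) by ring.
by rewrite normrM (gtr0_norm lam0) -[leRHS]mulrA.
Qed.

(* The slope of a start j with few irregular blocks is approximated by the
   slope of one of boundedly many i. By self-similarity, X x + c0 * Y y is an
   affine image, depending only on the first i blocks, of the projection with
   slope c i of the remaining ones, and the union bound over these blocks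
   enters the constant. *)
Lemma words_measure_le (eta : R) : 0 < eta -> exists2 Cst : R, 0 <= Cst &
  forall L : seq (R * R), (forall zr, zr \in L -> 0 < zr.2) ->
  forall n0, exists n m, [/\ (n0 <= n)%N, (n0 <= m)%N &
    expect p q n m (fun x y =>
      (has (fun zr => `|X x + c0 * Y y - zr.1| <= zr.2) L)%:R)
    <= eta + Cst * \sum_(zr <- L) zr.2 `^ s0].
Proof.
move=> eta0.
have [N [K [tau [beta [b0 [eta1 [W]]]]]]] := exists_parameters d01 e01 irr
  c0_neq0 sp sq s0_gt0 s01 s1_le1 frostman eta0.
set om := N%:R * _; set M := Num.truncn om.
move=> [[N0 M0 tau01 K0 beta01]].
move=> [[Kb0 beta_s0 eta1E W_spread] [xpred ypred [J0 J0P]]].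
case/andP: (d01) => d0 d1; pose r := d ^+ N; rewrite -/r in beta_s0.
have r0 : 0 < r by rewrite exprn_gt0.
have r1 : r < 1 by rewrite exprn_ilt1// ?(ltW d0)// -lt0n.
have r01 : 0 < r < 1 by rewrite r0 r1.
pose c := orbit_slope om c0 (- ln e); pose w := whole om.
have cp : 0 < `|c0| by rewrite normr_gt0.
have mB0 : 0 <= max_slope e c0 * word_bound e s.
  by apply: mulr_ge0; [apply: mulr_ge0 => //; apply: expR_ge0|apply: word_bound_ge0].
have mB1 : 0 < 1 + max_slope e c0 * word_bound e s by apply: ltr_pwDl.
(* Small enough for both closeness conditions on the replaced slope, [cs_close] and [cs_close']. *)
pose D := `|c0| * r / (1 + max_slope e c0 * word_bound e s).
have D0 : 0 < D by apply: divr_gt0 => //; apply: mulr_gt0.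
have Dc : D <= `|c0|.
  rewrite /D ler_pdivrMr// ler_wpM2l// (le_trans (ltW r1))// lerDl//.
have DmB : max_slope e c0 * word_bound e s * D <= `|c0| * r.
  rewrite /D mulrA ler_pdivrMr// [leLHS]mulrC ler_wpM2l ?mulr_ge0 ?(ltW r0)//.
  by rewrite lerDr.
have [I IP] := orbit_slope_net N D0.
pose cnt i : R := (#|A| ^ (i * N) * #|B| ^ w i)%:R.
(* The first [i] blocks rescale radii by [r ^+ i]; the further [r] is the rounding loss of
   [expect_close_le]. *)
pose Cst := \sum_(i < I.+1) cnt i * (r ^+ i * r)^-1 `^ s0.
have Cst0 i : 0 <= cnt i * (r ^+ i * r)^-1 `^ s0 by rewrite mulr_ge0 ?powR_ge0.
exists Cst; first by rewrite sumr_ge0.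
move=> L L0 n0; have [J1 J1P] := exists_pow_le_all r01 L0.
(* [J] must be long enough for the average over [W], for [r ^+ J] to lie below every radius, and for
   the words to exceed [n0]. *)
have [J [J0J J1J nJ _ Jp]] := exists_ge4 J0 J1 n0 0%N.
have step := whole_step d01 e01 N.
have wE u : ylen w 0 u = w u by rewrite /ylen add0n /w whole0 subn0.
have ypred' u : wsum (ylen w 0 u) (fun x =>
    wsum (ylen w 0 u.+1 - ylen w 0 u)%N (fun v =>
    q (x ++ v) * (predictable q K x v)%:R)) <= eta1.
  by rewrite !wE; apply: ypred.
have WJ : \sum_(u < J + J) expect p q N M (fun x y => (~~ W u x y)%:R) <=
    eta1 * (J + J)%:R by apply: J0P; rewrite (leq_trans J0J)// leq_addr.
have [j jJ ej] := exists_regular_start sp sq step tau01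
  (fun u => xpred (u * N)%N) ypred' Jp WJ.
have [i iI ij] := IP j.
have ci_close : `|c i - c j| <= `|c0| by apply: le_trans Dc.
have ci_close' : max_slope e c0 * word_bound e s * `|c i - c j| <= `|c0| * r.
  by apply: le_trans DmB; rewrite ler_wpM2l.
exists (i * N + J * N)%N, (w i + ylen w j J)%N; split.
- by rewrite (leq_trans nJ)// (leq_trans _ (leq_addl _ _))// leq_pmulr.
- rewrite (leq_trans nJ)// (leq_trans _ (leq_addl _ _))//.
  by rewrite (leq_trans _ (ylen_ge step j J))// leq_pmulr.
pose er x y := erratic p q N M w K W tau J j x y.
pose Xr (zr : R * R) (x0 : seq A) (y0 : seq B) x y : bool := ~~ er x y &&
  (`|X x + c i * Y y - (zr.1 - X x0 - c0 * Y y0) / r ^+ i| <= zr.2 / r ^+ i)%R.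
have ri0 : 0 < r ^+ i by rewrite exprn_gt0.
have cE : c i * r ^+ i = c0 * e ^+ w i by apply: orbit_slopeE.
apply: (@le_trans _ _ (expect p q (i * N + J * N) (w i + ylen w j J) (fun x y =>
   (er (drop (i * N) x) (drop (w i) y))%:R + \sum_(zr <- L)
    \sum_(xy : (i * N).-tuple A * (w i).-tuple B)
     (Xr zr xy.1 xy.2 (drop (i * N) x) (drop (w i) y))%:R))).
  apply: le_expect => // x y sx sy.
  have [e1|ne1] := boolP (er _ _).
    rewrite (@le_trans _ _ 1) ?lern1 ?leq_b1// lerDl.
    by rewrite sumr_ge0// => *; rewrite sumr_ge0.
  rewrite add0r; have [/hasP[zr zrL near]|_] := boolP (has _ _); last first.
    by rewrite sumr_ge0// => *; rewrite sumr_ge0.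
  have sx0 : size (take (i * N) x) == (i * N)%N.
    by rewrite size_takel// sx leq_addr.
  have sy0 : size (take (w i) y) == w i by rewrite size_takel// sy leq_addr.
  rewrite (big_rem zr)//= (bigD1 (Tuple sx0, Tuple sy0))//= -addrA.
  suff -> : Xr zr (take (i * N) x) (take (w i) y) (drop (i * N) x) (drop (w i) y).
    by rewrite lerDl addr_ge0// ?sumr_ge0// => *; rewrite sumr_ge0.
  rewrite /Xr ne1 /= ler_pdivlMr// -[X in _ * X](gtr0_norm ri0) -normrM.
  apply: le_trans near; rewrite le_eqVlt; apply/orP; left; apply/eqP; congr `|_|.
  rewrite -{3}(cat_take_drop (i * N) x) -{3}(cat_take_drop (w i) y).
  rewrite !word_value_cat (eqP sx0) (eqP sy0).
  have -> : d ^+ (i * N) = r ^+ i by rewrite mulnC exprM.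
  rewrite [c0 * (_ + _)]mulrDr [c0 * (_ * _)]mulrA -cE.
  move: (X _) (X _) (Y _) (Y _) => a1 a2 a3 a4.
  move: (lt0r_neq0 ri0); move: (r ^+ i) (c i) => rr cc rr0; by field.
rewrite expectD (expect_drop _ _ _ _ (fun x y => (er x y)%:R) sp sq).
apply: lerD; first exact: le_trans eta1E.
rewrite expect_sum mulr_sumr big_seq [leRHS]big_seq; apply: ler_sum => zr zrL.
rewrite expect_sum; apply: (@le_trans _ _ (cnt i * (r ^+ i * r)^-1 `^ s0 * zr.2 `^ s0)).
  apply: (@le_trans _ _ (\sum_(xy : (i * N).-tuple A * (w i).-tuple B)
     (r ^+ i * r)^-1 `^ s0 * zr.2 `^ s0)); last first.
    by rewrite sumr_const card_prod !card_tuple -[leLHS]mulr_natl mulrA.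
  apply: ler_sum => xy _; rewrite (expect_drop _ _ _ _
    (fun x y => (Xr zr xy.1 xy.2 x y)%:R) sp sq).
  rewrite -powRM ?invr_ge0 ?mulr_ge0 ?(ltW r0) ?(ltW ri0) ?(ltW (L0 zr zrL))//.
  rewrite (_ : _^-1 * zr.2 = zr.2 / r ^+ i / r); last by rewrite invfM; ring.
  apply: (expect_close_le d01 e01 c0_neq0 ci_close ci_close' sp sq K0
    beta01 Kb0 (ltW s0_gt0) beta_s0 W_spread).
  rewrite ler_pdivlMr//; apply: le_trans (J1P J J1J zr zrL).
  rewrite -/r ler_piMr//; first by rewrite exprn_ge0// ltW.
  by apply: exprn_ile1; apply: ltW.
rewrite ler_wpM2r ?powR_ge0// /Cst.
have iI1 : (i < I.+1)%N by [].
by rewrite (bigD1 (Ordinal iI1))//= lerDl sumr_ge0.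
Qed.

End WordMeasure.
(** * Measures on the symbolic spaces *)

Section RealProbability.
Context (dsp : measure_display) (T : measurableType dsp) (R : realType).
Variable P : probability T R.
Implicit Types (A B : set T).

Definition Pr A : R := fine (P A).

Lemma PrE A : measurable A -> P A = (Pr A)%:E.
Proof. by move=> mA; rewrite /Pr fineK// fin_num_measure. Qed.

Lemma Pr_ge0 A : 0 <= Pr A.
Proof. by rewrite fine_ge0. Qed.

Lemma Pr_setT : Pr setT = 1.
Proof. by rewrite /Pr probability_setT. Qed.

Lemma Pr_set0 : Pr set0 = 0.
Proof. by rewrite /Pr measure0. Qed.

Lemma le_Pr A B : measurable A -> measurable B -> A `<=` B -> Pr A <= Pr B.
Proof.
move=> mA mB AB; rewrite -lee_fin -!PrE//.
by apply: le_measure => //; rewrite inE.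
Qed.

Lemma Pr_le1 A : measurable A -> Pr A <= 1.
Proof. by move=> mA; rewrite -Pr_setT le_Pr. Qed.

Lemma PrU A B : measurable A -> measurable B -> A `&` B = set0 ->
  Pr (A `|` B) = Pr A + Pr B.
Proof.
move=> mA mB AB; apply: EFin_inj.
rewrite EFinD -!PrE//; last exact: measurableU.
exact: measureU.
Qed.

Lemma PrU_le A B : measurable A -> measurable B -> Pr (A `|` B) <= Pr A + Pr B.
Proof.
move=> mA mB; have -> : A `|` B = A `|` (B `\` A).
  by rewrite setUDr setDv setD0; apply/seteqP; split=> x /=; tauto.
have mBA : measurable (B `\` A) by apply: measurableD.
rewrite PrU//; last by apply/seteqP; split => x //= [? []].
by rewrite lerD2l le_Pr// => x [].
Qed.

Lemma Pr_setC A : measurable A -> Pr (~` A) = 1 - Pr A.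
Proof.
move=> mA; have mC : measurable (~` A) by apply: measurableC.
by rewrite -Pr_setT -(setUv A) PrU// ?setICr// addrAC subrr add0r.
Qed.

Lemma measurable_finite_mem (F : finType) (h : T -> F) (s : seq F) :
  (forall x, measurable [set w | h w = x]) -> measurable [set w | h w \in s].
Proof.
move=> mh; elim: s => [|x s IH].
  by rewrite (_ : mkset _ = set0)//; apply/seteqP; split.
rewrite (_ : mkset _ = [set w | h w = x] `|` [set w | h w \in s]).
  exact: measurableU.
by apply/seteqP; split=> w /=; rewrite inE => /predU1P.
Qed.

Lemma measurable_finite_preimage (F : finType) (h : T -> F) (S : set F) :
  (forall x, measurable [set w | h w = x]) -> measurable [set w | S (h w)].
Proof.
move=> mh; rewrite (_ : mkset _ = [set w | h w \in enum [pred x | `[< S x >]]]).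
  exact: measurable_finite_mem.
by apply/seteqP; split=> w /=; rewrite mem_enum => /asboolP.
Qed.

Lemma Pr_partition (F : finType) (h : T -> F) A :
  (forall x, measurable [set w | h w = x]) -> measurable A ->
  Pr A = \sum_x Pr (A `&` [set w | h w = x]).
Proof.
move=> mh mA.
have mF (s : seq F) := measurable_finite_mem s mh.
have H (s : seq F) : uniq s -> Pr (A `&` [set w | h w \in s]) =
    \sum_(x <- s) Pr (A `&` [set w | h w = x]).
  elim: s => [|x s IH] /=.
    rewrite big_nil (_ : _ `&` _ = set0) ?Pr_set0//.
    by apply/seteqP; split => w //= [].
  move=> /andP[xs us]; rewrite big_cons -IH// -PrU.
  - congr Pr; rewrite -setIUr; congr (_ `&` _).
    by apply/seteqP; split=> w /=; rewrite inE => /predU1P.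
  - exact: measurableI.
  - exact: measurableI.
  - apply/seteqP; split => w //= [[_ hx] [_ hs]].
    by move: xs; rewrite -hx hs.
rewrite -big_enum -H ?enum_uniq//; congr Pr.
by apply/seteqP; split => w /= => [Aw|[]//]; rewrite mem_enum.
Qed.

End RealProbability.
Section RandomWords.
Context (dsp : measure_display) (T : measurableType dsp) (R : realType).
Variables (P : probability T R) (F : finType) (h : nat -> T -> F).
Hypothesis mh : forall i x, measurable [set w | h i w = x].

Definition prefix n (w : T) : seq F := [seq h i w | i <- iota 0 n].

Lemma size_prefix n w : size (prefix n w) = n.
Proof. by rewrite size_map size_iota. Qed.

Lemma prefixS n w : prefix n.+1 w = rcons (prefix n w) (h n w).
Proof. by rewrite /prefix -addn1 iotaD map_cat cats1. Qed.

Lemma prefixS_eq n u x w :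
  (prefix n.+1 w = rcons u x) = (prefix n w = u /\ h n w = x).
Proof.
rewrite prefixS; apply/propext; split=> [|[-> ->]]//.
by move=> /eqP; rewrite eqseq_rcons => /andP[/eqP -> /eqP ->].
Qed.

Lemma measurable_prefix u : measurable [set w | prefix (size u) w = u].
Proof.
elim/last_ind: u => [|u x IH].
  by rewrite (_ : mkset _ = setT)//; apply/seteqP; split.
rewrite size_rcons (_ : mkset _ =
    [set w | prefix (size u) w = u] `&` [set w | h (size u) w = x]).
  exact: measurableI.
by apply/seteqP; split=> w /=; rewrite prefixS_eq.
Qed.

Lemma measurable_prefix_eq n u : measurable [set w | prefix n w = u].
Proof.
have [<-|nu] := eqVneq (size u) n; first exact: measurable_prefix.
rewrite (_ : mkset _ = set0)//; apply/seteqP; split => w //= wu.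
by move: nu; rewrite -wu size_prefix eqxx.
Qed.

Lemma Pr_wsum n (E : set T) : measurable E ->
  Pr P E = wsum n (fun u => Pr P (E `&` [set w | prefix n w = u])).
Proof.
move=> mE; elim: n => [|n IH].
  by congr Pr; apply/seteqP; split => w /= => [|[]].
rewrite wsumSr IH; apply: eq_wsum => u su.
have mEu : measurable (E `&` [set w | prefix n w = u]).
  by apply: measurableI => //; apply: measurable_prefix_eq.
rewrite (Pr_partition P (mh n) mEu); apply: eq_bigr => x _; congr Pr.
apply/seteqP; split => w /=; rewrite prefixS_eq.
  by move=> [[? ?] ?].
by move=> [? [? ?]].
Qed.

End RandomWords.

Section Cylinders.
Variables (R : realType) (a : nat) (ha : (2 <= a)%N).
Variable mu : probability (symbolic_space ha) R.

Definition letter (i : nat) (w : symbolic_space ha) : 'I_a := w i.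

Lemma measurable_letter i x : measurable [set w | letter i w = x].
Proof.
apply: sub_sigma_algebra.
have -> : [set w | letter i w = x] =
   (@proj nat (fun=> alphabet ha) i : sequence_space ha -> alphabet ha) @^-1` [set x].
  by apply/seteqP; split.
apply: open_comp => [w _|]; first exact: proj_continuous.
exact: discrete_open.
Qed.

Definition word_prob (u : seq 'I_a) : R :=
  Pr mu [set w | prefix letter (size u) w = u].

Hypothesis hmu : shift_invariant mu.

(** The cylinders over [x :: u] partition the shift preimage of the cylinder over [u]: this is where
    invariance enters. *)
Lemma stationary_word_prob : stationary word_prob.
Proof.
have mp u := measurable_prefix measurable_letter u.
split.
- by move=> u; apply: Pr_ge0.
- rewrite /word_prob (_ : mkset _ = setT) ?Pr_setT//.
  by apply/seteqP; split.
- move=> u; rewrite /word_prob -[RHS]/(fine _) -hmu; last exact: mp.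
  rewrite -/(Pr _ _).
  have ms : measurable (@Defs.shift a ha @^-1` [set w | prefix letter (size u) w = u]).
    rewrite (_ : _ @^-1` _ = \bigcup_(x in [set: 'I_a])
       [set w | prefix letter (size u).+1 w = x :: u]).
      apply: fin_bigcup_measurable => [|x _]; first exact: finite_finset.
      by apply: measurable_prefix_eq; apply: measurable_letter.
    apply/seteqP; split => w /=.
      move=> wu; exists (letter 0 w) => //=; rewrite /prefix /=; congr (_ :: _).
      by rewrite -[RHS]wu /prefix (iotaDl 1 0) -map_comp.
    move=> [x _ /=]; rewrite /prefix /= => -[_ <-].
    by rewrite size_map size_iota (iotaDl 1 0) -map_comp.
  rewrite (Pr_partition mu (measurable_letter 0) ms).
  apply: eq_bigr => x _; congr Pr; apply/seteqP; split => w /=.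
    rewrite /prefix /= => -[<- wu]; split => //.
    by rewrite -[RHS]wu (iotaDl 1 0) -map_comp.
  move=> [wu wx]; rewrite /prefix /=; congr (_ :: _) => //.
  by rewrite -[RHS]wu /prefix (iotaDl 1 0) -map_comp.
- move=> u; rewrite /word_prob (Pr_partition mu (measurable_letter (size u)) (mp u)).
  apply: eq_bigr => x _; congr Pr; rewrite size_rcons.
  by apply/seteqP; split=> w /=; rewrite prefixS_eq.
Qed.

End Cylinders.
Section CanonicalMap.
Variables (R : realType) (a : nat) (ha : (2 <= a)%N) (d : R) (t : 'I_a -> R).
Hypothesis d01 : 0 < d < 1.

Local Notation phi := (@canonical_map R a ha (affine_ifs d t)).
Local Notation xn n w := (word_value d t (prefix (@letter a ha) n w)).

Lemma word_value_prefixE n (w : symbolic_space ha) :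
  foldr (fun k x => affine_ifs d t (w k) x) 0 (iota 0 n) = xn n w.
Proof. by rewrite /word_value /prefix foldr_map. Qed.

Lemma word_value_prefixS n (w : symbolic_space ha) :
  xn n.+1 w = xn n w + d ^+ n * t (w n).
Proof. by rewrite prefixS -cats1 word_value_cat size_prefix /= mulr0 add0r. Qed.

Lemma word_value_prefix_dist n m (w : symbolic_space ha) : (n <= m)%N ->
  `|xn m w - xn n w| <= d ^+ n * word_bound d t.
Proof.
case/andP: d01 => d0 d1 nm; have dn0 : 0 <= d ^+ n by rewrite exprn_ge0// ltW.
have -> : prefix (@letter a ha) m w =
    prefix (@letter a ha) n w ++ [seq letter i w | i <- iota n (m - n)].
  by rewrite /prefix -map_cat -iotaD subnKC.
rewrite word_value_cat size_prefix addrAC subrr add0r normrM (ger0_norm dn0).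
by rewrite ler_wpM2l// word_value_bound.
Qed.

Lemma canonical_map_cvg (w : symbolic_space ha) : xn n w @[n --> \oo] --> phi w.
Proof.
case/andP: d01 => d0 d1.
have -> : phi w = lim ((fun n => xn n w) @ \oo).
  rewrite /canonical_map; congr (lim (_ @ \oo)).
  by apply/funext => n; apply: word_value_prefixE.
pose b := word_bound d t; have b0 : 0 <= b by apply: word_bound_ge0.
(* Subtracting the truncation error bound makes the sequence monotone, since [|t x| <= b * (1 - d)];
   convergence then follows from boundedness. *)
pose y n := xn n w - d ^+ n * b.
have cvd : (fun n => d ^+ n * b) @ \oo --> (0 : R).
  rewrite -[X in _ --> X](mul0r b); apply: cvgM; last exact: cvg_cst.
  by apply: cvg_expr; rewrite gtr0_norm.
have step n := word_value_prefixS n w.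
have tb x : `|t x| <= b * (1 - d).
  rewrite /b /word_bound divfK ?subr_eq0 ?gt_eqF//.
  by rewrite (bigD1 x)//= lerDl sumr_ge0.
have ynd : nondecreasing_seq y.
  apply/nondecreasing_seqP => n; rewrite /y step exprS.
  have dn0 : 0 <= d ^+ n by rewrite exprn_ge0// ltW.
  have : - (b * (1 - d)) <= t (w n) by have := tb (w n); rewrite ler_norml => /andP[].
  move/(ler_wpM2l dn0); lra.
have ycv : cvgn y.
  apply: nondecreasing_is_cvgn => //; exists b => _ [n _ <-].
  rewrite /y; have := word_value_bound t d01 (prefix (@letter a ha) n w).
  rewrite -/b ler_norml => /andP[_ h].
  have : 0 <= d ^+ n * b by rewrite mulr_ge0// exprn_ge0// ltW.
  lra.
have -> : (fun n => xn n w) = (fun n => y n + d ^+ n * b).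
  by apply/funext => n; rewrite /y subrK.
apply: is_cvgD => //; apply: cvgP; exact: cvd.
Qed.

Lemma canonical_map_dist n (w : symbolic_space ha) :
  `|phi w - xn n w| <= d ^+ n * word_bound d t.
Proof.
have cv := @canonical_map_cvg w.
have bd m : (n <= m)%N -> xn n w - d ^+ n * word_bound d t <= xn m w <=
    xn n w + d ^+ n * word_bound d t.
  move=> /(word_value_prefix_dist w); rewrite ler_norml => /andP[h1 h2].
  by apply/andP; split; lra.
have <- : lim (xn n w @[n --> \oo]) = phi w by apply: cvg_lim.
have lo : xn n w - d ^+ n * word_bound d t <= lim (xn n w @[n --> \oo]).
  apply: limr_ge; first by apply: cvgP; exact: cv.
  by exists n => //= m /bd /andP[].
have hi : lim (xn n w @[n --> \oo]) <= xn n w + d ^+ n * word_bound d t.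
  apply: limr_le; first by apply: cvgP; exact: cv.
  by exists n => //= m /bd /andP[].
by rewrite ler_norml; apply/andP; split; lra.
Qed.

Lemma measurable_canonical_map : measurable_fun [set: symbolic_space ha] phi.
Proof.
apply: (measurable_fun_cvg (h := fun n w => xn n w)) => [n|w _].
  elim: n => [|n IH]; first exact: measurable_cst.
  under eq_fun do rewrite word_value_prefixS.
  apply: measurable_funD => //; apply: measurable_funM; first exact: measurable_cst.
  move=> _ Y mY; rewrite setTI.
  apply: (measurable_finite_preimage (h := letter n) (t @^-1` Y)).
  exact: measurable_letter.
exact: canonical_map_cvg.
Qed.

End CanonicalMap.
Section JointMeasure.
Variables (R : realType) (a b : nat) (ha : (2 <= a)%N) (hb : (2 <= b)%N).
Variables (mu : probability (symbolic_space ha) R)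
  (nu : probability (symbolic_space hb) R).

Definition joint : probability (symbolic_space ha * symbolic_space hb)%type R :=
  (mu \x nu)%E.

Local Notation Om := (symbolic_space ha * symbolic_space hb)%type.

Definition words2 n m (x : seq 'I_a) (y : seq 'I_b) : set Om :=
  [set w | prefix (@letter a ha) n w.1 = x /\ prefix (@letter b hb) m w.2 = y].

Lemma words2E n m x y : words2 n m x y =
  [set w | prefix (@letter a ha) n w = x] `*` [set w | prefix (@letter b hb) m w = y].
Proof. by []. Qed.

Lemma measurable_words2 n m x y : measurable (words2 n m x y).
Proof.
rewrite words2E; apply: measurableX; apply: measurable_prefix_eq;
  exact: measurable_letter.
Qed.

Lemma Pr_words2 x y : Pr joint (words2 (size x) (size y) x y) =
  word_prob mu x * word_prob nu y.
Proof.
rewrite words2E /Pr /joint /= product_measure1E//; last 2 first.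
- by apply: measurable_prefix_eq; apply: measurable_letter.
- by apply: measurable_prefix_eq; apply: measurable_letter.
by rewrite fineM// fin_num_measure//; apply: measurable_prefix_eq;
  apply: measurable_letter.
Qed.

Lemma Pr_joint_words2 n m (E : set Om) : measurable E ->
  Pr joint E = wsum2 n m (fun x y => Pr joint (E `&` words2 n m x y)).
Proof.
move=> mE.
have m1 i x : measurable [set w : Om | letter i w.1 = x].
  have := @measurable_fst _ _ (symbolic_space ha) (symbolic_space hb) measurableT
    _ (measurable_letter i x).
  by rewrite setTI.
have m2 i y : measurable [set w : Om | letter i w.2 = y].
  have := @measurable_snd _ _ (symbolic_space ha) (symbolic_space hb) measurableT
    _ (measurable_letter i y).
  by rewrite setTI.
rewrite (Pr_wsum joint m1 n mE); apply: eq_wsum => x sx.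
rewrite (Pr_wsum joint m2 m); last first.
  by apply: measurableI => //; apply: measurable_prefix_eq.
by apply: eq_wsum => y sy; congr Pr; rewrite -setIA.
Qed.

Lemma Pr_joint_le_expect n m (E : set Om) (F : seq 'I_a -> seq 'I_b -> bool) :
  measurable E ->
  (forall w, E w -> F (prefix (@letter a ha) n w.1) (prefix (@letter b hb) m w.2)) ->
  Pr joint E <= expect (word_prob mu) (word_prob nu) n m (fun x y => (F x y)%:R).
Proof.
move=> mE EF; rewrite (Pr_joint_words2 n m mE); apply: le_wsum2 => x y sx sy.
have mw := measurable_words2 n m x y.
case: (boolP (F x y)) => Fxy.
  rewrite mulr1 -Pr_words2 sx sy le_Pr//; exact: measurableI.
rewrite mulr0 (_ : _ `&` _ = set0) ?Pr_set0//.
apply/seteqP; split => w //= [Ew [wx wy]].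
by move: Fxy; rewrite -wx -wy EF.
Qed.

Variables (f : symbolic_space ha -> R) (h : symbolic_space hb -> R).
Hypotheses (mf : measurable_fun [set: symbolic_space ha] f)
  (mh : measurable_fun [set: symbolic_space hb] h).

Definition plane_point (w : Om) : R * R := (f w.1, h w.2).

Lemma measurable_plane_point : measurable_fun [set: Om] plane_point.
Proof.
by apply: measurable_fun_pair; apply: measurableT_comp.
Qed.

(** The product measure integrates measures of sections, so the maps are moved one at a time: [h]
    inside the sections, [f] by change of variables in the outer integral. *)
Lemma product_pushforwardE (E : set (R * R)) : measurable E ->
  (pushforward mu f \x pushforward nu h)%E E = joint (plane_point @^-1` E).
Proof.
move=> mE; rewrite /product_measure1.
have mg : measurable_fun [set: R * symbolic_space hb]
    (fun z : R * symbolic_space hb => (z.1, h z.2)).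
  apply: measurable_fun_pair; first exact: measurable_fst.
  by apply: measurableT_comp => //; exact: measurable_snd.
pose E' := (fun z : R * symbolic_space hb => (z.1, h z.2)) @^-1` E.
have mE' : measurable E' by rewrite -[X in measurable X]setTI; apply: mg.
have eqs x : pushforward nu h (xsection E x) = nu (xsection E' x).
  rewrite /pushforward; congr (nu _); apply/seteqP; split=> y /=;
  by rewrite /xsection /= !inE.
rewrite (eq_integral (fun x => nu (xsection E' x))); last by move=> x _; apply: eqs.
rewrite ge0_integral_pushforward//.
by apply: measurable_fun_xsection.
Qed.

End JointMeasure.
(** * Hausdorff measures and box covers *)

Section BoxCovers.
Variable R : realType.
Local Notation plane := (R * R)%type.
Local Notation edist := (@Defs.edist R).
Implicit Types (x y z : plane) (E : set plane) (r s : R).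

Definition box z r : set plane :=
  [set x | `|x.1 - z.1| <= r /\ `|x.2 - z.2| <= r].

Lemma edistxx x : edist x x = 0.
Proof. by rewrite /Defs.edist /inner subrr /= mul0r addr0 sqrtr0. Qed.

Lemma edistE x y :
  edist x y = Num.sqrt ((x.1 - y.1) ^+ 2 + (x.2 - y.2) ^+ 2).
Proof. by []. Qed.

Lemma coord_le_edist x y :
  `|x.1 - y.1| <= edist x y /\ `|x.2 - y.2| <= edist x y.
Proof.
by rewrite edistE -!sqrtr_sqr; split; apply: ler_wsqrtr;
  rewrite ?lerDl ?lerDr sqr_ge0.
Qed.

Lemma edist_le_coord x y r : `|x.1 - y.1| <= r -> `|x.2 - y.2| <= r ->
  edist x y <= 2 * r.
Proof.
move=> h1 h2; have r0 : 0 <= r by apply: le_trans h1.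
rewrite edistE -[leRHS](ger0_norm (mulr_ge0 _ r0))// -sqrtr_sqr.
apply: ler_wsqrtr.
have : (x.1 - y.1) ^+ 2 <= r ^+ 2 by rewrite -[leLHS]real_normK ?num_real// lerXn2r ?nnegrE.
have : (x.2 - y.2) ^+ 2 <= r ^+ 2 by rewrite -[leLHS]real_normK ?num_real// lerXn2r ?nnegrE.
by rewrite exprMn; have := sqr_ge0 r; lra.
Qed.

Lemma diameter_ge0 (U : set plane) x : U x -> (0 <= diameter U)%E.
Proof.
by move=> Ux; apply: ereal_sup_ubound; exists (x, x) => //=; rewrite edistxx.
Qed.

Lemma diameter_box z r : (diameter (box z r) <= (4 * r)%:E)%E.
Proof.
apply: ge_ereal_sup => _ [[x y] /= [[x1 x2] [y1 y2]] <-].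
have h (u v w : R) : `|u - w| <= r -> `|v - w| <= r -> `|u - v| <= 2 * r.
  move=> h1 h2; rewrite (_ : u - v = (u - w) - (v - w)); last by ring.
  by apply: (le_trans (ler_normB _ _)); lra.
rewrite lee_fin (_ : 4 * r = 2 * (2 * r)); last by ring.
by apply: edist_le_coord; apply: h; eassumption.
Qed.

Lemma diameter_power_ge0 s (U : set plane) : (0 <= diameter_power s U)%E.
Proof. by rewrite /diameter_power; case: ifP => // _; apply: poweR_ge0. Qed.

Lemma diameter_power_box s z r : 0 <= s ->
  (diameter_power s (box z r) <= ((4 * r) `^ s)%:E)%E.
Proof.
move=> s0; rewrite /diameter_power; case: asboolP => [_|/eqP/set0P[x bx]].
  by rewrite lee_fin powR_ge0.
rewrite -poweR_EFin; apply: (gt0_ler_poweR s0).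
- by rewrite in_itv /= (diameter_ge0 bx) leey.
- rewrite in_itv /= leey andbT lee_fin mulr_ge0//.
  by case: bx => h _; apply: le_trans h.
- exact: diameter_box.
Qed.

Lemma hausdorff_premeasure_ge0 s e E : (0 <= hausdorff_premeasure s e E)%E.
Proof.
apply: le_ereal_inf_tmp => _ [U _ <-].
by apply: nneseries_ge0 => n _ _; apply: diameter_power_ge0.
Qed.

Lemma hausdorff_measure_eq0 s E :
  (forall e eps : R, 0 < e -> 0 < eps ->
     (hausdorff_premeasure s e E <= eps%:E)%E) ->
  hausdorff_measure s E = 0%E.
Proof.
move=> H; apply/eqP; rewrite eq_le; apply/andP; split.
  apply: ge_ereal_sup => _ [e e0 <-]; apply/lee_addgt0Pr => eps eps0.
  by rewrite add0e H.
apply: le_trans (hausdorff_premeasure_ge0 s 1 E) _.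
by apply: ereal_sup_ubound; exists 1 => //=; exact: ltr01.
Qed.

Lemma hausdorff_measure0_premeasure s e E : 0 < e ->
  hausdorff_measure s E = 0%E -> hausdorff_premeasure s e E = 0%E.
Proof.
move=> e0 H; apply/eqP; rewrite eq_le hausdorff_premeasure_ge0 andbT -H.
by apply: ereal_sup_ubound; exists e.
Qed.

(** Each covering set lies in the box about one of its points with its diameter as radius. Since
    diameters may vanish, [w n] is added, with summable [s]-th powers, to make every radius
    positive. *)
Lemma hausdorff_measure0_boxes s E : 0 < s ->
  hausdorff_measure s E = 0%E -> forall eps : R, 0 < eps ->
  exists (z : nat -> plane) (r : nat -> R),
  [/\ forall n, 0 < r n <= eps, E `<=` \bigcup_n box (z n) (r n) &
      forall N, \sum_(n < N) r n `^ s <= eps].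
Proof.
move=> s0 H eps eps0; have e2 : 0 < eps / 2 by lra.
(* 2^s is the loss in bounding the power of [D n + w n], and the other 2 accounts for two sums of
   size at most [c]. *)
pose c := eps / (2 * 2 `^ s); have p2 : 0 < 2 `^ s :> R by rewrite powR_gt0.
have c0 : 0 < c by rewrite divr_gt0// mulr_gt0.
have := hausdorff_measure0_premeasure e2 H.
have cE : (0 < c%:E)%E by rewrite lte_fin.
move=> H0; have : (hausdorff_premeasure s (eps / 2) E < c%:E)%E by rewrite H0.
move=> /ereal_inf_lt[_ [U [EU dU] <-] sumU].
(* An empty [U n] has diameter -oo, which [fine] sends to 0. *)
pose D n := fine (diameter (U n)).
have pick n : exists zn : plane, forall x, U n x -> `|x.1 - zn.1| <= D n /\ `|x.2 - zn.2| <= D n.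
  have [[y Uy]|no] := pselect (exists y, U n y); last first.
    by exists 0 => x Ux; case: no; exists x.
  exists y => x Ux.
  have h : ((edist x y)%:E <= diameter (U n))%E.
    by apply: ereal_sup_ubound; exists (x, y).
  have fin : diameter (U n) \is a fin_num.
    rewrite ge0_fin_numE ?(diameter_ge0 Uy)//.
    by apply: le_lt_trans (dU n) _; rewrite ltry.
  have hD : edist x y <= D n by rewrite -lee_fin /D fineK.
  by have [h1 h2] := coord_le_edist x y; split; [apply: le_trans h1 hD|apply: le_trans h2 hD].
have [z zP] := choice pick.
have D0 n : 0 <= D n.
  rewrite /D; have [[y Uy]|no] := pselect (exists y, U n y).
    by rewrite fine_ge0// (diameter_ge0 Uy).
  have -> : U n = set0 by apply/seteqP; split => x // Ux; case: no; exists x.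
  rewrite /diameter (_ : [set _ | _ in _] = set0) ?ereal_sup0//.
  by apply/seteqP; split => x // [[u v]] [].
have Deps n : D n <= eps / 2.
  rewrite -lee_fin /D; have [[y Uy]|no] := pselect (exists y, U n y).
    rewrite fineK ?dU//; rewrite ge0_fin_numE ?(diameter_ge0 Uy)//.
    by apply: le_lt_trans (dU n) _; rewrite ltry.
  have -> : U n = set0 by apply/seteqP; split => x // Ux; case: no; exists x.
  rewrite /diameter (_ : [set _ | _ in _] = set0) ?ereal_sup0/= ?lee_fin ?ltW//.
  by apply/seteqP; split => x // [[u v]] [].
have DU n : ((D n `^ s)%:E <= diameter_power s (U n))%E.
  rewrite /diameter_power; case: asboolP => [U0|/eqP/set0P[y Uy]].
    have -> : D n = 0; last by rewrite powR0// gt_eqF.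
    rewrite /D U0 /diameter (_ : [set _ | _ in _] = set0) ?ereal_sup0//.
    by apply/seteqP; split => x // [[u v]] [].
  rewrite -poweR_EFin /D fineK// ge0_fin_numE ?(diameter_ge0 Uy)//.
  by apply: le_lt_trans (dU n) _; rewrite ltry.
pose w n := Num.min (eps / 2) ((c / 2 ^+ n.+1) `^ s^-1).
have cn0 n : 0 < c / 2 ^+ n.+1 by rewrite divr_gt0// exprn_gt0.
have w0 n : 0 < w n by rewrite lt_min e2 powR_gt0.
have wc n : w n `^ s <= c / 2 ^+ n.+1.
  apply: (@le_trans _ _ (((c / 2 ^+ n.+1) `^ s^-1) `^ s)).
    apply: (ge0_ler_powR (ltW s0)); rewrite ?nnegrE ?powR_ge0 ?(ltW (w0 n))//.
    by rewrite ge_min lexx orbT.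
  by rewrite -powRrM mulVf ?gt_eqF// powRr1// ltW.
exists z, (fun n => D n + w n); split.
- move=> n; rewrite ltr_wpDl//= (splitr eps) lerD//.
  by rewrite ge_min lexx.
- move=> x /EU[n _ Ux]; exists n => //; have [h1 h2] := zP n x Ux.
  by split; [apply: le_trans h1 _|apply: le_trans h2 _]; rewrite lerDl ltW.
move=> N.
have powD n : (D n + w n) `^ s <= 2 `^ s * (D n `^ s + c / 2 ^+ n.+1).
  apply: (@le_trans _ _ ((2 * Num.max (D n) (w n)) `^ s)).
    apply: (ge0_ler_powR (ltW s0)); rewrite ?nnegrE ?addr_ge0
      ?mulr_ge0 ?le_max ?D0 ?(ltW (w0 n))//.
    rewrite mulr_natl mulr2n lerD// le_max lexx ?orbT//.
  rewrite powRM ?le_max ?D0// ler_wpM2l ?powR_ge0//.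
  have [h|h] := leP (D n) (w n).
    by apply: (le_trans (wc n)); rewrite lerDr powR_ge0.
  by rewrite lerDl ltW.
apply: (@le_trans _ _ (\sum_(n < N) 2 `^ s * (D n `^ s + c / 2 ^+ n.+1))).
  by apply: ler_sum => n _; apply: powD.
rewrite -mulr_sumr big_split /=.
have h1 : \sum_(n < N) D n `^ s <= c.
  rewrite -lee_fin -sumEFin; apply: le_trans (ltW sumU).
  apply: (@le_trans _ _ (\sum_(0 <= n < N) diameter_power s (U n))%E).
    rewrite big_mkord; apply: lee_sum => n _; exact: DU.
  by apply: nneseries_lim_ge => n _ _; apply: diameter_power_ge0.
have h2 : \sum_(n < N) c / 2 ^+ n.+1 <= c.
  have -> : \sum_(n < N) c / 2 ^+ n.+1 = c - c / 2 ^+ N.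
    elim: N {h1} => [|N IH]; first by rewrite big_ord0 expr0 divr1 subrr.
    rewrite big_ord_recr /= IH exprS; field; by rewrite expf_neq0.
  by rewrite gerBl divr_ge0 ?exprn_ge0// ltW.
apply: (@le_trans _ _ (2 `^ s * (c + c))).
  by rewrite ler_wpM2l ?powR_ge0// lerD.
rewrite /c le_eqVlt; apply/orP; left; apply/eqP; field.
by rewrite gt_eqF.
Qed.


Lemma hausdorff_measure0_of_lists s E : 0 < s ->
  (forall eps : R, 0 < eps -> exists L : nat -> seq (plane * R),
     [/\ forall i b, b \in L i -> 0 <= b.2 <= eps,
         forall x, E x -> exists i, exists2 b, b \in L i & box b.1 b.2 x &
         forall N, \sum_(i < N) \sum_(b <- L i) b.2 `^ s <= eps]) ->
  hausdorff_measure s E = 0%E.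
Proof.
move=> s0 H; apply: hausdorff_measure_eq0 => e eps e0 eps0.
have p4 : 0 < 4 `^ s :> R by rewrite powR_gt0.
(* Both 4's come from [diameter_box]: one for the power sums, one for the diameters. *)
have k0 : 0 < Num.min (eps / 4 `^ s) (e / 4) by rewrite lt_min !divr_gt0.
have [L [Lr EL Ls]] := H _ k0.
pose d : plane * R := (0, 0).
(* The dummy box makes every list nonempty, so that [S k] has at least [k]
   entries. *)
pose S k := flatten [seq d :: L i | i <- iota 0 k].
have SS k m : (k <= m)%N -> exists tl, S m = S k ++ tl.
  move=> km; exists (flatten [seq d :: L i | i <- iota k (m - k)]).
  by rewrite /S -flatten_cat -map_cat -iotaD subnKC.
have S1 k : S k.+1 = S k ++ d :: L k.
  by rewrite /S -addn1 iotaD map_cat flatten_cat /= cats0.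
have sS k : (k <= size (S k))%N.
  by elim: k => // k IH; rewrite S1 size_cat /=; lia.
have Sr k b : b \in S k -> 0 <= b.2 <= Num.min (eps / 4 `^ s) (e / 4).
  elim: k => // k IH; rewrite S1 mem_cat inE => /orP[/IH //|/predU1P[->|/Lr//]].
  by rewrite /= lexx ltW.
have Ssum k : \sum_(b <- S k) b.2 `^ s = \sum_(i < k) \sum_(b <- L i) b.2 `^ s.
  elim: k => [|k IH]; first by rewrite big_nil big_ord0.
  by rewrite S1 big_cat big_cons big_ord_recr /= IH powR0 ?gt_eqF// add0r.
pose U k := box (nth d (S k.+1) k).1 (nth d (S k.+1) k).2.
have Uin k : nth d (S k.+1) k \in S k.+1 by rewrite mem_nth// (leq_trans _ (sS _)).
apply: (@le_trans _ _ (\sum_(n <oo) diameter_power s (U n))%E).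
  apply: ereal_inf_lbound; exists U => //; split.
    move=> x /EL[i [b bL bx]].
    have bS : b \in S i.+1 by rewrite S1 mem_cat inE bL !orbT.
    have := nth_index d bS; move: (bS); rewrite -index_mem.
    move: (index b _) => j ji jb; exists j => //; rewrite /U.
    suff -> : nth d (S j.+1) j = nth d (S i.+1) j.
      by rewrite jb.
    have [h|h] := leqP j.+1 i.+1.
      by have [tl ->] := SS _ _ h; rewrite nth_cat sS.
    by have [tl ->] := SS _ _ (ltnW h); rewrite nth_cat ji.
  move=> n; apply: le_trans (diameter_box _ _) _; rewrite lee_fin.
  by have := Sr _ _ (Uin n); rewrite le_min => /and3P[_ _ h]; lra.
apply: lime_le; first by apply: is_cvg_nneseries => n _ _; apply: diameter_power_ge0.
near=> N.
have -> : eps%:E = (4 `^ s * (eps / 4 `^ s))%:E by congr EFin; field; rewrite gt_eqF.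
apply: (@le_trans _ _ (\sum_(0 <= n < N) ((4 `^ s * (nth d (S N) n).2 `^ s)%:E))%E).
  rewrite big_nat [leRHS]big_nat; apply: lee_sum => n /andP[_ nN].
  have -> : nth d (S N) n = nth d (S n.+1) n.
    by have [tl ->] := SS _ _ nN; rewrite nth_cat sS.
  rewrite -powRM//; last by have /andP[] := Sr _ _ (Uin n).
  by apply: diameter_power_box; apply: ltW.
rewrite sumEFin lee_fin -mulr_sumr ler_wpM2l ?powR_ge0//.
apply: (@le_trans _ _ (\sum_(b <- S N) b.2 `^ s)); last first.
  by rewrite Ssum; apply: (le_trans (Ls N)); rewrite ge_min lexx.
rewrite -(cat_take_drop N (S N)) big_cat /= -[leLHS]addr0 lerD//; last first.
  by apply: sumr_ge0 => b _; apply: powR_ge0.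
rewrite (big_nth d) size_take_min (minn_idPl (sS N)) le_eqVlt; apply/orP; left.
apply/eqP; rewrite big_nat [RHS]big_nat; apply: eq_bigr => n /andP[_ nN].
by rewrite nth_take// cat_take_drop.
Unshelve. all: by end_near. Qed.

Lemma measurable_rectangle (i j : interval R) :
  measurable [set x : plane | x.1 \in i /\ x.2 \in j].
Proof. by apply: (@measurableX _ _ R R [set` i] [set` j]). Qed.

Lemma measurable_box z r : measurable (box z r).
Proof.
rewrite (_ : box z r = [set x | x.1 \in `[z.1 - r, z.1 + r] /\ x.2 \in `[z.2 - r, z.2 + r]]).
  exact: measurable_rectangle.
by apply/seteqP; split => x /=; rewrite /box /= !in_itv /= !ler_distl.
Qed.

End BoxCovers.
(** * The Frostman condition from the lower dimension *)

Section UnionBounds.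
Context (dsp : measure_display) (T : measurableType dsp) (R : realType).
Variables (P : probability T R) (I : eqType) (A : I -> set T).
Hypothesis mA : forall i, measurable (A i).

Definition some_of (s : seq I) : set T := [set w | exists2 i, i \in s & A i w].

Lemma some_of_cons i s : some_of (i :: s) = A i `|` some_of s.
Proof.
apply/seteqP; split => [w [j]|w [Aw|[j js Aw]]] /=.
- by rewrite inE => /predU1P[->|js] Aw; [left|right; exists j].
- by exists i; rewrite ?mem_head.
- by exists j; rewrite // inE js orbT.
Qed.

Lemma some_of_nil : some_of [::] = set0.
Proof. by apply/seteqP; split => w // [i]. Qed.

Lemma measurable_some_of s : measurable (some_of s).
Proof.
elim: s => [|i s IH]; first by rewrite some_of_nil.
by rewrite some_of_cons; apply: measurableU.
Qed.

Lemma Pr_some_of_le s : Pr P (some_of s) <= \sum_(i <- s) Pr P (A i).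
Proof.
elim: s => [|i s IH]; first by rewrite some_of_nil Pr_set0 big_nil.
rewrite some_of_cons big_cons; apply: (le_trans (PrU_le _ _ _)) => //.
  exact: measurable_some_of.
by rewrite lerD2l.
Qed.

Lemma Pr_some_of s : (forall i j w, A i w -> A j w -> i = j) -> uniq s ->
  Pr P (some_of s) = \sum_(i <- s) Pr P (A i).
Proof.
move=> dis; elim: s => [|i s IH]; first by rewrite some_of_nil Pr_set0 big_nil.
move=> /= /andP[si us]; rewrite some_of_cons big_cons PrU ?IH//.
  exact: measurable_some_of.
apply/seteqP; split => w // [Aw [j js]] /(dis _ _ _ Aw) E.
by move: si; rewrite E js.
Qed.

End UnionBounds.

Section DyadicCells.
Variables (R : realType) (B : R).
Local Notation plane := (R * R)%type.

(** Half-open, so that the cells of one level are disjoint; the shift by [B] makes natural indices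
    sufficient for coordinates at least [- B]. *)
Definition dyadic k i : interval R :=
  `[k%:R / 2 ^+ i - B, k.+1%:R / 2 ^+ i - B[.

Definition dcoord i (v : R) : nat := Num.truncn (2 ^+ i * (v + B)).

Lemma mem_dyadic k i v : - B <= v -> (v \in dyadic k i) = (dcoord i v == k).
Proof.
move=> Bv; have p2 : 0 < 2 ^+ i :> R by rewrite exprn_gt0.
rewrite truncn_eq ?mulr_ge0 ?(ltW p2)//; last by lra.
by rewrite in_itv /= lerBlDr ltrBrDr ler_pdivrMr// ltr_pdivlMr// (mulrC (2 ^+ i)).
Qed.

Lemma dyadic_dist k i v : v \in dyadic k i ->
  `|v - (k%:R / 2 ^+ i - B)| <= (2 ^+ i)^-1.
Proof.
rewrite in_itv /= -(natr1 k) mulrDl mul1r => /andP[h1 h2].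
by rewrite ger0_norm ?subr_ge0//; lra.
Qed.

Definition cell i (c : nat * nat) : set plane :=
  [set x | x.1 \in dyadic c.1 i /\ x.2 \in dyadic c.2 i].

Lemma measurable_cell i c : measurable (cell i c).
Proof. exact: measurable_rectangle. Qed.

Lemma cell_sub_box i c : cell i c `<=`
  box (c.1%:R / 2 ^+ i - B, c.2%:R / 2 ^+ i - B) (2 ^+ i)^-1.
Proof. by move=> x [h1 h2]; split; apply: dyadic_dist. Qed.

Lemma dcoord_near i v z rad : - B <= v -> `|v - z| <= rad ->
  2 ^+ i * rad <= 1 ->
  dcoord i v \in iota (Num.truncn (2 ^+ i * (z + B) - 1)) 3.
Proof.
move=> Bv; rewrite ler_distl => /andP[h1 h2] h3; rewrite mem_iota.
have p2 : 0 < 2 ^+ i :> R by rewrite exprn_gt0.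
have e1 : 2 ^+ i * (v + B) <= 2 ^+ i * (z + B) + 1.
  apply: (@le_trans _ _ (2 ^+ i * (z + rad + B))); first by rewrite ler_pM2l// lerD2r.
  by rewrite (_ : z + rad + B = z + B + rad) ?mulrDr ?lerD2l//; lra.
have e2 : 2 ^+ i * (z + B) - 1 <= 2 ^+ i * (v + B).
  apply: (@le_trans _ _ (2 ^+ i * (z - rad + B))); last by rewrite ler_pM2l// lerD2r.
  by rewrite (_ : z - rad + B = z + B - rad) ?mulrBr ?lerD2l ?lerN2//; lra.
rewrite /dcoord le_truncn//=.
have := truncnS_gt (2 ^+ i * (z + B) - 1); move: (Num.truncn (_ - 1)) => j hj.
rewrite addn3 ltnS truncn_le_nat -(natr1 j.+2) -(natr1 j.+1); rewrite -(natr1 j) in hj *; lra.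
Qed.

End DyadicCells.
Lemma Pr_bigcap_small (dsp : measure_display) (T : measurableType dsp)
    (R : realType) (P : probability T R) (F : nat -> set T) (eta : R) :
  (forall n, measurable (F n)) -> (forall n m, (n <= m)%N -> F m `<=` F n) ->
  Pr P (\bigcap_n F n) = 0 -> 0 < eta -> exists n, Pr P (F n) <= eta.
Proof.
move=> mF dF F0 eta0.
have mI : measurable (\bigcap_n F n) by apply: bigcapT_measurable.
have cv : (P \o F) x @[x --> \oo] --> P (\bigcap_n F n).
  apply: nonincreasing_cvg_mu => //.
    by apply: le_lt_trans (probability_le1 P (mF 0%N)) _; rewrite ltry.
  by move=> n m nm; rewrite subsetEset; apply: dF.
have cv0 : (P \o F) x @[x --> \oo] --> 0%E by rewrite -[0%E]/(0%:E) -F0 -(PrE P mI).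
have /cvgrPdist_le/(_ _ eta0)[n _ Hn] : Pr P (F x) @[x --> \oo] --> 0.
  by apply: fine_cvg.
exists n; have := Hn n (leqnn n); rewrite sub0r normrN ger0_norm//.
exact: Pr_ge0.
Qed.

Lemma size_mul_le_sum (R : realType) (I : eqType) (s : seq I) (f : I -> R) a :
  (forall i, i \in s -> a <= f i) -> (size s)%:R * a <= \sum_(i <- s) f i.
Proof.
elim: s => [|i s IH] H; first by rewrite mul0r big_nil.
rewrite big_cons /= -nat1r mulrDl mul1r lerD ?H ?mem_head//.
by apply: IH => j js; rewrite H// inE js orbT.
Qed.

Lemma powR2_itv (R : realType) (x : R) : x < 0 -> 0 < (2 `^ x : R) < 1.
Proof.
move=> x0; rewrite powR_gt0//= /powR pnatr_eq0 /= expR_lt1.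
by rewrite pmulr_llt0// ln_gt0// ltr1n.
Qed.

Section DyadicFrostman.
Context (dsp : measure_display) (T : measurableType dsp) (R : realType).
Variables (P : probability T R) (V : T -> R * R) (B s1 sg : R).
Hypothesis mV : measurable_fun [set: T] V.
Hypothesis boundV : forall w,
  (- B <= (V w).1 <= B) /\ (- B <= (V w).2 <= B).
Hypothesis s1_gt0 : 0 < s1.
Hypothesis s1_lt_sg : s1 < sg.
Hypothesis null : forall E, measurable E ->
  hausdorff_measure sg E = 0%E -> Pr P (V @^-1` E) = 0.

Local Notation y := (2 `^ (- s1) : R).
Local Notation kap := (2 `^ (s1 - sg) : R).

Lemma measurable_preimage E : measurable E -> measurable (V @^-1` E).
Proof. by move=> mE; rewrite -(setTI (_ @^-1` _)); apply: mV. Qed.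

Let kap01 : 0 < kap < 1. Proof. by rewrite powR2_itv// subr_lt0. Qed.

Definition vcell i c := V @^-1` cell B i c.

Lemma measurable_vcell i c : measurable (vcell i c).
Proof. by apply: measurable_preimage; apply: measurable_cell. Qed.

Lemma vcellP i c w : vcell i c w <->
  c = (dcoord B i (V w).1, dcoord B i (V w).2).
Proof.
have [/andP[b1 _] /andP[b2 _]] := boundV w.
rewrite /vcell /cell /= !mem_dyadic//; case: c => k l /=.
by split=> [[/eqP -> /eqP ->]|[-> ->]].
Qed.

Definition heavy i : seq (nat * nat) :=
  [seq c <- [seq (k, l) | k <- iota 0 (dcoord B i B).+1,
                          l <- iota 0 (dcoord B i B).+1] |
    y ^+ i < Pr P (vcell i c)].

Lemma size_heavy i : (size (heavy i))%:R * y ^+ i <= 1.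
Proof.
have u : uniq (heavy i).
  by rewrite filter_uniq// allpairs_uniq ?iota_uniq// => -[? ?] [? ?] _ _ [-> ->].
have dis (c c' : nat * nat) w : vcell i c w -> vcell i c' w -> c = c'.
  by move=> /vcellP -> /vcellP ->.
apply: (@le_trans _ _ (\sum_(c <- heavy i) Pr P (vcell i c))); last first.
  rewrite -(Pr_some_of P (@measurable_vcell i) dis u) Pr_le1//.
  by apply: measurable_some_of; apply: measurable_vcell.
apply: size_mul_le_sum => c; rewrite mem_filter => /andP[h _]; exact: ltW.
Qed.

Lemma mem_heavy i c w : vcell i c w -> (c \in heavy i) = (y ^+ i < Pr P (vcell i c)).
Proof.
move=> /vcellP ->; rewrite mem_filter andbC allpairs_f//.
all: rewrite mem_iota add0n ltnS /dcoord le_truncn// ler_pM2l ?exprn_gt0// lerD2r.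
all: by have [/andP[_ b1] /andP[_ b2]] := boundV w.
Qed.

Definition heavy_set i : set (R * R) := some_of (cell B i) (heavy i).

Lemma measurable_heavy_set i : measurable (heavy_set i).
Proof. by apply: measurable_some_of; apply: measurable_cell. Qed.

Definition heavy_tail i0 := \bigcup_(i in [set i | (i0 <= i)%N]) heavy_set i.

Lemma measurable_heavy_tail i0 : measurable (heavy_tail i0).
Proof. by apply: bigcup_measurable => i _; apply: measurable_heavy_set. Qed.

Let inv_exp2_powR n : ((2 ^+ n)^-1 : R) `^ sg = (y * kap) ^+ n.
Proof.
rewrite -powRD ?pnatr_eq0 ?implybT// addrA addNr add0r.
rewrite -powR_mulrn ?powR_ge0// -powRrM -powR_invn//.
by rewrite -powRrM; congr powR; ring.
Qed.

Let geometric_tail i0 N :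
  \sum_(j < N) kap ^+ (i0 + j) <= kap ^+ i0 / (1 - kap).
Proof.
have /andP[k0 k1] := kap01; move: k0 k1; move: (kap) => k k0 k1.
have k2 : 0 < 1 - k by lra.
have -> : \sum_(j < N) k ^+ (i0 + j) = (k ^+ i0 - k ^+ (i0 + N)) / (1 - k).
  elim: N => [|N IH]; first by rewrite big_ord0 addn0 subrr mul0r.
  by rewrite big_ord_recr /= IH addnS exprS; field; rewrite gt_eqF.
by rewrite ler_pM2r ?invr_gt0// gerBl exprn_ge0// ltW.
Qed.

(** Level [i] has at most y^(-i) heavy cells, being disjoint and of mass above [y ^+ i], and each
    costs [(y * kap) ^+ i]. The tails are those of a geometric series in [kap < 1], which is where
    [s1 < sg] is spent. *)
Lemma hausdorff_measure_heavy_limsup :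
  hausdorff_measure sg (\bigcap_i0 heavy_tail i0) = 0%E.
Proof.
have /andP[k0 k1] := kap01.
apply: hausdorff_measure0_of_lists => [|eps eps0]; first exact: lt_trans s1_lt_sg.
have e1 : 0 < eps * (1 - kap) by rewrite mulr_gt0// subr_gt0.
have [n1 H1] := linear_geometric_small (lexx 0) kap01 e1.
have h01 : 0 < (2^-1 : R) < 1 by apply/andP; split; lra.
have [n2 H2] := linear_geometric_small (lexx 0) h01 eps0.
pose i0 := maxn n1 n2.
have {}H1 := H1 i0 (leq_maxl _ _);
  have {}H2 n (h : (i0 <= n)%N) := H2 n (leq_trans (leq_maxr _ _) h).
rewrite mul0r add0r mul1r in H1.
pose corner i (c : nat * nat) : R * R := (c.1%:R / 2 ^+ i - B, c.2%:R / 2 ^+ i - B).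
exists (fun j => [seq (corner (i0 + j)%N c, (2 ^+ (i0 + j))^-1) | c <- heavy (i0 + j)]).
split.
- move=> j b /mapP[c _ ->] /=; rewrite invr_ge0 exprn_ge0//=.
  by have := H2 (i0 + j)%N (leq_addr _ _); rewrite mul0r add0r mul1r exprVn.
- move=> x /(_ i0 I)[i /= ii [c ch cx]]; exists (i - i0)%N.
  exists (corner i c, (2 ^+ i)^-1); last exact: cell_sub_box.
  by apply/mapP; exists c; rewrite subnKC.
move=> N; apply: (@le_trans _ _ (\sum_(j < N) kap ^+ (i0 + j))).
  apply: ler_sum => j _; rewrite big_map /= big_const_seq count_predT iter_addr_0.
  rewrite inv_exp2_powR exprMn -[leLHS]mulr_natl mulrA ler_piMl ?exprn_ge0 ?powR_ge0//.
  exact: size_heavy.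
apply: (le_trans (geometric_tail _ _)).
by rewrite ler_pdivrMr ?subr_gt0.
Qed.

Lemma exists_light_set (eta : R) : 0 < eta -> exists i0,
  Pr P (V @^-1` heavy_tail i0) <= eta.
Proof.
apply: Pr_bigcap_small => [n|n m nm w [i /= mi hi]|].
- by apply: measurable_preimage; apply: measurable_heavy_tail.
- by exists i => //=; apply: leq_trans mi.
rewrite -preimage_bigcap null ?hausdorff_measure_heavy_limsup//.
by apply: bigcapT_measurable => i; apply: measurable_heavy_tail.
Qed.


Definition light_set i0 := ~` (V @^-1` heavy_tail i0).

Lemma measurable_light_set i0 : measurable (light_set i0).
Proof.
apply: measurableC; apply: measurable_preimage; exact: measurable_heavy_tail.
Qed.

Let Pr_light_cell i0 i c : (i0 <= i)%N ->
  Pr P (light_set i0 `&` vcell i c) <= y ^+ i.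
Proof.
move=> ii; have ml := measurable_light_set i0; have mc := @measurable_vcell i c.
have [h|h] := leP (Pr P (vcell i c)) (y ^+ i).
  by apply: le_trans h; apply: le_Pr => //; exact: measurableI.
rewrite (_ : _ `&` _ = set0) ?Pr_set0 ?exprn_ge0 ?powR_ge0//.
apply/seteqP; split => // w [lw cw]; apply: lw; exists i => //.
by exists c => //; rewrite (mem_heavy cw).
Qed.

Let scale_exists (i0 : nat) (rad : R) : 0 < rad -> rad <= (2 ^+ i0)^-1 ->
  exists2 i, (i0 <= i)%N & (2 ^+ i.+1)^-1 < rad <= (2 ^+ i)^-1.
Proof.
move=> r0 ri0.
have ex : exists i, (2 ^+ (i0 + i).+1)^-1 < rad.
  have h01 : 0 < (2^-1 : R) < 1 by apply/andP; split; lra.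
  have r2 : 0 < rad / 2 by lra.
  have [n Hn] := linear_geometric_small (lexx 0) h01 r2.
  exists n; have := Hn (i0 + n).+1 (leqW (leq_addl _ _)).
  by rewrite mul0r add0r mul1r exprVn; lra.
exists (i0 + ex_minn ex)%N; first exact: leq_addr.
case: ex_minnP => -[|m] hm mm; rewrite hm /= ?addn0// addnS.
by rewrite leNgt; apply/negP => /mm; rewrite ltnn.
Qed.

(** At the dyadic scale of [rad] a box meets at most 3 by 3 cells, each of light mass at most
    [y ^+ i]. The second constant makes the bound exceed 1 for radii above the scale [i0]. *)
Lemma Pr_light_box_le i0 z rad : 0 < rad ->
  Pr P (light_set i0 `&` V @^-1` box z rad) <=
    (9 * 2 `^ s1 + (2 ^+ i0) `^ s1) * rad `^ s1.
Proof.
move=> r0; have ml := measurable_light_set i0.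
have mb : measurable (V @^-1` box z rad).
  by apply: measurable_preimage; apply: measurable_box.
have rs : 0 <= rad `^ s1 by apply: powR_ge0.
have [h|h] := leP rad (2 ^+ i0)^-1; last first.
  apply: (@le_trans _ _ 1); first by apply: Pr_le1; apply: measurableI.
  rewrite mulrDl -[leLHS]add0r lerD ?mulr_ge0 ?powR_ge0//.
  rewrite -powRM ?exprn_ge0 ?(ltW r0)//.
  apply: (@le_trans _ _ (1 `^ s1)); first by rewrite powR1.
  apply: (ge0_ler_powR (ltW s1_gt0)); rewrite ?nnegrE ?mulr_ge0 ?exprn_ge0 ?(ltW r0)//.
  by rewrite -ler_pdivrMl ?exprn_gt0// mulr1 ltW.
have [i ii /andP[ri1 ri]] := scale_exists r0 h.
pose c := [seq (k, l) | k <- iota (Num.truncn (2 ^+ i * (z.1 + B) - 1)) 3,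
                        l <- iota (Num.truncn (2 ^+ i * (z.2 + B) - 1)) 3].
have r1 : 2 ^+ i * rad <= 1 by rewrite -ler_pdivlMl ?exprn_gt0// mulr1.
pose A c := light_set i0 `&` vcell i c.
have mA j : measurable (A j) by apply: measurableI => //; apply: measurable_vcell.
apply: (@le_trans _ _ (Pr P (some_of A c))).
  apply: le_Pr; [exact: measurableI|exact: measurable_some_of|].
  move=> w [lw [b1 b2]]; have [/andP[B1 _] /andP[B2 _]] := boundV w.
  exists (dcoord B i (V w).1, dcoord B i (V w).2).
    by apply: allpairs_f; apply: (dcoord_near (rad := rad)).
  by split => //; apply/vcellP.
apply: (le_trans (Pr_some_of_le _ mA _)).
apply: (@le_trans _ _ (9 * y ^+ i)).
  have -> : 9 * y ^+ i = \sum_(j <- c) y ^+ i.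
    by rewrite big_const_seq count_predT iter_addr_0 size_allpairs !size_iota mulr_natl.
  by apply: ler_sum => j _; apply: Pr_light_cell.
rewrite [leRHS]mulrDl -[leLHS]addr0 lerD ?mulr_ge0 ?powR_ge0// -mulrA ler_wpM2l//.
have -> : y ^+ i = ((2 ^+ i)^-1) `^ s1.
  by rewrite -powR_mulrn ?powR_ge0// -powRrM -powR_invn// -powRrM; congr powR; ring.
rewrite -powRM ?(ltW r0)//.
apply: (ge0_ler_powR (ltW s1_gt0)); rewrite ?nnegrE ?mulr_ge0 ?invr_ge0 ?exprn_ge0 ?(ltW r0)//.
by move: ri1; rewrite exprS invfM mulrC; lra.
Qed.

End DyadicFrostman.

(** * Frostman weights on words from null sets on the plane *)

Section FrostmanFromDimension.
Variables (R : realType) (a b : nat) (ha : (2 <= a)%N) (hb : (2 <= b)%N).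
Variables (mu : probability (symbolic_space ha) R)
  (nu : probability (symbolic_space hb) R).
Variables (d e : R) (t : 'I_a -> R) (s : 'I_b -> R).
Hypotheses (d01 : 0 < d < 1) (e01 : 0 < e < 1).

Definition attractor_point : symbolic_space ha * symbolic_space hb -> R * R :=
  plane_point (canonical_map (affine_ifs d t)) (canonical_map (affine_ifs e s)).

Lemma measurable_attractor_point : measurable_fun setT attractor_point.
Proof. by apply: measurable_plane_point; apply: measurable_canonical_map. Qed.

Lemma attractor_point_bound w :
  let B := Num.max (word_bound d t) (word_bound e s) in
  (- B <= (attractor_point w).1 <= B) /\ (- B <= (attractor_point w).2 <= B).
Proof.
have h1 := canonical_map_dist t d01 0 w.1.
have h2 := canonical_map_dist s e01 0 w.2.
rewrite expr0 mul1r /word_value /= subr0 in h1; rewrite expr0 mul1r /word_value /= subr0 in h2.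
by rewrite /attractor_point /=; split; rewrite -ler_norml le_max; apply/orP; [left|right].
Qed.

Lemma attractor_point_dist n m w (k : R) : d ^+ n <= k -> e ^+ m <= k ->
  `|(attractor_point w).1 - word_value d t (prefix (@letter a ha) n w.1)|
    <= k * word_bound d t /\
  `|(attractor_point w).2 - word_value e s (prefix (@letter b hb) m w.2)|
    <= k * word_bound e s.
Proof.
move=> dk ek; split.
  apply: (le_trans (canonical_map_dist t d01 n w.1)).
  by rewrite ler_wpM2r// word_bound_ge0.
apply: (le_trans (canonical_map_dist s e01 m w.2)).
by rewrite ler_wpM2r// word_bound_ge0.
Qed.

Variables (s1 sg : R).
Hypotheses (s1_gt0 : 0 < s1) (s1_lt_sg : s1 < sg).
Hypothesis null : forall E, measurable E -> hausdorff_measure sg E = 0%E ->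
  Pr (joint mu nu) (attractor_point @^-1` E) = 0.

(** The weight of a pair of words is the mass of its cylinder inside the light set. Words of scale
    [k] determine the point up to [k] times the word bounds, so a box of radius [rad >= k] only
    grows by the factor [C]. *)
Lemma frostman_words_attractor :
  frostman_words d e t s (word_prob mu) (word_prob nu) s1.
Proof.
move=> eta eta0; set P := joint mu nu; set V := attractor_point.
pose Bd := word_bound d t; pose Be := word_bound e s.
have Bd0 : 0 <= Bd by apply: word_bound_ge0.
have Be0 : 0 <= Be by apply: word_bound_ge0.
have mV : measurable_fun setT V := measurable_attractor_point.
have [i0 Hi0] := exists_light_set mV attractor_point_bound s1_gt0 s1_lt_sg null eta0.
set G := light_set P V (Num.max Bd Be) s1 i0.
have mG : measurable G by apply: measurable_light_set.
pose C := 1 + Bd + Be; have C0 : 0 < C by rewrite /C; lra.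
pose CF := (9 * 2 `^ s1 + (2 ^+ i0) `^ s1) * C `^ s1.
exists CF => n m k k0 dk ek.
exists (fun x y => Pr P (G `&` words2 (size x) (size y) x y)); split.
- move=> x y; rewrite Pr_ge0 -Pr_words2 le_Pr//.
  + by apply: measurableI => //; apply: measurable_words2.
  + exact: measurable_words2.
- have -> : wsum2 n m (fun x y => Pr P (G `&` words2 (size x) (size y) x y)) = Pr P G.
    rewrite (Pr_joint_words2 mu nu n m mG); apply/eqP; rewrite eq_le.
    by apply/andP; split; apply: le_wsum2 => x y -> ->.
  by rewrite Pr_setC ?lerD2l ?lerN2//; apply: measurable_preimage => //;
    apply: measurable_heavy_tail.
move=> z1 z2 rad krad; have rad0 : 0 < rad by apply: lt_le_trans krad.
have C1 : 0 < C * rad by rewrite mulr_gt0.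
have mb : measurable (G `&` V @^-1` box (z1, z2) (C * rad)).
  by apply: measurableI => //; apply: measurable_preimage => //; apply: measurable_box.
apply: (@le_trans _ _ (Pr P (G `&` V @^-1` box (z1, z2) (C * rad)))); last first.
  rewrite /CF -mulrA -powRM ?(ltW C0) ?(ltW rad0)//.
  exact: (Pr_light_box_le P mV attractor_point_bound s1_gt0 i0 (z1, z2) C1).
rewrite (Pr_joint_words2 mu nu n m mb); apply: le_wsum2 => x y sx sy.
have mw := measurable_words2 n m x y.
rewrite sx sy; case: (boolP (_ && _)) => [/andP[h1 h2]|_]; last first.
  by rewrite mulr0 Pr_ge0.
rewrite mulr1 le_Pr//; [exact: measurableI|exact: measurableI|].
move=> w [Gw wxy]; split => //; split => //; case: (wxy) => w1 w2.
have [g1 g2] := attractor_point_dist w dk ek; rewrite w1 w2 in g1 g2.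
have kB : k * Bd <= rad * Bd /\ k * Be <= rad * Be by rewrite !ler_wpM2r.
have rB : 0 <= rad * Bd /\ 0 <= rad * Be by split; apply: mulr_ge0 => //; apply: ltW.
have CE : C * rad = rad + rad * Bd + rad * Be by rewrite /C; ring.
rewrite /box /= CE; case: kB rB => [k1 k2] [k3 k4].
split.
  by apply: le_trans (ler_distD (word_value d t x) _ _) _; rewrite /= -/Bd in g1; lra.
by apply: le_trans (ler_distD (word_value e s y) _ _) _; rewrite /= -/Be in g2; lra.
Qed.

End FrostmanFromDimension.
(** * Projections of the product measure *)

Section ProjectionFormula.
Variable R : realType.

(** Orthogonal projection onto the line spanned by (1, c). *)
Definition slope_projection (c : R) (x : R * R) : R * R :=
  ((x.1 + c * x.2) / (1 + c ^+ 2), c * ((x.1 + c * x.2) / (1 + c ^+ 2))).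

Lemma projections_slope (p : R * R -> R * R) : projections p ->
  p <> @pi_horizontal R -> p <> @pi_vertical R ->
  exists2 c : R, c != 0 & p = slope_projection c.
Proof.
move=> [_ [[u1 u2] u0 ->] orth] ph pv.
have sum0 : u1 ^+ 2 + u2 ^+ 2 != 0.
  rewrite paddr_eq0 ?sqr_ge0// !expf_eq0 /=; apply/negP => /andP[/eqP a1 /eqP a2].
  by apply: u0; rewrite a1 a2.
have pE x : exists2 k, p x = (k * u1, k * u2) &
    k * (u1 ^+ 2 + u2 ^+ 2) = x.1 * u1 + x.2 * u2.
  have [[k _ kE] /(_ (1 * u1, 1 * u2))] := orth x.
  rewrite -kE /inner /= => H; exists k => //.
  have /H : exists2 k : R, [set: R] k & (k * u1, k * u2) = (1 * u1, 1 * u2).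
    by exists 1.
  by rewrite !mul1r; lra.
have [u10|u10] := eqVneq u1 0.
  exfalso; apply: pv; apply/funext => x; have [k -> kE] := pE x.
  rewrite u10 mulr0 /pi_vertical; congr pair; apply: (@mulIf _ u2).
    by apply: contraNneq sum0 => u20; rewrite u10 u20 expr0n addr0.
  by move: kE; rewrite u10; lra.
have [u20|u20] := eqVneq u2 0.
  exfalso; apply: ph; apply/funext => x; have [k -> kE] := pE x.
  rewrite u20 mulr0 /pi_horizontal; congr pair; apply: (@mulIf _ u1) => //.
  by move: kE; rewrite u20; lra.
exists (u2 / u1); first by rewrite mulf_neq0 ?invr_eq0.
apply/funext => x; have [k -> kE] := pE x.
have -> : k = (x.1 * u1 + x.2 * u2) / (u1 ^+ 2 + u2 ^+ 2) by rewrite -kE mulfK.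
have h : 1 + (u2 / u1) ^+ 2 != 0 by rewrite gt_eqF// ltr_pwDl ?sqr_ge0.
have sum0' : u1 * u1 + u2 * u2 != 0 by rewrite -!expr2.
by rewrite /slope_projection; congr pair; field; rewrite ?u10 ?sum0 ?andbT//.
Qed.

Variable c : R.
Local Notation p := (slope_projection c).

Let k_gt0 : 0 < 1 + c ^+ 2. Proof. by rewrite ltr_pwDl ?sqr_ge0. Qed.

Lemma measurable_slope_projection : measurable_fun setT p.
Proof.
have m : measurable_fun setT (fun x : R * R => (x.1 + c * x.2) / (1 + c ^+ 2)).
  apply: measurable_funM; last exact: measurable_cst.
  apply: measurable_funD; first exact: measurable_fst.
  by apply: measurable_funM; [exact: measurable_cst|exact: measurable_snd].
by apply: measurable_fun_pair => //; apply: measurable_funM.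
Qed.

Lemma slope_projection_box x z r : box z r x ->
  box (p z) ((1 + `|c|) ^+ 2 * r) (p x).
Proof.
case=> h1 h2; have r0 : 0 <= r by apply: le_trans h1.
have ca := normr_ge0 c.
have h : `|(x.1 + c * x.2) / (1 + c ^+ 2) - (z.1 + c * z.2) / (1 + c ^+ 2)| <=
    (1 + `|c|) * r.
  rewrite -mulrBl normrM normfV (gtr0_norm k_gt0) ler_pdivrMr//.
  apply: (@le_trans _ _ ((1 + `|c|) * r)); last first.
    by rewrite ler_peMr ?mulr_ge0 ?addr_ge0// lerDl sqr_ge0.
  rewrite (_ : _ - _ = (x.1 - z.1) + c * (x.2 - z.2)); last by ring.
  by apply: (le_trans (ler_normD _ _)); rewrite normrM mulrDl mul1r lerD// ler_wpM2l.
have C0 : 0 <= (1 + `|c|) * r by rewrite mulr_ge0// addr_ge0.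
split => /=; rewrite expr2 -mulrA.
  by apply: (le_trans h); rewrite ler_peMl// lerDl.
by rewrite -mulrBr normrM ler_pM// lerDr.
Qed.

Lemma strip_of_box z r x : box z r (p x) ->
  `|x.1 + c * x.2 - (1 + c ^+ 2) * z.1| <= (1 + c ^+ 2) * r.
Proof.
case=> h _; move: h => /=; rewrite -(ler_pM2l k_gt0).
rewrite -{1}(gtr0_norm k_gt0) -normrM mulrBr mulrCA divff ?mulr1//.
exact: lt0r_neq0.
Qed.

End ProjectionFormula.

(** * Null sets, their projections, and segments *)

Section DimensionBounds.
Variable R : realType.
Local Notation plane := (R * R)%type.
Implicit Types (E : set plane) (r s : R) (m : set plane -> \bar R).

Lemma hausdorff_measure0_le s s' E : 0 <= s <= s' ->
  hausdorff_measure s E = 0%E -> hausdorff_measure s' E = 0%E.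
Proof.
move=> /andP[s0 ss'] H; apply: hausdorff_measure_eq0 => e eps e0 eps0.
have e1 : 0 < Num.min e 1 by rewrite lt_min e0 ltr01.
have : (hausdorff_premeasure s (Num.min e 1%R) E < eps%:E)%E.
  by rewrite (hausdorff_measure0_premeasure e1 H) lte_fin.
move=> /ereal_inf_lt[_ [U [EU dU] <-] sumU].
apply: (@le_trans _ _ (\sum_(n <oo) diameter_power s' (U n))%E).
  apply: ereal_inf_lbound; exists U => //; split => // n.
  by apply: le_trans (dU n) _; rewrite lee_fin ge_min lexx.
apply: le_trans (ltW sumU); apply: lee_nneseries => n _.
  by move=> _; apply: diameter_power_ge0.
rewrite /diameter_power; case: asboolP => [//|/eqP/set0P[x Ux]].
have d0 := diameter_ge0 Ux; have d1 : (diameter (U n) <= 1%:E)%E.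
  by apply: le_trans (dU n) _; rewrite lee_fin ge_min lexx orbT.
have fd : diameter (U n) \is a fin_num.
  by rewrite ge0_fin_numE//; apply: le_lt_trans d1 _; rewrite ltry.
move: d0 d1; rewrite -(fineK fd) !lee_fin; move: (fine _) => v v0 v1.
have [->|vn0] := eqVneq v 0.
  have [sE|sn0] := eqVneq s 0.
    by rewrite sE powRr0 /powR eqxx lern1 leq_b1.
  have sgt0 : 0 < s by rewrite lt_def sn0.
  by rewrite !powR0// gt_eqF// (lt_le_trans sgt0).
by apply: ger_powR => //; rewrite v1 andbT lt_def vn0.
Qed.

Lemma lower_hausdorff_dim_le m E s : measurable E -> (0 < m E)%E -> 0 <= s ->
  hausdorff_measure s E = 0%E -> (lower_hausdorff_dim m <= s%:E)%E.
Proof.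
move=> mE mE0 s0 H; apply: (@le_trans _ _ (hausdorff_dim E)).
  by apply: ereal_inf_lbound; exists E.
by apply: ereal_inf_lbound; exists s.
Qed.

Lemma le_lower_hausdorff_dim m (x : \bar R) :
  (forall E s, measurable E -> (0 < m E)%E -> 0 <= s ->
    hausdorff_measure s E = 0%E -> (x <= s%:E)%E) ->
  (x <= lower_hausdorff_dim m)%E.
Proof.
move=> H; apply: le_ereal_inf_tmp => _ [E [mE mE0] <-].
by apply: le_ereal_inf_tmp => _ [s [s0 Hs] <-]; apply: (H E).
Qed.

(* The intersection over [j] of the unions of image boxes is a measurable
   null set whose preimage contains [E]. *)
Lemma projection_hull c s E : 0 < s -> hausdorff_measure s E = 0%E ->
  exists F, [/\ measurable F, hausdorff_measure s F = 0%E &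
    E `<=` slope_projection c @^-1` F].
Proof.
move=> s0 H; pose C := (1 + `|c|) ^+ 2; pose p := slope_projection c.
have C0 : 0 < C by rewrite exprn_gt0// ltr_pwDl.
have ej (j : nat) : 0 < (j.+1%:R)^-1 :> R by rewrite invr_gt0.
have hz (j : nat) : exists zr : (nat -> plane) * (nat -> R),
    [/\ forall n, 0 < zr.2 n <= (j.+1%:R)^-1, E `<=` \bigcup_n box (zr.1 n) (zr.2 n) &
      forall N, \sum_(n < N) zr.2 n `^ s <= (j.+1%:R)^-1].
  by have [z [r zr]] := hausdorff_measure0_boxes s0 H (ej j); exists (z, r).
have [zr zrP] := choice hz.
pose F := \bigcap_j \bigcup_n box (p ((zr j).1 n)) (C * (zr j).2 n).
exists F; split.
- apply: bigcapT_measurable => j; apply: bigcupT_measurable => n.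
  exact: measurable_box.
- apply: hausdorff_measure0_of_lists => // eps eps0.
  have [j hj] := exists_nat_ge ((C + C `^ s) / eps).
  have C1 : 0 < C `^ s by rewrite powR_gt0.
  have h : (C + C `^ s) * (j.+1%:R)^-1 <= eps.
    rewrite ler_pdivrMr// mulrC -ler_pdivrMr// (le_trans hj)//.
    by rewrite ler_nat.
  have [h1 h2] : C * (j.+1%:R)^-1 <= eps /\ C `^ s * (j.+1%:R)^-1 <= eps.
    by split; apply: le_trans h; rewrite ler_pM2r// ?lerDl ?lerDr ltW.
  have [rP _ sP] := zrP j.
  exists (fun n => [:: (p ((zr j).1 n), C * (zr j).2 n)]); split.
  + move=> n b; rewrite inE => /eqP -> /=; have /andP[r0 r1] := rP n.
    by rewrite mulr_ge0 ?(ltW r0) ?(ltW C0)//= (le_trans _ h1)// ler_pM2l.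
  + move=> x /(_ j I)[n _ hx]; exists n.
    by exists (p ((zr j).1 n), C * (zr j).2 n); rewrite ?mem_head.
  + move=> N; apply: le_trans h2.
    apply: (@le_trans _ _ (C `^ s * \sum_(n < N) (zr j).2 n `^ s)).
      rewrite mulr_sumr; apply: ler_sum => n _; rewrite big_seq1 /=.
      by rewrite powRM ?(ltW C0)//; have /andP[/ltW] := rP n.
    by rewrite ler_pM2l.
- move=> x Ex j _; have [_ /(_ x Ex)[n _ bx] _] := zrP j.
  by exists n => //; apply: slope_projection_box.
Qed.

Definition segment (c B : R) : set plane :=
  [set x | x.2 = c * x.1 /\ `|x.1| <= B].

Lemma measurable_segment c B : measurable (segment c B).
Proof.
have m2 : measurable_fun setT (fun x : plane => x.2 - c * x.1).
  by apply: measurable_funB; [|apply: measurable_funM].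
rewrite (_ : segment c B = (fun x : plane => x.2 - c * x.1) @^-1` [set 0] `&`
    (fst @^-1` [set` `[- B, B]])).
  apply: measurableI; rewrite -[X in measurable X]setTI.
    exact: m2.
  exact: measurable_fst.
apply/seteqP; split => x; rewrite /segment /= in_itv /= -ler_norml.
  by case=> -> ->; rewrite subrr.
by case=> /eqP; rewrite subr_eq0 => /eqP.
Qed.

(** O(2^i) boxes of radius O(2^-i) suffice, with power sum O(2^(i (1 - s))). *)
Lemma hausdorff_measure_segment c B s : 1 < s ->
  hausdorff_measure s (segment c B) = 0%E.
Proof.
move=> s1; have s0 : 0 < s by lra.
have ca := normr_ge0 c; have Ba := normr_ge0 B.
pose C := 1 + `|c|; have C0 : 0 < C by rewrite /C; lra.
have kap01 : 0 < (2 `^ (1 - s) : R) < 1.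
  by rewrite powR2_itv// subr_lt0.
apply: hausdorff_measure0_of_lists => // eps eps0.
pose D := (2 * `|B| + 1) * C `^ s; have D0 : 0 < D.
  by rewrite mulr_gt0 ?powR_gt0//; lra.
have [n1 H1] := linear_geometric_small (lexx 0) kap01 (divr_gt0 eps0 D0).
have h01 : 0 < (2^-1 : R) < 1 by apply/andP; split; lra.
have [n2 H2] := linear_geometric_small (lexx 0) h01 (divr_gt0 eps0 C0).
pose i := maxn n1 n2.
have {}H1 := H1 i (leq_maxl _ _); have {}H2 := H2 i (leq_maxr _ _).
rewrite mul0r add0r mul1r ler_pdivlMr// in H1.
rewrite mul0r add0r mul1r exprVn ler_pdivlMr// in H2.
pose q k : plane := (k%:R / 2 ^+ i - `|B|, c * (k%:R / 2 ^+ i - `|B|)).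
pose l := [seq (q k, C * (2 ^+ i)^-1) | k <- iota 0 (dcoord `|B| i `|B|).+1].
exists (fun j => if j is 0%N then l else [::]); split.
- move=> [|j] b //= /mapP[k _ ->] /=.
  by rewrite mulr_ge0 ?(ltW C0) ?invr_ge0 ?exprn_ge0// mulrC.
- move=> x [x2 x1]; exists 0%N; have xB : `|x.1| <= `|B| by apply: (le_trans x1); apply: ler_norm.
  have /andP[x3 x4] : - `|B| <= x.1 <= `|B| by rewrite -ler_norml.
  exists (q (dcoord `|B| i x.1), C * (2 ^+ i)^-1).
    apply/mapP; exists (dcoord `|B| i x.1) => //.
    by rewrite mem_iota add0n ltnS /dcoord le_truncn// ler_pM2l ?exprn_gt0// lerD2r.
  have hd : x.1 \in dyadic `|B| (dcoord `|B| i x.1) i by rewrite mem_dyadic.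
  have hx := dyadic_dist hd; have i2 : 0 <= (2 ^+ i)^-1 :> R by rewrite invr_ge0 exprn_ge0.
  have [c1 c2] : 1 <= C /\ `|c| <= C by rewrite /C; split; lra.
  split => /=; first by apply: (le_trans hx); rewrite ler_peMl.
  by rewrite x2 -mulrBr normrM ler_pM.
have p2 : 0 < 2 ^+ i :> R by rewrite exprn_gt0.
have suml : \sum_(b <- l) b.2 `^ s <= eps.
  have -> : \sum_(b <- l) b.2 `^ s =
      \sum_(k <- iota 0 (dcoord `|B| i `|B|).+1) (C * (2 ^+ i)^-1) `^ s.
    exact: big_map.
  rewrite big_const_seq count_predT iter_addr_0 size_iota.
  rewrite -[leLHS]mulr_natl powRM ?invr_ge0 ?(ltW C0) ?(ltW p2)//.
  have -> : (2 ^+ i)^-1 `^ s = (2 ^+ i)^-1 * (2 `^ (1 - s)) ^+ i :> R.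
    rewrite -powR_mulrn ?powR_ge0// -powRrM -powR_invn// -powRrM -powRD.
      by congr powR; ring.
    by rewrite pnatr_eq0 implybT.
  apply: le_trans H1; rewrite /D.
  have cnt : (dcoord `|B| i `|B|).+1%:R <= 2 ^+ i * (2 * `|B| + 1) :> R.
    rewrite -natr1 mulrDr mulr1 lerD//; last by rewrite exprn_ege1// ler1n.
    have v0 : 0 <= 2 ^+ i * (`|B| + `|B|) by rewrite mulr_ge0 ?addr_ge0// ltW.
    have /andP[h _] := truncn_itv v0; apply: (le_trans h).
    by rewrite mulr_natl mulr2n.
  have -> : 2 `^ (1 - s) ^+ i * ((2 * `|B| + 1) * C `^ s) =
      2 ^+ i * (2 * `|B| + 1) * (C `^ s * ((2 ^+ i)^-1 * 2 `^ (1 - s) ^+ i)).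
    by field; rewrite expf_neq0.
  by rewrite ler_wpM2r// !mulr_ge0 ?powR_ge0 ?exprn_ge0 ?powR_ge0 ?invr_ge0 ?(ltW p2).
case=> [|N]; first by rewrite big_ord0 ltW.
by rewrite big_ord_recl /= [X in _ + X]big1 ?addr0// => j _; rewrite big_nil.
Qed.

End DimensionBounds.

(** * Null sets of the projected measure *)

Section ProjectedMeasure.
Variables (R : realType) (a b : nat) (ha : (2 <= a)%N) (hb : (2 <= b)%N).
Variables (mu : probability (symbolic_space ha) R)
  (nu : probability (symbolic_space hb) R).
Variables (d e : R) (t : 'I_a -> R) (s : 'I_b -> R) (c : R).
Hypotheses (d01 : 0 < d < 1) (e01 : 0 < e < 1).
Hypothesis irr : irrational (ln d / ln e).
Hypothesis c_neq0 : c != 0.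
Hypotheses (hmu : shift_invariant mu) (hnu : shift_invariant nu).

Local Notation V := (@attractor_point R a b ha hb d e t s).
Local Notation P := (joint mu nu).

Let mV : measurable_fun setT V.
Proof. exact: measurable_attractor_point. Qed.

Definition strip (zr : R * R) : set (R * R) :=
  [set x | `|x.1 + c * x.2 - zr.1| <= zr.2].

Lemma measurable_strip zr : measurable (strip zr).
Proof.
have m : measurable_fun setT (fun x : R * R => x.1 + c * x.2).
  by apply: measurable_funD; [|apply: measurable_funM].
rewrite (_ : strip zr = (fun x : R * R => x.1 + c * x.2) @^-1`
    [set` `[zr.1 - zr.2, zr.1 + zr.2]]).
  by rewrite -[X in measurable X]setTI; apply: m.
by apply/seteqP; split => x; rewrite /strip /= in_itv /= ler_distl.
Qed.

Definition vstrip zr := V @^-1` strip zr.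

Lemma measurable_vstrip zr : measurable (vstrip zr).
Proof. by apply: measurable_preimage => //; apply: measurable_strip. Qed.

Variables (s0 s1 : R).
Hypotheses (s0_gt0 : 0 < s0) (s01 : s0 < s1) (s1_le1 : s1 <= 1).
Hypothesis frostman : frostman_words d e t s (word_prob mu) (word_prob nu) s1.

(** Long words determine the attractor point to within the smallest radius of the list, so doubling
    the radii transfers [words_measure_le]; hence its freedom to take words beyond any [n0]. *)
Lemma Pr_strips_le (eta : R) : 0 < eta -> exists2 Cst : R, 0 <= Cst &
  forall L : seq (R * R), (forall zr, zr \in L -> 0 < zr.2) ->
    Pr P (some_of vstrip L) <= eta + Cst * \sum_(zr <- L) zr.2 `^ s0.
Proof.
move=> eta0; have sp := stationary_word_prob hmu.
have sq := stationary_word_prob hnu.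
have [Cst C0 HC] := words_measure_le d01 e01 irr c_neq0 sp sq s0_gt0 s01 s1_le1
  frostman eta0.
exists (Cst * 2 `^ s0) => [|L L0]; first by rewrite mulr_ge0 ?powR_ge0.
have [k k0 kL] : exists2 k : R, 0 < k & forall zr, zr \in L -> k <= zr.2.
  have [J /(_ J (leqnn J)) kL] := exists_pow_le_all d01 L0.
  by exists (d ^+ J) => //; rewrite exprn_gt0//; case/andP: d01.
pose Bd := word_bound d t; pose Be := word_bound e s.
have Bd0 : 0 <= Bd by apply: word_bound_ge0.
have Be0 : 0 <= Be by apply: word_bound_ge0.
pose C := 1 + Bd + `|c| * Be.
have cB : 0 <= `|c| * Be by rewrite mulr_ge0.
have Cgt0 : 0 < C by rewrite /C; lra.
have kC : 0 < k / C by rewrite divr_gt0.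
have [n1 H1] := linear_geometric_small (lexx 0) d01 kC.
have [n2 H2] := linear_geometric_small (lexx 0) e01 kC.
pose L2 := [seq (zr.1, 2 * zr.2) | zr <- L].
have L20 zr : zr \in L2 -> 0 < zr.2.
  by case/mapP => z zL -> /=; rewrite mulr_gt0// L0.
have [n [m [nn mm]]] := HC L2 L20 (maxn n1 n2).
have {}H1 := H1 n (leq_trans (leq_maxl _ _) nn).
have {}H2 := H2 m (leq_trans (leq_maxr _ _) mm).
rewrite mul0r add0r mul1r in H1; rewrite mul0r add0r mul1r in H2.
have -> : \sum_(zr <- L2) zr.2 `^ s0 = 2 `^ s0 * \sum_(zr <- L) zr.2 `^ s0.
  rewrite big_map mulr_sumr big_seq [RHS]big_seq; apply: eq_bigr => zr zL /=.
  by rewrite powRM// ltW// L0.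
rewrite mulrA; apply: le_trans; apply: Pr_joint_le_expect.
  by apply: measurable_some_of; apply: measurable_vstrip.
move=> w [zr zL hw]; rewrite has_map; apply/hasP; exists zr => //=.
have [g1 g2] := attractor_point_dist t s d01 e01 w H1 H2.
have kz := kL _ zL; move: hw; rewrite /vstrip /strip /= => hw.
move: g1 g2 hw; rewrite /=.
move: (canonical_map _ w.1) (canonical_map _ w.2) => v1 v2.
move: (word_value d t _) (word_value e s _) => x y g1 g2 hw.
have e1 : k / C * Bd + `|c| * (k / C * Be) <= k.
  rewrite (_ : _ + _ = k * ((Bd + `|c| * Be) / C)); last by ring.
  by rewrite ler_piMr ?(ltW k0)// ler_pdivrMr// /C; lra.
have e2 : `|c * (v2 - y)| <= `|c| * (k / C * Be) by rewrite normrM ler_wpM2l.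
rewrite (_ : x + c * y - zr.1 = (v1 + c * v2 - zr.1) - ((v1 - x) + c * (v2 - y))); last by ring.
apply: (le_trans (ler_normB _ _)); have := ler_normD (v1 - x) (c * (v2 - y)).
rewrite -/Bd in g1; lra.
Qed.

(** Boxes covering [E] pull back to countably many strips, while [Pr_strips_le] treats finite
    families; continuity from above leaves at most a third of [eta] outside finitely many of
    them. *)
Lemma Pr_projected_null E : measurable E -> hausdorff_measure s0 E = 0%E ->
  Pr P (V @^-1` (slope_projection c @^-1` E)) = 0.
Proof.
move=> mE H; set Q := V @^-1` _.
have mQ : measurable Q.
  apply: measurable_preimage => //; rewrite -[X in measurable X]setTI.
  exact: measurable_slope_projection.
apply/eqP; rewrite eq_le Pr_ge0 andbT; apply/ler_addgt0Pr => eta eta0.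
have eta3 : 0 < eta / 3 by lra.
have [Cst C0 HC] := Pr_strips_le eta3.
pose k := 1 + c ^+ 2; have k0 : 0 < k by rewrite ltr_pwDl ?sqr_ge0.
have D0 : 0 < 1 + Cst * k `^ s0.
  by rewrite ltr_pwDl// mulr_ge0// powR_ge0.
have [z [r [rP EP sP]]] := hausdorff_measure0_boxes s0_gt0 H (divr_gt0 eta3 D0).
pose L N := [seq (k * (z n).1, k * r n) | n <- iota 0 N].
have Lpos N zr : zr \in L N -> 0 < zr.2.
  by case/mapP => n _ ->; rewrite mulr_gt0//; case/andP: (rP n).
have mL N : measurable (some_of vstrip (L N)).
  by apply: measurable_some_of; apply: measurable_vstrip.
have [N hN] : exists N, Pr P (Q `\` some_of vstrip (L N)) <= eta / 3.
  apply: Pr_bigcap_small => //.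
  - by move=> N; apply: measurableD.
  - move=> N M NM w [Qw h]; split => // -[zr zrL hw]; apply: h; exists zr => //.
    case/mapP: zrL => n; rewrite mem_iota => /andP[_ nN] ->.
    by apply/mapP; exists n => //; rewrite mem_iota (leq_trans nN).
  rewrite (_ : \bigcap_n _ = set0) ?Pr_set0//; apply/seteqP; split => // w hw.
  have [Qw _] := hw 0%N I; have [n _ bn] := EP _ Qw.
  have [_] := hw n.+1 I; apply; exists (k * (z n).1, k * r n).
    by apply/mapP; exists n => //; rewrite mem_iota add0n ltnSn.
  exact: strip_of_box.
have h : Pr P Q <= Pr P (Q `\` some_of vstrip (L N)) + Pr P (some_of vstrip (L N)).
  apply: le_trans (PrU_le _ _ _) => //; last exact: measurableD.
  apply: le_Pr => //; first by apply: measurableU => //; apply: measurableD.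
  by move=> w Qw; have [|] := pselect (some_of vstrip (L N) w); [right|left].
have hL := HC _ (@Lpos N).
have hs : Cst * \sum_(zr <- L N) zr.2 `^ s0 <= eta / 3.
  rewrite big_map /=.
  have -> : \sum_(j <- iota 0 N) (k * r j) `^ s0 = k `^ s0 * \sum_(n < N) r n `^ s0.
    rewrite mulr_sumr -(big_mkord xpredT (fun n => k `^ s0 * r n `^ s0)).
    rewrite /index_iota subn0; apply: eq_bigr => n _.
    by rewrite powRM ?(ltW k0)//; case/andP: (rP n) => /ltW.
  rewrite mulrA; apply: (@le_trans _ _ (Cst * k `^ s0 * (eta / 3 / (1 + Cst * k `^ s0)))).
    by rewrite ler_wpM2l// mulr_ge0 ?powR_ge0.
  rewrite mulrCA ler_piMr ?(ltW eta3)// ler_pdivrMr// mul1r lerDr.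
  exact: ler01.
by rewrite add0r; lra.
Qed.

End ProjectedMeasure.
Theorem theorem1p1 (R : realType) (a b : nat)
    (ha : (2 <= a)%N) (hb : (2 <= b)%N) (delta rho : R)
    (hdelta : 0 < delta < 1) (hrho : 0 < rho < 1)
    (t : 'I_a -> R) (s : 'I_b -> R)
    (mu : probability (symbolic_space ha) R)
    (nu : probability (symbolic_space hb) R)
    (hmu : shift_invariant mu) (hnu : shift_invariant nu)
    (hirr : irrational (ln delta / ln rho)) :
  let PhiI := @canonical_map R a ha (affine_ifs delta t) in
  let PhiJ := @canonical_map R b hb (affine_ifs rho s) in
  let product := (pushforward mu PhiI \x pushforward nu PhiJ)%E in
  forall p : R * R -> R * R, projections p ->
    p <> @pi_horizontal R -> p <> @pi_vertical R ->
    lower_hausdorff_dim (pushforward product p) =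
      Order.min 1%E (lower_hausdorff_dim product).
Proof.
move=> PhiI PhiJ product p pP ph pv.
have [c c0 pE] := projections_slope pP ph pv.
pose V := @attractor_point R a b ha hb delta rho t s.
have mV : measurable_fun setT V by apply: measurable_attractor_point.
have mp : measurable_fun setT p by rewrite pE; apply: measurable_slope_projection.
have mpre (E : set (R * R)) : measurable E -> measurable (p @^-1` E).
  by move=> mE; rewrite -[X in measurable X]setTI; apply: mp.
have prodE (E : set (R * R)) : measurable E ->
    product E = (Pr (joint mu nu) (V @^-1` E))%:E.
  move=> mE; rewrite -PrE; last exact: measurable_preimage.
  by apply: product_pushforwardE => //; apply: measurable_canonical_map.
have projE (E : set (R * R)) : measurable E ->
    pushforward product p E = (Pr (joint mu nu) (V @^-1` (p @^-1` E)))%:E.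
  by move=> mE; rewrite -prodE//; apply: mpre.
apply/eqP; rewrite eq_le; apply/andP; split.
  rewrite le_min; apply/andP; split.
    (* The segment carries the whole projected measure and is null in every dimension [1 + eps]. *)
    apply/lee_addgt0Pr => eps eps0; rewrite -EFinD.
    pose B := Num.max (word_bound delta t) (word_bound rho s).
    apply: (@lower_hausdorff_dim_le _ _ (segment c ((1 + `|c|) * B))).
    - exact: measurable_segment.
    - rewrite projE; last exact: measurable_segment.
      rewrite (_ : V @^-1` _ = setT) ?Pr_setT ?lte_fin//.
      apply/seteqP; split => // w _.
      have [] := @attractor_point_bound R a b ha hb delta rho t s hdelta hrho w.
      rewrite -/V -/B -!ler_norml pE => h1 h2; split => //=.
      have k1 : 1 <= 1 + c ^+ 2 by rewrite lerDl sqr_ge0.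
      have k0 : 0 < 1 + c ^+ 2 by apply: lt_le_trans k1.
      rewrite normrM normfV (gtr0_norm k0) ler_pdivrMr//.
      have B0 : 0 <= (1 + `|c|) * B.
        by rewrite mulr_ge0 ?addr_ge0// (le_trans _ h1).
      apply: (@le_trans _ _ ((1 + `|c|) * B)); last by rewrite ler_peMr.
      apply: (le_trans (ler_normD _ _)); rewrite normrM mulrDl mul1r lerD//.
      by rewrite ler_wpM2l.
    - by rewrite addr_ge0// ltW.
    - by apply: hausdorff_measure_segment; rewrite ltrDl.
  apply: le_lower_hausdorff_dim => E sg mE E0 sg0 H.
  (* Raising the exponent makes it positive even when [sg] is 0, as [projection_hull] requires. *)
  apply/lee_addgt0Pr => eps eps0; rewrite -EFinD.
  have sge : 0 < sg + eps by rewrite ltr_wpDl.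
  have He : hausdorff_measure (sg + eps) E = 0%E.
    by apply: hausdorff_measure0_le H; rewrite sg0 lerDl ltW.
  have [F [mF HF EF]] := projection_hull c sge He.
  apply: (lower_hausdorff_dim_le mF _ (ltW sge) HF).
  rewrite projE//; move: E0; rewrite prodE// !lte_fin => /lt_le_trans; apply.
  rewrite le_Pr//; try (apply: measurable_preimage => //); first exact: mpre.
  by move=> w /EF; rewrite -pE.
apply: le_lower_hausdorff_dim => E sg mE E0 sg0 H.
rewrite leNgt; apply/negP => sgm.
(* The minimum exceeds [sg] and is at most 1, hence is a real number. *)
have [al alm sgal] : exists2 al : R,
  (al%:E <= Order.min 1 (lower_hausdorff_dim product))%E & sg < al.
  have m1 : (Order.min 1 (lower_hausdorff_dim product) <= 1%:E)%E.
    by rewrite ge_min lexx.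
  move: sgm m1; case: (Order.min _ _) => [al| |] //; rewrite lte_fin => h _.
  by exists al.
have [al1 aldim] : al <= 1 /\ (al%:E <= lower_hausdorff_dim product)%E.
  by move: alm; rewrite le_min lee_fin => /andP[].
(* Three exponents fit strictly between [sg] and [al]: [sg + g] for the projected null set, positive
   even if [sg] is 0, [sg + 2 * g] for the Frostman bound, and [sg + 3 * g], whose null sets have
   mass zero. *)
pose g := (al - sg) / 4; have g0 : 0 < g by rewrite /g; lra.
have alE : al = sg + 4 * g by rewrite /g; field.
have null F : measurable F -> hausdorff_measure (sg + 3 * g) F = 0%E ->
    Pr (joint mu nu) (V @^-1` F) = 0.
  move=> mF HF; apply/eqP; rewrite eq_le Pr_ge0 andbT leNgt; apply/negP => F0.
  have h : (0 < product F)%E by rewrite prodE// lte_fin.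
  have s3 : 0 <= sg + 3 * g by lra.
  have := le_trans aldim (lower_hausdorff_dim_le mF h s3 HF).
  by rewrite lee_fin; lra.
have [h1 h2 h3 h4] : [/\ 0 < sg + g, sg + g < sg + 2 * g,
  sg + 2 * g < sg + 3 * g & sg + 2 * g <= 1].
  by split; lra.
have fr := @frostman_words_attractor R a b ha hb mu nu delta rho t s hdelta hrho
  (sg + 2 * g) (sg + 3 * g) (lt_trans h1 h2) h3 null.
have Hg : hausdorff_measure (sg + g) E = 0%E.
  by apply: hausdorff_measure0_le H; apply/andP; split; lra.
have := Pr_projected_null hdelta hrho hirr c0 hmu hnu h1 h2 h4 fr mE Hg.
by move=> Z; move: E0; rewrite projE// pE Z ltxx.
Qed.
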